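(* Let $\mathbb{G}$ be a non-Kac compact quantum group and suppose that there exists a subset $E\subseteq\operatorname{Irr}(\mathbb{G})$ such that $$\sup_{\alpha\in E}\frac{\log\left(\|Q_{\alpha}\|_{op}\|Q_{\alpha}^{-1}\|_{op}\right)}{\log(1+n_{\alpha})}=\infty.$$ For any $C\in(1,2)$, define $\theta:E\rightarrow[0,1]$ by $\theta(\alpha)=1-\dfrac{\log(C)}{\log(1+n_{\alpha})}$. Then the non-degenerate representation $$v_{E,\theta}=\bigoplus_{\alpha\in E}\left(1\otimes Q_{\alpha}^{\frac{\theta(\alpha)}{2}}\right)(u^{\alpha})^c\left(1\otimes Q_{\alpha}^{-\frac{\theta(\alpha)}{2}}\right)\in L^\infty(\mathbb{G})\overline{\otimes}B(H_E),\qquad H_E=\bigoplus_{\alpha\in E}H_\alpha,$$ satisfies $\|v_{E,\theta}\|_{L^{\infty}(\mathbb{G})\overline{\otimes}B(H_E)}\leq C$ and is not unitarizable.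
   Context: A compact quantum group $\mathbb{G}=(L^\infty(\mathbb{G}),\Delta,h)$ (von Neumann algebraic setting) is a von Neumann algebra $L^\infty(\mathbb{G})$ with a coassociative normal unital $*$-homomorphism $\Delta:L^\infty(\mathbb{G})\to L^\infty(\mathbb{G})\overline{\otimes}L^\infty(\mathbb{G})$ and a faithful normal state $h$ (the Haar state) with $(\operatorname{id}\otimes h)\Delta(a)=h(a)1=(h\otimes\operatorname{id})\Delta(a)$. It is of Kac type if $h$ is tracial, and non-Kac otherwise. $L^1(\mathbb{G})=L^\infty(\mathbb{G})_*$. A representation of $\mathbb{G}$ on a Hilbert space $H_V$ is an element $V\in L^\infty(\mathbb{G})\overline{\otimes}B(H_V)$ with $(\Delta\otimes\operatorname{id})(V)=V_{13}V_{23}$; it is non-degenerate if $\operatorname{span}\{(\omega\otimes\operatorname{id})(V)\xi:\omega\in L^1(\mathbb{G}),\xi\in H_V\}$ is dense in $H_V$; it is unitarizable if there is an invertible $T\in B(H_V)$ such that $(1\otimes T)V(1\otimes T^{-1})$ is unitary. For a family of representations $V_i\in L^\infty(\mathbb{G})\overline{\otimes}B(H_i)$ with $\sup_i\|V_i\|<\infty$, the direct sum is $\bigoplus_iV_i=\sum_i(1\otimes t_i)V_i(1\otimes t_i^* )\in L^\infty(\mathbb{G})\overline{\otimes}B(\bigoplus_iH_i)$, where $t_i:H_i\to\bigoplus_iH_i$ is the canonical isometry (strong operator convergence). $\operatorname{Irr}(\mathbb{G})$ is the set of equivalence classes of irreducible unitary representations; for $\alpha\in\operatorname{Irr}(\mathbb{G})$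 fix a representative $u^\alpha=\sum_{i,j=1}^{n_\alpha}u^\alpha_{ij}\otimes e^\alpha_{ij}\in L^\infty(\mathbb{G})\otimes B(H_\alpha)$, $n_\alpha=\dim H_\alpha$. With the antipode $S(u^\alpha_{ij})=(u^\alpha_{ji})^*$ on $\operatorname{Pol}(\mathbb{G})=\operatorname{span}\{u^\alpha_{ij}\}$, $Q_\alpha\in B(H_\alpha)$ is the unique positive invertible operator with $\operatorname{Tr}(Q_\alpha)=\operatorname{Tr}(Q_\alpha^{-1})$ and $(S^2\otimes\operatorname{id})(u^\alpha)=(1\otimes Q_\alpha)u^\alpha(1\otimes Q_\alpha^{-1})$. The orthonormal basis of $H_\alpha$ defining the matrix units $e^\alpha_{ij}$ is chosen so that $Q_\alpha$ is diagonal. The contragredient representation is $(u^\alpha)^c=\sum_{i,j}(u^\alpha_{ij})^*\otimes e^\alpha_{ij}$ with respect to this basis; $(1\otimes Q_\alpha^{1/2})(u^\alpha)^c(1\otimes Q_\alpha^{-1/2})$ is unitary. $\|\cdot\|_{op}$ is the operator norm. *)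

(* Defs.v *)
(* MathComp-Analysis; the complex numbers are R[i] for a realType R. *)
From HB Require Import structures.
From mathcomp Require Import all_boot all_order all_algebra.
From mathcomp Require Import finmap ring.
From mathcomp Require Import all_classical all_reals all_analysis.
From mathcomp Require Import complex.

Set Implicit Arguments.
Unset Strict Implicit.
Unset Printing Implicit Defensive.
Import Order.TTheory GRing.Theory Num.Theory.
Local Open Scope classical_set_scope.
Local Open Scope ring_scope.

(** * Hilbert spaces

    A choice of an orthonormal basis identifies a Hilbert space with the space
    [l2 I] of square-summable families indexed by some set I, so all Hilbert
    spaces below are of this form.  In this model the Hilbert tensor product of
    [l2 I] and [l2 J] is [l2 (I * J)], the Hilbert direct sum of the [l2 (J a)]
    is [l2 {a & J a}], and C^n with its canonical basis is [l2 'I_n]. *)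

Section SquareSummable.
Variables (R : realType) (I : choiceType).
Implicit Types (z : R[i]) (f : I -> R[i]).

Definition abs2 z : R := complex.Re z ^+ 2 + complex.Im z ^+ 2.

Definition sqsum f : \bar R := \esum_(i in [set: I]) (abs2 (f i))%:E.

Definition sqsummable : {pred I -> R[i]} := fun f => (sqsum f < +oo)%E.

Lemma abs2_ge0 z : 0 <= abs2 z.
Proof. by rewrite addr_ge0 ?sqr_ge0. Qed.

Lemma abs2M z w : abs2 (z * w) = abs2 z * abs2 w.
Proof. by case: z => a b; case: w => c d; rewrite /abs2 /=; ring. Qed.

Lemma abs2D z w : abs2 (z + w) <= 2 * abs2 z + 2 * abs2 w.
Proof.
case: z => a b; case: w => c d; rewrite /abs2 /= -subr_ge0.
have -> : 2 * (a ^+ 2 + b ^+ 2) + 2 * (c ^+ 2 + d ^+ 2) -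
  ((a + c) ^+ 2 + (b + d) ^+ 2) = (a - c) ^+ 2 + (b - d) ^+ 2 by ring.
by rewrite addr_ge0 ?sqr_ge0.
Qed.

Lemma sqsum_ge0 f : (0 <= sqsum f)%E.
Proof. by apply: esum_ge0 => i _; rewrite lee_fin abs2_ge0. Qed.

Lemma esumZ_lty (c : R) f : 0 <= c -> f \in sqsummable ->
  (\esum_(i in [set: I]) (c * abs2 (f i))%:E < +oo)%E.
Proof.
move=> c0 fl2; apply: (@le_lt_trans _ _ (c%:E * sqsum f)%E).
  apply: ge_ereal_sup => _ [A [finA _] <-].
  rewrite (eq_fsbigr (fun i => c%:E * (abs2 (f i))%:E)%E); last first.
    by move=> i _; rewrite EFinM.
  rewrite -ge0_mule_fsumr; last by move=> i; rewrite lee_fin abs2_ge0.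
  rewrite lee_wpmul2l ?lee_fin//; apply: esum_ge.
  by exists A => //; split.
by rewrite lte_mul_pinfty ?lee_fin.
Qed.

Lemma sqsummable_submod : submod_closed sqsummable.
Proof.
split=> [|c f g fl2 gl2].
  rewrite unfold_in /sqsum esum1 ?ltry// => i _.
  by rewrite /abs2 /= expr0n/= addr0.
rewrite unfold_in; apply: (@le_lt_trans _ _
  (\esum_(i in [set: I]) ((2 * abs2 c * abs2 (f i))%:E +
                          (2 * abs2 (g i))%:E))%E).
  apply: le_esum => i _; rewrite -EFinD lee_fin -mulrA -abs2M.
  exact: abs2D.
rewrite esumD; first last.
- by move=> i _; rewrite lee_fin mulr_ge0 ?abs2_ge0.
- by move=> i _; rewrite lee_fin !mulr_ge0 ?abs2_ge0.
by rewrite lte_add_pinfty ?esumZ_lty ?mulr_ge0 ?abs2_ge0.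
Qed.

HB.instance Definition _ :=
  GRing.isSubmodClosed.Build R[i] (I -> R[i]) sqsummable sqsummable_submod.

Record l2 := L2 { l2val :> I -> R[i]; _ : l2val \in sqsummable }.

HB.instance Definition _ := [isSub for l2val].
HB.instance Definition _ := [Choice of l2 by <:].
HB.instance Definition _ := [SubChoice_isSubLmodule of l2 by <:].

(* The vector with the given coordinates.  The default value 0 is irrelevant:
   [mkl2] is only meant to be applied to square-summable families. *)
Definition mkl2 f : l2 := insubd (0 : l2) f.

(* Sums of absolutely summable families. *)
Definition rsum (f : I -> R) : R :=
  fine (\esum_(i in [set: I]) (Num.max (f i) 0)%:E) -
  fine (\esum_(i in [set: I]) (Num.max (- f i) 0)%:E).

Definition csum f : R[i] :=
  (rsum (fun i => complex.Re (f i)) +i* rsum (fun i => complex.Im (f i)))%C.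

(* Inner product, linear in the first variable. *)
Definition dot (x y : l2) : R[i] := csum (fun i => x i * (y i)^*%C).

Definition l2norm (x : l2) : R := Num.sqrt (fine (sqsum x)).

Definition bvec (i : I) : l2 := mkl2 (fun j => (j == i)%:R).

End SquareSummable.

Arguments l2 : clear implicits.

Notation op R I J := (l2 R I -> l2 R J).

(** * Bounded operators *)

Section Operators.
Context {R : realType}.
Local Notation op I J := (op R I J).

Definition bounded_op {I J : choiceType} (T : op I J) : Prop :=
  linear T /\ exists c : R, forall x, l2norm (T x) <= c * l2norm x.

Definition opnorm {I J : choiceType} (T : op I J) : R :=
  sup [set l2norm (T x) | x in [set x | l2norm x <= 1]].

(* The bounded operator Y with (Y x, y) = B x y, for a bounded sesquilinear
   form B. *)
Definition op_of_form {I J : choiceType} (B : l2 R I -> l2 R J -> R[i]) : op I J :=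
  xget (0 : op I J)
    [set Y | bounded_op Y /\ forall x y, dot (Y x) y = B x y].

Definition adj {I J : choiceType} (T : op I J) : op J I :=
  op_of_form (fun y x => dot y (T x)).

Definition unitary {I J : choiceType} (T : op I J) : Prop :=
  [/\ bounded_op T, adj T \o T = id & T \o adj T = id].

Definition lin_span {V : lmodType R[i]} (D : set V) : set V :=
  [set v | exists (n : nat) (c : 'I_n -> R[i]) (d : 'I_n -> V),
     (forall i, D (d i)) /\ v = \sum_i c i *: d i].

Definition reindex {I J : choiceType} (s : I -> J) : op J I :=
  fun f => mkl2 (f \o s).

(** ** Tensor products *)

Definition tens {I J : choiceType} (x : l2 R I) (y : l2 R J) : l2 R (I * J)%type :=
  mkl2 (fun p => x p.1 * y p.2).

(* T (x) 1 and 1 (x) T, acting on the fibres of vectors of l2 (I * J). *)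
Definition amp_l {I I' J : choiceType} (T : op I I') :
    op (I * J)%type (I' * J)%type :=
  fun f => mkl2 (fun p => T (mkl2 (fun i => f (i, p.2))) p.1).

Definition amp_r {I J J' : choiceType} (T : op J J') :
    op (I * J)%type (I * J')%type :=
  fun f => mkl2 (fun p => T (mkl2 (fun j => f (p.1, j))) p.2).

Definition op_tens {I I' J J' : choiceType} (T : op I I') (S : op J J') :
    op (I * J)%type (I' * J')%type :=
  amp_l T \o amp_r S.

(* Slice maps along vector functionals w_(x,y)(a) = (a x, y):
   [slice_r x y X] = (id (x) w_(x,y))(X), [slice_l x y X] = (w_(x,y) (x) id)(X). *)
Definition slice_r {I J : choiceType} (x y : l2 R J)
    (X : op (I * J)%type (I * J)%type) : op I I :=
  op_of_form (fun a b => dot (X (tens a x)) (tens b y)).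

Definition slice_l {I J : choiceType} (x y : l2 R I)
    (X : op (I * J)%type (I * J)%type) : op J J :=
  op_of_form (fun a b => dot (X (tens x a)) (tens y b)).

(* Slices along arbitrary functionals: [fslice_l w X] = (w (x) id)(X) and
   [fslice_r w X] = (id (x) w)(X). *)
Definition fslice_l {I J : choiceType} (w : op I I -> R[i])
    (X : op (I * J)%type (I * J)%type) : op J J :=
  op_of_form (fun a b => w (slice_r a b X)).

Definition fslice_r {I J : choiceType} (w : op J J -> R[i])
    (X : op (I * J)%type (I * J)%type) : op I I :=
  op_of_form (fun a b => w (slice_l a b X)).

(* l2 ((I * J) * K) -> l2 (I * (J * K)) and its inverse *)
Definition assoc {I J K : choiceType} : op (I * J * K)%type (I * (J * K))%type :=
  reindex (fun q => ((q.1, q.2.1), q.2.2)).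

Definition assoc_inv {I J K : choiceType} :
    op (I * (J * K))%type (I * J * K)%type :=
  reindex (fun p => (p.1.1, (p.1.2, p.2))).

Definition flip12 {I J K : choiceType} : op (I * J * K)%type (J * I * K)%type :=
  reindex (fun p => ((p.1.2, p.1.1), p.2)).

Definition leg23 {I J : choiceType} (V : op (I * J)%type (I * J)%type) :
    op (I * I * J)%type (I * I * J)%type :=
  assoc_inv \o amp_r V \o assoc.

Definition leg13 {I J : choiceType} (V : op (I * J)%type (I * J)%type) :
    op (I * I * J)%type (I * I * J)%type :=
  flip12 \o leg23 V \o flip12.

(** ** Von Neumann algebras *)

Definition commutant {I : choiceType} (M : set (op I I)) : set (op I I) :=
  [set T | bounded_op T /\ forall a, M a -> T \o a = a \o T].

Definition vN_algebra {I : choiceType} (M : set (op I I)) : Prop :=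
  [/\ forall a, M a -> bounded_op a,
      forall a, M a -> M (adj a)
    & commutant (commutant M) = M].

Definition vN_tens {I J : choiceType} (M : set (op I I)) (N : set (op J J)) :
    set (op (I * J)%type (I * J)%type) :=
  commutant (commutant [set op_tens a b | a in M & b in N]).

Definition Bop (J : choiceType) : set (op J J) := [set T | bounded_op T].

(* Elements of the predual M_*. *)
Definition normal_functional {I : choiceType} (M : set (op I I))
    (w : op I I -> R[i]) : Prop :=
  exists x y : nat -> l2 R I,
    [/\ (\esum_(n in [set: nat]) sqsum (x n) < +oo)%E,
        (\esum_(n in [set: nat]) sqsum (y n) < +oo)%E
      & forall a, M a -> w a = csum (fun n => dot (a (x n)) (y n))].

Definition normal_faithful_state {I : choiceType} (M : set (op I I))
    (h : op I I -> R[i]) : Prop :=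
  [/\ normal_functional M h,
      forall a, M a -> 0 <= h (adj a \o a),
      h id = 1
    & forall a, M a -> h (adj a \o a) = 0 -> a = 0].

Definition normal_unital_star_hom {I J : choiceType} (M : set (op I I))
    (N : set (op J J)) (Phi : op I I -> op J J) : Prop :=
  [/\ forall a, M a -> N (Phi a),
      forall (c : R[i]) a b, M a -> M b -> Phi (c *: a + b) = c *: Phi a + Phi b,
      forall a b, M a -> M b -> Phi (a \o b) = Phi a \o Phi b,
      forall a, M a -> Phi (adj a) = adj (Phi a)
    & Phi id = id /\
      forall w, normal_functional N w -> normal_functional M (w \o Phi)].

(* Y = (Phi (x) id)(X) and Y = (id (x) Phi)(X) for a normal homomorphism Phi:
   the tensor product map is determined by the compatibility with slices,
   (id (x) w)(Phi (x) id)(X) = Phi ((id (x) w)(X)), and it is enough to test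
   this on the vector functionals w since these span a dense subspace of the
   predual. *)
Definition hom_tens_id {I I' J : choiceType} (Phi : op I I -> op I' I')
    (X : op (I * J)%type (I * J)%type) (Y : op (I' * J)%type (I' * J)%type) : Prop :=
  bounded_op Y /\ forall x y : l2 R J, slice_r x y Y = Phi (slice_r x y X).

Definition id_tens_hom {I J J' : choiceType} (Phi : op J J -> op J' J')
    (X : op (I * J)%type (I * J)%type) (Y : op (I * J')%type (I * J')%type) : Prop :=
  bounded_op Y /\ forall x y : l2 R I, slice_l x y Y = Phi (slice_l x y X).

End Operators.

Arguments Bop {R} J _.

(** * Compact quantum groups *)

Record cqg (R : realType) := CQG {
  cqg_idx : choiceType;
  Linf : set (op R cqg_idx cqg_idx);
  comul : op R cqg_idx cqg_idx ->
          op R (cqg_idx * cqg_idx)%type (cqg_idx * cqg_idx)%type;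
  haar : op R cqg_idx cqg_idx -> R[i];
  Linf_vN : vN_algebra Linf;
  comul_hom : normal_unital_star_hom Linf (vN_tens Linf Linf) comul;
  comul_coassoc : forall a, Linf a -> exists X Y,
    [/\ hom_tens_id comul (comul a) X,
        id_tens_hom comul (comul a) Y
      & assoc \o X = Y \o assoc];
  haar_state : normal_faithful_state Linf haar;
  haar_invariant : forall a, Linf a ->
    fslice_r haar (comul a) = haar a *: id /\
    fslice_l haar (comul a) = haar a *: id }.

Arguments cqg_idx {R} G : rename.
Arguments Linf {R} G : rename.
Arguments comul {R} G : rename.
Arguments haar {R} G : rename.

Section CQG.
Context {R : realType}.

Definition Kac (G : cqg R) : Prop :=
  forall a b, Linf G a -> Linf G b -> haar G (a \o b) = haar G (b \o a).

Notation repop G J := (op R (cqg_idx G * J)%type (cqg_idx G * J)%type).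

Definition representation (G : cqg R) {J : choiceType} (V : repop G J) : Prop :=
  vN_tens (Linf G) (Bop J) V /\ hom_tens_id (comul G) V (leg13 V \o leg23 V).

Definition nondegenerate_rep (G : cqg R) {J : choiceType} (V : repop G J) : Prop :=
  forall (z : l2 R J) (e : R), 0 < e -> exists2 y,
    lin_span [set y | exists w x, normal_functional (Linf G) w /\
                                  y = fslice_l w V x] y
    & l2norm (z - y) < e.

Definition unitarizable (G : cqg R) {J : choiceType} (V : repop G J) : Prop :=
  exists T T' : op R J J, [/\ bounded_op T, bounded_op T', T \o T' = id, T' \o T = id
    & unitary (amp_r T \o V \o amp_r T' : repop G J)].

Definition intertwiner (G : cqg R) {J K : choiceType} (V : repop G J)
    (W : repop G K) (T : op R J K) : Prop :=
  bounded_op T /\ amp_r T \o V = W \o amp_r T.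

Definition irreducible_unitary_rep (G : cqg R) {J : choiceType} (V : repop G J) :
    Prop :=
  [/\ representation V, unitary V, exists x : l2 R J, x != 0
    & forall T, intertwiner V V T -> exists c : R[i], T = c *: id].

Definition equivalent_rep (G : cqg R) {J K : choiceType} (V : repop G J)
    (W : repop G K) : Prop :=
  exists2 T : op R J K, unitary T & intertwiner V W T.

(* Irr(G), with a choice of representatives acting on C^n; the canonical basis
   of C^n is the chosen orthonormal basis of H_alpha. *)
Record irr_system (G : cqg R) := IrrSystem {
  Irr : choiceType;
  irr_dim : Irr -> nat;
  irr_rep : forall alpha : Irr, repop G 'I_(irr_dim alpha);
  irr_repP : forall alpha, irreducible_unitary_rep (@irr_rep alpha);
  irr_inj : forall alpha beta,
    equivalent_rep (@irr_rep alpha) (@irr_rep beta) -> alpha = beta;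
  irr_exhaust : forall (J : choiceType) (V : repop G J),
    irreducible_unitary_rep V -> exists alpha, equivalent_rep (@irr_rep alpha) V }.

Arguments irr_dim {G} i alpha : rename.
Arguments irr_rep {G} i alpha : rename.

(* The entries u_ij of u = sum_ij u_ij (x) e_ij, and conversely. *)
Definition coef (G : cqg R) {n : nat} (u : repop G 'I_n) (i j : 'I_n) :
    op R (cqg_idx G) (cqg_idx G) :=
  slice_r (bvec R j) (bvec R i) u.

Definition mxop {n : nat} (A : 'M[R[i]]_n) : op R 'I_n 'I_n :=
  fun x => mkl2 (fun i => \sum_j A i j * x j).

Definition of_coef (G : cqg R) {n : nat}
    (a : 'I_n -> 'I_n -> op R (cqg_idx G) (cqg_idx G)) : repop G 'I_n :=
  \sum_i \sum_j op_tens (a i j) (mxop (delta_mx i j)).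

Definition contragredient (G : cqg R) {n : nat} (u : repop G 'I_n) : repop G 'I_n :=
  of_coef (fun i j => adj (coef u i j)).

Definition Pol (G : cqg R) (X : irr_system G) :
    set (op R (cqg_idx G) (cqg_idx G)) :=
  lin_span [set a | exists alpha i j, a = coef (irr_rep X alpha) i j].

(* Only the values of S on Pol(G) matter. *)
Definition antipode (G : cqg R) (X : irr_system G)
    (S : op R (cqg_idx G) (cqg_idx G) -> op R (cqg_idx G) (cqg_idx G)) : Prop :=
  (forall (c : R[i]) a b, Pol X a -> Pol X b -> S (c *: a + b) = c *: S a + S b) /\
  (forall alpha i j,
     S (coef (irr_rep X alpha) i j) = adj (coef (irr_rep X alpha) j i)).

(* Q is the operator Q_alpha; it is required to be diagonal because the basis
   of H_alpha is chosen in this way. *)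
Definition modular_operator (G : cqg R)
    (S : op R (cqg_idx G) (cqg_idx G) -> op R (cqg_idx G) (cqg_idx G))
    {n : nat} (u : repop G 'I_n) (Q : 'M[R[i]]_n) : Prop :=
  [/\ (forall x, 0 <= dot (mxop Q x) x) /\ Q \in unitmx,
      \tr Q = \tr (invmx Q),
      of_coef (fun i j => S (S (coef u i j))) =
        (amp_r (mxop Q) \o u \o amp_r (mxop (invmx Q)) : repop G 'I_n)
    & is_diag_mx Q].

(* Q^t for a positive diagonal matrix Q. *)
Definition mxpow {n : nat} (Q : 'M[R[i]]_n) (t : R) : 'M[R[i]]_n :=
  diag_mx (\row_i ((complex.Re (Q i i)) `^ t)%:C%C).

Definition deformed_contragredient (G : cqg R) {n : nat} (u : repop G 'I_n)
    (Q : 'M[R[i]]_n) (t : R) : repop G 'I_n :=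
  amp_r (mxop (mxpow Q (t / 2))) \o contragredient u
    \o amp_r (mxop (mxpow Q (- (t / 2)))).

Definition incl {A : choiceType} {J : A -> choiceType} (a : A) :
    op R (J a) {b : A & J b} :=
  fun f => mkl2 (fun p => untag 0 (fun j : J a => f j) p).

(* W is the direct sum of the uniformly bounded family V: the sum of the
   (1 (x) t_a) V_a (1 (x) t_a^* ) converges strongly to W. *)
Definition is_direct_sum (G : cqg R) {A : choiceType} {J : A -> choiceType}
    (V : forall a, repop G (J a)) (W : repop G {a : A & J a}) : Prop :=
  [/\ exists c : R, forall a, bounded_op (V a) /\ opnorm (V a) <= c,
      bounded_op W
    & forall z (e : R), 0 < e -> exists F : {fset A}, forall F' : {fset A},
        (F `<=` F')%fset ->
        let t a := @incl A J a in
        l2norm (\sum_(a <- F') amp_r (t a) (V a (amp_r (adj (t a)) z)) - W z) < e].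

End CQG.

Arguments Irr {R G} i : rename.
Arguments irr_dim {R G} i alpha : rename.
Arguments irr_rep {R G} i alpha : rename.

(* Main.v *)
Require Import Defs.
From HB Require Import structures.
From mathcomp Require Import all_boot all_order all_algebra.
From mathcomp Require Import finmap ring lra.
From mathcomp Require Import all_classical all_reals all_analysis.
From mathcomp Require Import complex spectral.

Set Implicit Arguments.
Unset Strict Implicit.
Unset Printing Implicit Defensive.
Import Order.TTheory GRing.Theory Num.Theory.
Local Open Scope classical_set_scope.
Local Open Scope ring_scope.

(** Let [U] be the matrix of an irreducible unitary representation of dimension
    [n], [V] its contragredient (the entrywise adjoint) and
    [X_s = Q^s V Q^-s], so that the summands of the representation [v_(E,theta)]
    are the matrices [X_(theta / 2)].

    The modular operator.  By the two invariance properties of the Haar state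
    [h], the scalar matrices [F = h(V^* V)] and [E = h(V V^* )] satisfy
    [V^* F V = F] and [V E V^* = E] ([corep_inv_l], [corep_inv_r]), and they are
    positive definite because [h] is faithful ([hmx_posdef]).  Hence [V] is
    invertible, with inverse [F^-1 V^* F], and similar to an irreducible unitary
    representation ([contragredient_unitarizable]), on which the antipode is
    known: [S] maps [V] to its inverse ([antipode_contragredient]).  Applying
    [S] twice to [U] shows that [F] implements [S^2] up to transposition, and by
    irreducibility [F] is a multiple of [Q].  Therefore [V^* Q V = Q]
    ([modular_invariant]), which says that [X_(1/2)] is unitary
    ([qbar_half_unitary]).

    The norm.  Entrywise estimates give |X_0| <= n, and |X_(1/2)| = 1.  In
    between the norm is log-convex ([qbar_midpoint]): [X_m^* X_m] is similar to
    [X_(m+d)^* X_(m-d)], and the norm of a selfadjoint operator is its spectral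
    radius, so |X_m|^2 <= |X_(m+d)| |X_(m-d)|.  This midpoint inequality takes
    the place of complex interpolation and yields |X_s| <= (1 + n)^(1 - 2 s)
    ([qbar_norm]); for [s = theta / 2] the right-hand side is [C].  The direct
    sum is a block diagonal operator, hence also bounded by [C]; that it is a
    representation can be tested on matrix coefficients ([hom_tens_gcoef]), and
    it is nondegenerate because its blocks are invertible.

    No unitarization.  If [T] makes the direct sum unitary, then the inner
    product [(T x, T y)] restricted to a summand is a form invariant under
    [X_(theta / 2)] ([gram_invariant]), and by irreducibility it is a multiple
    of [Q^(1 - theta)] ([invariant_form]).  As its values on unit vectors lie
    between [|T^-1|^-2] and [|T|^2], the numbers [(|Q| |Q^-1|)^(1 - theta)] are
    bounded uniformly over [E].  Since [1 - theta = log C / log (1 + n)], this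
    bounds the quotients whose supremum is assumed to be infinite. *)

Local Notation normc := Normc.normc.
Local Notation "z ^*" := (conjc z) : ring_scope.
Local Notation "x %:C" := (real_complex _ x) : ring_scope.

(** * Summable families of complex numbers *)

Lemma eq_addr_eq0 (V : zmodType) (x : V) : x = x + x -> x = 0.
Proof. by rewrite -{1}[x]addr0 => /addrI. Qed.

Section Complex.
Variable R : realType.
Implicit Types (z w : R[i]) (x y : R).

Lemma abs2E z : abs2 z = normc z ^+ 2.
Proof. by case: z => a b; rewrite /abs2 /= sqr_sqrtr// addr_ge0 ?sqr_ge0. Qed.

Lemma normc_ge0 z : 0 <= normc z.
Proof. by case: z => a b /=; rewrite sqrtr_ge0. Qed.

Lemma mulcJ z : z * z^* = (abs2 z)%:C.
Proof.
case: z => a b; apply/eqP; rewrite eq_complex /abs2 /=; apply/andP; split; apply/eqP; ring.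
Qed.

Lemma conjcM z w : (z * w)^* = z^* * w^*.
Proof. exact: (rmorphM (@conjc R)). Qed.

Lemma conjcD z w : (z + w)^* = z^* + w^*.
Proof. exact: (rmorphD (@conjc R)). Qed.

Lemma conjcN z : (- z)^* = - z^*.
Proof. exact: (rmorphN (@conjc R)). Qed.

Lemma normcJr z : normc z^* = normc z.
Proof. by case: z => a b /=; rewrite sqrrN. Qed.

Lemma abs20 : abs2 (0 : R[i]) = 0.
Proof. by rewrite abs2E Normc.normc0 expr0n. Qed.

Lemma abs2_eq0 z : abs2 z = 0 -> z = 0.
Proof. by rewrite abs2E => /eqP; rewrite expf_eq0 /= => /eqP /Normc.eq0_normc. Qed.

Lemma normc_real x : 0 <= x -> normc x%:C = x.
Proof. by move=> x0; rewrite /= expr0n/= addr0 sqrtr_sqr ger0_norm. Qed.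

Lemma normcD z w : normc (z + w) <= normc z + normc w.
Proof. exact: le_normcD. Qed.

Lemma Re_normc z : `|complex.Re z| <= normc z.
Proof.
case: z => a b /=; rewrite -sqrtr_sqr ler_sqrt ?addr_ge0 ?sqr_ge0//.
by rewrite lerDl sqr_ge0.
Qed.

Lemma Im_normc z : `|complex.Im z| <= normc z.
Proof.
case: z => a b /=; rewrite -sqrtr_sqr ler_sqrt ?addr_ge0 ?sqr_ge0//.
by rewrite lerDr sqr_ge0.
Qed.

Lemma normc_ReIm z : normc z <= `|complex.Re z| + `|complex.Im z|.
Proof.
case: z => a b /=.
rewrite -[leRHS]ger0_norm ?addr_ge0// -sqrtr_sqr ler_sqrt ?sqr_ge0//.
rewrite sqrrD !real_normK ?num_real// -addrA lerD2l lerDr.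
by rewrite mulrn_wge0// mulr_ge0.
Qed.

Lemma complex_ext z w : complex.Re z = complex.Re w -> complex.Im z = complex.Im w -> z = w.
Proof. by case: z => a b; case: w => c d /= -> ->. Qed.

Lemma cReD z w : complex.Re (z + w) = complex.Re z + complex.Re w.
Proof. by case: z; case: w. Qed.
Lemma cImD z w : complex.Im (z + w) = complex.Im z + complex.Im w.
Proof. by case: z; case: w. Qed.
Lemma cReM z w : complex.Re (z * w) =
  complex.Re z * complex.Re w - complex.Im z * complex.Im w.
Proof. by case: z; case: w. Qed.
Lemma cImM z w : complex.Im (z * w) =
  complex.Re z * complex.Im w + complex.Im z * complex.Re w.
Proof. by case: z; case: w. Qed.

End Complex.

Section Sums.
Variables (R : realType) (I : choiceType).

Local Notation esumT f := (\esum_(i in [set: I]) (f i)%:E)%E.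

Definition abssum (f : I -> R) := (esumT (fun i => `|f i|) < +oo)%E.

Lemma esumT_ge0 (f : I -> R) : (forall i, 0 <= f i) -> (0 <= esumT f)%E.
Proof. by move=> f0; apply: esum_ge0 => i _; rewrite lee_fin. Qed.

Lemma esumT_finite (f : I -> R) : (forall i, 0 <= f i) -> (esumT f < +oo)%E ->
  esumT f \is a fin_num.
Proof. by move=> f0 foo; rewrite ge0_fin_numE ?esumT_ge0. Qed.

Lemma le_esumT (f g : I -> R) : (forall i, f i <= g i) -> (esumT f <= esumT g)%E.
Proof. by move=> fg; apply: le_esum => i _; rewrite lee_fin. Qed.

Lemma esumTD (f g : I -> R) : (forall i, 0 <= f i) -> (forall i, 0 <= g i) ->
  esumT (fun i => f i + g i) = (esumT f + esumT g)%E.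
Proof.
move=> f0 g0; under eq_esum do rewrite EFinD.
by rewrite esumD// => i _; rewrite lee_fin.
Qed.

Lemma esumTZ (c : R) (f : I -> R) : 0 <= c -> (forall i, 0 <= f i) ->
  esumT (fun i => c * f i) = (c%:E * esumT f)%E.
Proof.
move=> c0 f0; apply/eqP; rewrite eq_le; apply/andP; split.
  apply: ge_ereal_sup => _ [A [finA _] <-].
  rewrite (eq_fsbigr (fun i => c%:E * (f i)%:E)%E); last by move=> i _; rewrite EFinM.
  rewrite -ge0_mule_fsumr; last by move=> i; rewrite lee_fin.
  rewrite lee_wpmul2l ?lee_fin//; apply: esum_ge; by exists A.
have [->|cn0] := eqVneq c 0.
  by rewrite mul0e; apply: esumT_ge0 => i; rewrite mul0r.
have cp : 0 < c by rewrite lt_neqAle eq_sym cn0.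
rewrite muleC -lee_pdivlMr//.
apply: ge_ereal_sup => _ [A [finA _] <-].
rewrite lee_pdivlMr// muleC.
rewrite ge0_mule_fsumr; last by move=> i; rewrite lee_fin.
by apply: esum_ge; exists A.
Qed.

Lemma le_abssum (f g : I -> R) : (forall i, `|f i| <= g i) -> (esumT g < +oo)%E -> abssum f.
Proof. by move=> fg goo; apply: le_lt_trans goo; exact: le_esumT. Qed.

Lemma abssumZ c f : abssum f -> abssum (fun i => c * f i).
Proof.
move=> fs; apply: (@le_abssum _ (fun i => `|c| * `|f i|)).
  by move=> i; rewrite normrM.
by rewrite esumTZ// lte_mul_pinfty// lee_fin.
Qed.

(** The sum does not depend on how a family is written as a difference of
    nonnegative summable families; this is what makes it additive. *)
Lemma rsum_diff (f p q : I -> R) : (forall i, 0 <= p i) -> (forall i, 0 <= q i) ->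
  (esumT p < +oo)%E -> (esumT q < +oo)%E -> (forall i, f i = p i - q i) ->
  rsum f = fine (esumT p) - fine (esumT q).
Proof.
move=> p0 q0 ps qs fpq; rewrite /rsum.
set fp := fun i => Num.max (f i) 0; set fm := fun i => Num.max (- f i) 0.
have fp0 i : 0 <= fp i by rewrite le_max lexx orbT.
have fm0 i : 0 <= fm i by rewrite le_max lexx orbT.
have fpp i : fp i <= p i.
  by rewrite ge_max p0 andbT fpq lerBlDr lerDl.
have fmq i : fm i <= q i.
  by rewrite ge_max q0 andbT fpq opprB lerBlDr lerDl.
have fps := le_lt_trans (le_esumT fpp) ps.
have fms := le_lt_trans (le_esumT fmq) qs.
have E i : fp i + q i = p i + fm i.
  have := fpq i; rewrite /fp /fm /Num.max.
  by do 2 (case: ifPn; rewrite -?leNgt => ?); move=> *; lra.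
have : (esumT fp + esumT q = esumT p + esumT fm)%E.
  by rewrite -!esumTD//; apply: eq_esum => i _; rewrite E.
move/(congr1 fine); rewrite !fineD ?esumT_finite//.
by rewrite /fp /fm; lra.
Qed.

Lemma rsumD f g : abssum f -> abssum g -> rsum (fun i => f i + g i) = rsum f + rsum g.
Proof.
move=> fs gs.
pose p (h : I -> R) i := Num.max (h i) 0; pose q (h : I -> R) i := Num.max (- h i) 0.
have p0 h i : 0 <= p h i by rewrite le_max lexx orbT.
have q0 h i : 0 <= q h i by rewrite le_max lexx orbT.
have ps h : abssum h -> (esumT (p h) < +oo)%E.
  apply: le_lt_trans; apply: le_esumT => i.
  by rewrite ge_max normr_ge0 ler_norm.
have qs h : abssum h -> (esumT (q h) < +oo)%E.
  apply: le_lt_trans; apply: le_esumT => i.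
  by rewrite ge_max normr_ge0 -normrN ler_norm.
rewrite (@rsum_diff _ (fun i => p f i + p g i) (fun i => q f i + q g i)).
- have [? ? ? ?] := And4 (ps f fs) (ps g gs) (qs f fs) (qs g gs).
  by rewrite !esumTD// !fineD ?esumT_finite// /rsum /p /q opprD addrACA.
- by move=> i; rewrite addr_ge0.
- by move=> i; rewrite addr_ge0.
- by rewrite esumTD// lte_add_pinfty ?ps.
- by rewrite esumTD// lte_add_pinfty ?qs.
- move=> i; rewrite /p /q /Num.max.
  by do 4 (case: ifPn; rewrite -?leNgt => ?); lra.
Qed.

Lemma rsumN (f : I -> R) : rsum (fun i => - f i) = - rsum f.
Proof. by rewrite /rsum opprB; congr (_ - _); under eq_esum do rewrite opprK. Qed.

Lemma rsumZ c (f : I -> R) : abssum f -> rsum (fun i => c * f i) = c * rsum f.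
Proof.
suff H d : 0 <= d -> abssum f -> rsum (fun i => d * f i) = d * rsum f.
  move=> fs; have [c0|c0] := leP 0 c; first exact: H.
  have := H (- c); rewrite oppr_ge0 ltW// => /(_ isT fs).
  rewrite (_ : (fun i => - c * f i) = (fun i => - (c * f i))).
    by rewrite rsumN mulNr => /oppr_inj.
  by apply/funext => i; rewrite mulNr.
move=> d0 fs.
rewrite (@rsum_diff _ (fun i => d * Num.max (f i) 0) (fun i => d * Num.max (- f i) 0)).
- have m0 (h : I -> R) i : 0 <= Num.max (h i) 0 by rewrite le_max lexx orbT.
  rewrite (esumTZ d0 (m0 f)) (esumTZ d0 (m0 (fun i => - f i))).
  rewrite !fineM// -?mulrBr// esumT_finite//.
  + by move=> i; exact: (m0 (fun i => - f i)).
  + by apply: le_lt_trans fs; apply: le_esumT => i; rewrite ge_max normr_ge0 -normrN ler_norm.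
  + by apply: le_lt_trans fs; apply: le_esumT => i; rewrite ge_max normr_ge0 ler_norm.
- by move=> i; rewrite mulr_ge0// le_max lexx orbT.
- by move=> i; rewrite mulr_ge0// le_max lexx orbT.
- rewrite esumTZ// ?lte_mul_pinfty ?lee_fin//; last by move=> i; rewrite le_max lexx orbT.
  by apply: le_lt_trans fs; apply: le_esumT => i; rewrite ge_max normr_ge0 ler_norm.
- rewrite esumTZ// ?lte_mul_pinfty ?lee_fin//; last by move=> i; rewrite le_max lexx orbT.
  by apply: le_lt_trans fs; apply: le_esumT => i; rewrite ge_max normr_ge0 -normrN ler_norm.
- move=> i; rewrite -mulrBr; congr (_ * _); rewrite /Num.max.
  by do 2 (case: ifPn; rewrite -?leNgt => ?); move=> *; lra.
Qed.

Lemma rsum_ge0E (f : I -> R) : (forall i, 0 <= f i) -> rsum f = fine (esumT f).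
Proof.
move=> f0; rewrite /rsum [X in _ - fine X]esum1; last first.
  by move=> i _; rewrite max_r// oppr_le0.
by rewrite subr0; congr fine; apply: eq_esum => i _; rewrite max_l.
Qed.

Lemma rsum0 : rsum (fun _ : I => 0 : R) = 0.
Proof. by rewrite rsum_ge0E// esum1. Qed.

Lemma rsum_le (f g : I -> R) : (forall i, `|f i| <= g i) -> (esumT g < +oo)%E ->
  `|rsum f| <= fine (esumT g).
Proof.
move=> fg gs; have g0 i : 0 <= g i by apply: le_trans (fg i).
suff H h : (forall i, `|h i| <= g i) -> rsum h <= fine (esumT g).
  rewrite ler_norml H// andbT lerNl -rsumN H// => i; by rewrite normrN.
move=> hg.
rewrite (@rsum_diff _ g (fun i => g i - h i))//.
- rewrite gerBl fine_ge0// esumT_ge0// => i.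
  by rewrite subr_ge0 (le_trans (ler_norm _)).
- by move=> i; rewrite subr_ge0 (le_trans (ler_norm _)).
- apply: (@le_lt_trans _ _ (esumT (fun i => g i + g i))); last by rewrite esumTD// lte_add_pinfty.
  apply: le_esumT => i; rewrite lerD2l (le_trans (ler_norm _))// normrN//.
- by move=> i; rewrite opprB addrC subrK.
Qed.

Definition csummable (f : I -> R[i]) := abssum (fun i => normc (f i)).

Lemma csummableRe f : csummable f -> abssum (fun i => complex.Re (f i)).
Proof.
move=> fs; apply: le_abssum fs => i.
by rewrite (ger0_norm (normc_ge0 _)) Re_normc.
Qed.

Lemma csummableIm f : csummable f -> abssum (fun i => complex.Im (f i)).
Proof.
move=> fs; apply: le_abssum fs => i.
by rewrite (ger0_norm (normc_ge0 _)) Im_normc.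
Qed.

Lemma le_csummable (f : I -> R[i]) g : (forall i, normc (f i) <= g i) -> (esumT g < +oo)%E ->
  csummable f.
Proof.
by move=> fg goo; apply: (@le_abssum _ g) => // i; rewrite ger0_norm// normc_ge0.
Qed.

Lemma csummableZ c f : csummable f -> csummable (fun i => c * f i).
Proof.
move=> fs; apply: le_csummable (abssumZ (normc c) fs) => i.
by rewrite Normc.normcM ler_norm.
Qed.

Lemma csumD f g : csummable f -> csummable g ->
  csum (fun i => f i + g i) = csum f + csum g.
Proof.
move=> fs gs; rewrite /csum; apply: complex_ext; rewrite ?cReD ?cImD /=.
  rewrite -rsumD ?csummableRe//; congr rsum; apply/funext => i; exact: cReD.
rewrite -rsumD ?csummableIm//; congr rsum; apply/funext => i; exact: cImD.
Qed.

Lemma csumZ c f : csummable f -> csum (fun i => c * f i) = c * csum f.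
Proof.
move=> fs; rewrite /csum; apply: complex_ext; rewrite ?cReM ?cImM /=.
  rewrite -mulNr -!rsumZ ?csummableRe ?csummableIm// -rsumD ?abssumZ ?csummableRe ?csummableIm//.
  by congr rsum; apply/funext => i; rewrite cReM mulNr.
rewrite -!rsumZ ?csummableRe ?csummableIm// -rsumD ?abssumZ ?csummableRe ?csummableIm//.
by congr rsum; apply/funext => i; rewrite cImM.
Qed.

Lemma csumJ (f : I -> R[i]) : csum (fun i => (f i)^*) = (csum f)^*.
Proof.
apply: complex_ext => /=; first by congr rsum; apply/funext => i; case: (f i).
by rewrite -rsumN; congr rsum; apply/funext => i; case: (f i).
Qed.

Lemma csum_real (f : I -> R) : csum (fun i => (f i)%:C) = (rsum f)%:C.
Proof. by apply: complex_ext => //=; exact: rsum0. Qed.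

Lemma csum_le (f : I -> R[i]) g : (forall i, normc (f i) <= g i) -> (esumT g < +oo)%E ->
  normc (csum f) <= 2 * fine (esumT g).
Proof.
move=> fg gs; apply: le_trans (normc_ReIm _) _; rewrite mulr_natl mulr2n /=.
by apply: lerD; apply: rsum_le => // i; apply: le_trans (fg i); rewrite ?Re_normc ?Im_normc.
Qed.

Lemma esum_single (f : I -> R) k : 0 <= f k -> (forall i, i != k -> f i = 0) ->
  esumT f = (f k)%:E.
Proof.
move=> f0 fk; rewrite -(esum_set1 (a := fun i => (f i)%:E) (t := k)) ?lee_fin//.
rewrite [RHS]esum_mkcond; apply: eq_esum => i _.
case: ifPn => //; rewrite notin_setE /= => /eqP ik; by rewrite fk.
Qed.

Lemma rsum_single (f : I -> R) k : (forall i, i != k -> f i = 0) -> rsum f = f k.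
Proof.
move=> fk; rewrite /rsum.
rewrite (@esum_single (fun i => Num.max (f i) 0) k) ?le_max ?lexx ?orbT//; last first.
  by move=> i /fk ->; rewrite maxxx.
rewrite (@esum_single (fun i => Num.max (- f i) 0) k) ?le_max ?lexx ?orbT//; last first.
  by move=> i /fk ->; rewrite oppr0 maxxx.
by rewrite /= /Num.max; do 2 (case: ifPn; rewrite -?leNgt => ?); lra.
Qed.

Lemma csum_single (f : I -> R[i]) k : (forall i, i != k -> f i = 0) -> csum f = f k.
Proof.
by move=> fk; apply: complex_ext => /=; rewrite (@rsum_single _ k)// => i /fk ->.
Qed.

End Sums.

(** * Square-summable families: inner product, bases, bounded forms *)

Section L2.
Variables (R : realType) (I : choiceType).
Implicit Types (x y z : l2 R I) (c : R[i]).

Lemma l2_ext x y : (forall i, x i = y i) -> x = y.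
Proof. by move=> xy; apply: val_inj; apply/funext. Qed.

Lemma l2DE x y i : (x + y) i = x i + y i. Proof. by []. Qed.
Lemma l2NE x i : (- x) i = - x i. Proof. by []. Qed.
Lemma l2ZE c x i : (c *: x) i = c * x i. Proof. by []. Qed.
Lemma l2sumE (T : Type) (s : seq T) (P : pred T) (F : T -> l2 R I) i :
  (\sum_(t <- s | P t) F t) i = \sum_(t <- s | P t) F t i.
Proof. by elim/big_rec2: _ => // t u v _ <-; rewrite l2DE. Qed.

Lemma mkl2E (f : I -> R[i]) : f \in @sqsummable R I -> forall i, mkl2 f i = f i.
Proof. by move=> fs i; rewrite /mkl2 /insubd insubT. Qed.

Lemma sqsum_fin x : sqsum x \is a fin_num.
Proof. by rewrite ge0_fin_numE ?sqsum_ge0//; case: x. Qed.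

Lemma l2norm_ge0 x : 0 <= l2norm x. Proof. exact: sqrtr_ge0. Qed.

Lemma l2norm_sqr x : (l2norm x ^+ 2)%:E = sqsum x.
Proof. by rewrite sqr_sqrtr ?fine_ge0 ?sqsum_ge0// fineK// sqsum_fin. Qed.

Lemma dot_summable x y : csummable (fun i => x i * (y i)^*).
Proof.
apply: (@le_csummable _ _ _ (fun i => abs2 (x i) + abs2 (y i))).
  move=> i; rewrite Normc.normcM normcJr !abs2E.
  have := normc_ge0 (x i); have := normc_ge0 (y i).
  set a := normc _; set b := normc _; nra.
have a0 (z : l2 R I) i : 0 <= abs2 (z i) by exact: abs2_ge0.
rewrite (esumTD (a0 x) (a0 y)) -/(sqsum x) -/(sqsum y).
by rewrite lte_add_pinfty// ltey_eq sqsum_fin.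
Qed.

Lemma dotDl x y z : dot (x + y) z = dot x z + dot y z.
Proof.
rewrite /dot -csumD; try exact: dot_summable.
by congr csum; apply/funext => i; rewrite l2DE mulrDl.
Qed.

Lemma dotZl c x y : dot (c *: x) y = c * dot x y.
Proof.
rewrite /dot -csumZ; last exact: dot_summable.
by congr csum; apply/funext => i; rewrite l2ZE mulrA.
Qed.

Lemma dotC x y : dot y x = (dot x y)^*.
Proof.
rewrite /dot -csumJ; congr csum; apply/funext => i.
by rewrite conjcM conjcK mulrC.
Qed.

Lemma dotDr x y z : dot x (y + z) = dot x y + dot x z.
Proof. by rewrite dotC dotDl conjcD -!dotC. Qed.

Lemma dotZr c x y : dot x (c *: y) = c^* * dot x y.
Proof. by rewrite dotC dotZl conjcM -dotC. Qed.

Lemma dot0l y : dot 0 y = 0.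
Proof. by rewrite -(scale0r (0 : l2 R I)) dotZl mul0r. Qed.

Lemma dot0r y : dot y 0 = 0.
Proof. by rewrite dotC dot0l conjc0. Qed.

Lemma dotNl x y : dot (- x) y = - dot x y.
Proof. by rewrite -scaleN1r dotZl mulN1r. Qed.

Lemma dotBl x y z : dot (x - y) z = dot x z - dot y z.
Proof. by rewrite dotDl dotNl. Qed.

Lemma dotNr x y : dot x (- y) = - dot x y.
Proof. by rewrite dotC dotNl conjcN -dotC. Qed.

Lemma dotBr x y z : dot x (y - z) = dot x y - dot x z.
Proof. by rewrite dotDr dotNr. Qed.

Lemma dot_suml (T : Type) (s : seq T) (P : pred T) (F : T -> l2 R I) y :
  dot (\sum_(t <- s | P t) F t) y = \sum_(t <- s | P t) dot (F t) y.
Proof.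
by elim/big_rec2: _ => [|t u v _ <-]; rewrite ?dot0l// dotDl.
Qed.

Lemma dot_sumr (T : Type) (s : seq T) (P : pred T) (F : T -> l2 R I) y :
  dot y (\sum_(t <- s | P t) F t) = \sum_(t <- s | P t) dot y (F t).
Proof.
by elim/big_rec2: _ => [|t u v _ <-]; rewrite ?dot0r// dotDr.
Qed.

Lemma dotxx x : dot x x = (l2norm x ^+ 2)%:C.
Proof.
rewrite /dot.
rewrite (_ : (fun i => _) = (fun i => (abs2 (x i))%:C)).
  rewrite csum_real rsum_ge0E; last by move=> i; exact: abs2_ge0.
  by rewrite -/(sqsum x) -l2norm_sqr.
by apply/funext => i; rewrite mulcJ.
Qed.

Lemma l2norm_eq0 x : l2norm x = 0 -> x = 0.
Proof.
move=> x0; apply: l2_ext => i; apply: abs2_eq0.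
apply/eqP; rewrite eq_le abs2_ge0 andbT -lee_fin.
have -> : 0%:E = sqsum x by rewrite -l2norm_sqr x0 expr0n.
apply: esum_ge; exists [set i]; first by split => //.
by rewrite fsbig_set1.
Qed.

Lemma l2norm0 : l2norm (0 : l2 R I) = 0.
Proof.
by apply/eqP; rewrite -sqrf_eq0; apply/eqP; apply: complexI; rewrite -dotxx dot0l.
Qed.

Lemma l2normZ c x : l2norm (c *: x) = normc c * l2norm x.
Proof.
apply/eqP; rewrite -(eqrXn2 (n := 2))// ?mulr_ge0 ?l2norm_ge0 ?normc_ge0//.
apply/eqP/complexI; rewrite -dotxx dotZl dotZr mulrA mulcJ dotxx -rmorphM /=.
by rewrite abs2E exprMn.
Qed.

Lemma cauchy_schwarz x y : normc (dot x y) <= l2norm x * l2norm y.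
Proof.
set c := dot x y; set a := l2norm y ^+ 2.
have E : dot (a%:C *: x - c *: y) (a%:C *: x - c *: y) =
   (a * (a * l2norm x ^+ 2 - abs2 c))%:C.
  rewrite !(dotBl, dotBr, dotZl, dotZr) !dotxx (dotC x y) -/c -/a !conjc_real.
  move: (l2norm x ^+ 2) => b; clearbody a c.
  by rewrite rmorphM rmorphB rmorphM /= -mulcJ; ring.
have H : 0 <= a * (a * l2norm x ^+ 2 - abs2 c).
  move: E; rewrite dotxx => /complexI <-; exact: sqr_ge0.
have [y0|yn0] := eqVneq (l2norm y) 0.
  by rewrite /c (l2norm_eq0 y0) dot0r Normc.normc0 mulr_ge0 ?l2norm_ge0.
have a0 : 0 < a by rewrite exprn_gt0// lt_neqAle eq_sym yn0 l2norm_ge0.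
move: H; rewrite pmulr_rge0// subr_ge0 abs2E /a -exprMn mulrC.
by rewrite ler_pXn2r ?nnegrE ?mulr_ge0 ?l2norm_ge0 ?normc_ge0.
Qed.

Lemma l2normD x y : l2norm (x + y) <= l2norm x + l2norm y.
Proof.
rewrite -(ler_pXn2r (n := 2)) ?nnegrE ?addr_ge0 ?l2norm_ge0//.
have E : l2norm (x + y) ^+ 2 =
   l2norm x ^+ 2 + l2norm y ^+ 2 + 2 * complex.Re (dot x y).
  apply: complexI; rewrite -dotxx !(dotDl, dotDr) !dotxx (dotC x y).
  move: (l2norm x ^+ 2) (l2norm y ^+ 2) (dot x y) => a b d.
  rewrite !rmorphD rmorphM /=.
  have -> : (2%:C : R[i]) * (complex.Re d)%:C = d + d^*.
    by rewrite addcJ; congr (_ * _); rewrite (rmorph_nat (real_complex R) 2).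
  by ring.
have := le_trans (ler_norm _) (le_trans (Re_normc (dot x y)) (cauchy_schwarz x y)).
by rewrite E sqrrD; lra.
Qed.

Lemma l2normN x : l2norm (- x) = l2norm x.
Proof. by rewrite -scaleN1r l2normZ normcN Normc.normc1 mul1r. Qed.

Lemma l2norm_sum (T : Type) (s : seq T) (P : pred T) (F : T -> l2 R I) :
  l2norm (\sum_(t <- s | P t) F t) <= \sum_(t <- s | P t) l2norm (F t).
Proof.
elim/big_rec2: _ => [|t u v _ H]; first by rewrite l2norm0.
by apply: le_trans (l2normD _ _) _; rewrite lerD2l.
Qed.

(** ** The canonical basis *)

Lemma bvecE (i j : I) : bvec R i j = (j == i)%:R.
Proof.
apply: mkl2E; rewrite unfold_in /sqsum (@esum_single _ _ _ i) ?abs2_ge0 ?ltry// => k ki.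
by rewrite (negPf ki) abs20.
Qed.

Lemma dot_bvecr x i : dot x (bvec R i) = x i.
Proof.
rewrite /dot (@csum_single _ _ _ i) ?bvecE ?eqxx ?conjc1 ?mulr1// => k ki.
by rewrite bvecE (negPf ki) conjc0 mulr0.
Qed.

Lemma dot_bvecl x i : dot (bvec R i) x = (x i)^*.
Proof. by rewrite dotC dot_bvecr. Qed.

Lemma l2norm_bvec (i : I) : l2norm (bvec R i) = 1.
Proof.
apply/eqP; rewrite -(eqrXn2 (n := 2)) ?l2norm_ge0// expr1n.
by apply/eqP/complexI; rewrite -dotxx dot_bvecr bvecE eqxx.
Qed.

Lemma dot_eqr x y : (forall z, dot x z = dot y z) -> x = y.
Proof. by move=> xy; apply: l2_ext => i; rewrite -!dot_bvecr. Qed.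

Definition l2trunc (s : seq I) x : l2 R I := \sum_(i <- s) x i *: bvec R i.

Lemma dot_trunc s x y : dot (l2trunc s x) y = \sum_(i <- s) x i * (y i)^*.
Proof. by rewrite dot_suml; apply: eq_bigr => i _; rewrite dotZl dot_bvecl. Qed.

Lemma l2truncE s x i : uniq s -> l2trunc s x i = if i \in s then x i else 0.
Proof.
move=> us; rewrite -dot_bvecr dot_trunc.
case: ifPn => [is_|ins].
  rewrite (bigD1_seq i)//= bvecE eqxx conjc1 mulr1 big1 ?addr0// => j ji.
  by rewrite bvecE (negPf ji) conjc0 mulr0.
rewrite big_seq big1// => j js; rewrite bvecE.
by case: eqP js ins => [->->//|_ _ _]; rewrite conjc0 mulr0.
Qed.

Lemma l2norm_truncE s x : uniq s -> l2norm (l2trunc s x) ^+ 2 = \sum_(i <- s) abs2 (x i).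
Proof.
move=> us; apply: complexI; rewrite -dotxx dot_trunc rmorph_sum /= !big_seq.
by apply: eq_bigr => i is_; rewrite l2truncE// is_ mulcJ.
Qed.

Lemma l2norm_sub_trunc s x : uniq s ->
  l2norm (x - l2trunc s x) ^+ 2 = l2norm x ^+ 2 - \sum_(i <- s) abs2 (x i).
Proof.
move=> us; apply: complexI; rewrite -dotxx !(dotBl, dotBr).
have H : dot (l2trunc s x) x = (\sum_(i <- s) abs2 (x i))%:C.
  by rewrite dot_trunc rmorph_sum; apply: eq_bigr => i _; rewrite mulcJ.
rewrite dotxx [dot x (l2trunc _ _)]dotC H dotxx l2norm_truncE// conjc_real rmorphB /=.
by ring.
Qed.

Lemma sum_abs2_le s x : uniq s -> \sum_(i <- s) abs2 (x i) <= l2norm x ^+ 2.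
Proof. by move=> us; rewrite -subr_ge0 -l2norm_sub_trunc// sqr_ge0. Qed.

Lemma fsbig_seq_fset (f : I -> R) (A : set I) : finite_set A ->
  (\sum_(i \in A) (f i)%:E = (\sum_(i <- fset_set A) f i)%:E)%E.
Proof. by move=> fA; rewrite fsbig_finite//= sumEFin. Qed.

(** This density is what allows bounded forms and operators to be compared on
    the canonical basis only. *)
Lemma l2_approx x (e : R) : 0 < e ->
  exists2 s : seq I, uniq s & l2norm (x - l2trunc s x) < e.
Proof.
move=> e0.
have e20 : 0 < e ^+ 2 by rewrite exprn_gt0.
have : ((l2norm x ^+ 2 - e ^+ 2)%:E < sqsum x)%E.
  by rewrite -l2norm_sqr lte_fin ltrBlDr ltrDl.
rewrite /sqsum /esum => /ereal_sup_gt [_ [A [finA _] <-]].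
rewrite fsbig_seq_fset// lte_fin => H.
exists (fset_set A) => //; rewrite -(ltr_pXn2r (n := 2)) ?nnegrE ?l2norm_ge0 ?ltW//.
by rewrite l2norm_sub_trunc//; lra.
Qed.

Lemma sqsum_le (f : I -> R[i]) (c : R) :
  (forall s : seq I, uniq s -> \sum_(i <- s) abs2 (f i) <= c) -> (sqsum f <= c%:E)%E.
Proof.
move=> H; apply: ge_ereal_sup => _ [A [finA _] <-].
by rewrite fsbig_seq_fset// lee_fin H.
Qed.

Lemma sqsummable_le (f : I -> R[i]) (c : R) :
  (sqsum f <= c%:E)%E -> f \in @sqsummable R I.
Proof. by move=> H; rewrite unfold_in (le_lt_trans H)// ltry. Qed.

End L2.

Section Forms.
Variables (R : realType) (I J : choiceType).

Definition bform (B : l2 R I -> l2 R J -> R[i]) :=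
  [/\ forall c x x' y, B (c *: x + x') y = c * B x y + B x' y,
      forall c x y y', B x (c *: y + y') = c^* * B x y + B x y'
    & exists2 c : R, 0 <= c & forall x y, normc (B x y) <= c * l2norm x * l2norm y].

Variable B : l2 R I -> l2 R J -> R[i].
Hypothesis HB : bform B.

Lemma bform0l y : B 0 y = 0.
Proof.
have [H _ _] := HB; have := H 1 0 0 y.
by rewrite scale1r addr0 mul1r => /eq_addr_eq0.
Qed.

Lemma bform0r x : B x 0 = 0.
Proof.
have [_ H _] := HB; have := H 1 x 0 0.
by rewrite scale1r addr0 conjc1 mul1r => /eq_addr_eq0.
Qed.

Lemma bform_suml (T : Type) (s : seq T) (F : T -> l2 R I) (c : T -> R[i]) y :
  B (\sum_(t <- s) c t *: F t) y = \sum_(t <- s) c t * B (F t) y.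
Proof.
elim: s => [|t s IH]; first by rewrite !big_nil bform0l.
by case: HB => H _ _; rewrite !big_cons H IH.
Qed.

Lemma bform_sumr (T : Type) (s : seq T) (F : T -> l2 R J) (c : T -> R[i]) x :
  B x (\sum_(t <- s) c t *: F t) = \sum_(t <- s) (c t)^* * B x (F t).
Proof.
elim: s => [|t s IH]; first by rewrite !big_nil bform0r.
by case: HB => _ H _; rewrite !big_cons H IH.
Qed.

Lemma eps_le0 (a c : R) : 0 <= c -> (forall e : R, 0 < e -> a <= c * e) -> a <= 0.
Proof.
move=> c0 H; apply/ler_addgt0Pl => e e0.
have := H (e / (c + 1)); rewrite divr_gt0 ?ltr_wpDl// => /(_ isT) /le_trans; apply.
rewrite addr0 mulrCA ler_piMr ?(ltW e0)// ler_pdivrMr ?ltr_wpDl//.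
by rewrite mul1r lerDl.
Qed.

Lemma bform_eq0 : (forall i j, B (bvec R i) (bvec R j) = 0) -> forall x y, B x y = 0.
Proof.
move=> H0; have [Hl Hr [c c0 Hc]] := HB.
have H1 i y : B (bvec R i) y = 0.
  apply: Normc.eq0_normc; apply/eqP; rewrite eq_le normc_ge0 andbT.
  apply: (@eps_le0 _ c c0) => e e0.
  have [s us hs] := l2_approx y e0.
  have -> : y = 1 *: (y - l2trunc s y) + l2trunc s y by rewrite scale1r subrK.
  rewrite Hr conjc1 mul1r bform_sumr big1 ?addr0; last by move=> k _; rewrite H0 mulr0.
  apply: le_trans (Hc _ _) _; rewrite l2norm_bvec mulr1.
  by rewrite ler_wpM2l// ltW.
move=> x y; apply: Normc.eq0_normc; apply/eqP; rewrite eq_le normc_ge0 andbT.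
apply: (@eps_le0 _ (c * l2norm y)) => [|e e0]; first by rewrite mulr_ge0 ?l2norm_ge0.
have [s us hs] := l2_approx x e0.
have -> : x = 1 *: (x - l2trunc s x) + l2trunc s x by rewrite scale1r subrK.
rewrite Hl mul1r bform_suml big1 ?addr0; last by move=> k _; rewrite H1 mulr0.
apply: le_trans (Hc _ _) _; rewrite mulrAC.
by apply: ler_wpM2l; [rewrite mulr_ge0 ?l2norm_ge0|exact: ltW].
Qed.

End Forms.

Section Riesz.
Variables (R : realType) (I J : choiceType).
Implicit Types (T : op R I J) (B : l2 R I -> l2 R J -> R[i]).

Lemma bformB B B' : bform B -> bform B' -> bform (fun x y => B x y - B' x y).
Proof.
move=> [l1 r1 [c c0 h1]] [l2 r2 [d d0 h2]]; split.
- by move=> *; rewrite l1 l2; ring.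
- by move=> *; rewrite r1 r2; ring.
exists (c + d); first by rewrite addr_ge0.
move=> x y; apply: le_trans (normcD _ _) _; rewrite normcN !mulrDl.
exact: lerD.
Qed.

(** By density of the finitely supported vectors.  Most identities between
    operators below are reduced to basis vectors in this way. *)
Lemma bform_ext B B' : bform B -> bform B' ->
  (forall i j, B (bvec R i) (bvec R j) = B' (bvec R i) (bvec R j)) ->
  forall x y, B x y = B' x y.
Proof.
move=> bB bB' H x y; apply/eqP; rewrite -subr_eq0; apply/eqP.
by apply: (bform_eq0 (bformB bB bB')) => i j; rewrite H subrr.
Qed.

Lemma bounded_ge0 T : bounded_op T ->
  exists2 c : R, 0 <= c & forall x, l2norm (T x) <= c * l2norm x.
Proof.
move=> [_ [c Hc]]; exists `|c| => // x.
by apply: le_trans (Hc x) _; rewrite ler_wpM2r ?l2norm_ge0 ?ler_norm.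
Qed.

Lemma linop T : linear T -> forall (c : R[i]) x y, T (c *: x + y) = c *: T x + T y.
Proof. by []. Qed.

Lemma mk_linear T : (forall (c : R[i]) x y, T (c *: x + y) = c *: T x + T y) -> linear T.
Proof. by []. Qed.

Lemma linop0 T : linear T -> T 0 = 0.
Proof.
move=> H; have := linop H 1 0 0.
by rewrite !scale1r addr0 => /eq_addr_eq0.
Qed.

Lemma linopD T : linear T -> forall x y, T (x + y) = T x + T y.
Proof. by move=> H x y; have := linop H 1 x y; rewrite !scale1r. Qed.

Lemma linopZ T : linear T -> forall (c : R[i]) x, T (c *: x) = c *: T x.
Proof. by move=> H c x; have := linop H c x 0; rewrite linop0// !addr0. Qed.

Lemma linop_sum T : linear T -> forall (U : Type) (s : seq U) (P : pred U) (F : U -> l2 R I),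
  T (\sum_(t <- s | P t) F t) = \sum_(t <- s | P t) T (F t).
Proof.
move=> H U s P F.
by elim/big_rec2: _ => [|t u v _ <-]; rewrite ?linop0// linopD.
Qed.

Lemma bform_of_op T : bounded_op T -> bform (fun x y => dot (T x) y).
Proof.
move=> bT; have [c c0 Hc] := bounded_ge0 bT; have [lT _] := bT; split.
- by move=> *; rewrite lT dotDl dotZl.
- by move=> *; rewrite dotDr dotZr.
exists c => // x y; apply: le_trans (cauchy_schwarz _ _) _.
by rewrite ler_wpM2r ?l2norm_ge0.
Qed.

Lemma bounded_op_ext T T' : bounded_op T -> bounded_op T' ->
  (forall i, T (bvec R i) = T' (bvec R i)) -> T = T'.
Proof.
move=> bT bT' H; apply/funext => x; apply: dot_eqr => y.
by apply: (bform_ext (bform_of_op bT) (bform_of_op bT')) => i j; rewrite H.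
Qed.

(** The coordinates of [Y x] must be the numbers [B x e_j]; they are square
    summable because the vector [z] of any finitely many of them satisfies
    |z|^2 = B x z <= c |x| |z|. *)
Lemma riesz B : bform B -> exists Y, bounded_op Y /\ forall x y, dot (Y x) y = B x y.
Proof.
move=> bB; have [lB rB [c c0 Hc]] := bB.
pose f x j := B x (bvec R j).
have fs x : (sqsum (f x) <= ((c * l2norm x) ^+ 2)%:E)%E.
  apply: sqsum_le => s us; set S := \sum_(_ <- s) _.
  have S0 : 0 <= S by apply: sumr_ge0 => i _; exact: abs2_ge0.
  pose z := \sum_(j <- s) f x j *: bvec R j.
  have zj j : j \in s -> z j = f x j.
    move=> js; rewrite l2sumE (bigD1_seq j)// l2ZE bvecE eqxx mulr1 big1; first exact: addr0.
    by move=> k kj; rewrite l2ZE bvecE eq_sym (negPf kj) mulr0.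
  have z2 : l2norm z ^+ 2 = S.
    apply: complexI; rewrite -dotxx {1}/z dot_suml rmorph_sum /= !big_seq.
    by apply: eq_bigr => j js; rewrite dotZl dot_bvecl zj// mulcJ.
  have Bz : B x z = S%:C.
    rewrite /z (bform_sumr bB) rmorph_sum /=; apply: eq_bigr => j _.
    by rewrite mulrC mulcJ.
  have := Hc x z; rewrite Bz normc_real// -z2 => h.
  have [->|zn0] := eqVneq (l2norm z) 0.
    by rewrite expr0n /= sqr_ge0.
  have zp : 0 < l2norm z by rewrite lt_neqAle eq_sym zn0 l2norm_ge0.
  move: h; rewrite expr2 ler_pM2r// => h.
  by rewrite -expr2 ler_pXn2r ?nnegrE ?mulr_ge0 ?l2norm_ge0.
pose Y x : l2 R J := mkl2 (f x).
have YE x j : Y x j = f x j by rewrite mkl2E//; exact: sqsummable_le (fs x).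
have bY : bounded_op Y.
  split; first by apply: mk_linear => a x y; apply: l2_ext => j; rewrite l2DE l2ZE !YE /f lB.
  exists c => x; rewrite -(ler_pXn2r (n := 2)) ?nnegrE ?mulr_ge0 ?l2norm_ge0//.
  rewrite -lee_fin l2norm_sqr (_ : l2val (Y x) = f x)//.
  by apply/funext => j; exact: YE.
exists Y; split => // x y.
apply: (bform_ext (bform_of_op bY) bB) => i j.
by rewrite dot_bvecr YE.
Qed.

Lemma op_of_formP B : bform B ->
  bounded_op (op_of_form B) /\ forall x y, dot (op_of_form B x) y = B x y.
Proof.
move=> /riesz [Y HY]; rewrite /op_of_form; case: xgetP => [Z _ //|/(_ Y)].
by move=> /(_ HY).
Qed.

Lemma op_of_form_eq B Y : bounded_op Y -> (forall x y, dot (Y x) y = B x y) ->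
  op_of_form B = Y.
Proof.
move=> bY HY; rewrite /op_of_form; case: xgetP => [Z _ [bZ HZ]|/(_ Y) []//].
by apply/funext => x; apply: dot_eqr => y; rewrite HZ HY.
Qed.

End Riesz.

Section Adjoint.
Variables (R : realType) (I J : choiceType).
Implicit Types (T : op R I J).

Lemma adj_form T : bounded_op T -> bform (fun y x => dot y (T x)).
Proof.
move=> bT; have [lT _] := bT; have [c c0 Hc] := bounded_ge0 bT; split.
- by move=> *; rewrite dotDl dotZl.
- by move=> *; rewrite lT dotDr dotZr.
exists c => // x y; apply: le_trans (cauchy_schwarz _ _) _.
apply: le_trans (ler_wpM2l (l2norm_ge0 _) (Hc _)) _.
by rewrite mulrCA mulrA.
Qed.

Lemma bounded_adj T : bounded_op T -> bounded_op (adj T).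
Proof. by move=> /adj_form /op_of_formP []. Qed.

Lemma dot_adjl T x y : bounded_op T -> dot (adj T y) x = dot y (T x).
Proof. by move=> /adj_form /op_of_formP [_ H]; exact: H. Qed.

Lemma dot_adjr T x y : bounded_op T -> dot x (adj T y) = dot (T x) y.
Proof. by move=> bT; rewrite dotC dot_adjl// -dotC. Qed.

Lemma adj_eq T (S : op R J I) : bounded_op S ->
  (forall x y, dot (S y) x = dot y (T x)) -> adj T = S.
Proof. by move=> bS H; apply: op_of_form_eq. Qed.

(** An operator and its adjoint satisfy the same bound, because
    |T^* y|^2 = (y, T T^* y). *)
Lemma adj_norm T (c : R) : bounded_op T -> 0 <= c ->
  (forall x, l2norm (T x) <= c * l2norm x) ->
  forall y, l2norm (adj T y) <= c * l2norm y.
Proof.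
move=> bT c0 Hc y.
have [->|n0] := eqVneq (l2norm (adj T y)) 0; first by rewrite mulr_ge0 ?l2norm_ge0.
have np : 0 < l2norm (adj T y) by rewrite lt_neqAle eq_sym n0 l2norm_ge0.
rewrite -(ler_pM2r np) -expr2.
have -> : l2norm (adj T y) ^+ 2 = normc (dot y (T (adj T y))).
  by rewrite -dot_adjl// dotxx normc_real// sqr_ge0.
apply: le_trans (cauchy_schwarz _ _) _.
apply: le_trans (ler_wpM2l (l2norm_ge0 _) (Hc _)) _.
by rewrite mulrCA mulrA.
Qed.

End Adjoint.

(** * Fibrewise operators *)

(** A decomposition of an index set [L] into the pieces [K a], that is, of the
    Hilbert space [l2 L] into the orthogonal sum of the [l2 (K a)].  It covers
    at once the two amplifications on [l2 (I * J)] and direct sums. *)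
Record fibration (A : choiceType) (K : A -> choiceType) (L : choiceType) := Fibration {
  fin : forall a, K a -> L;
  fbase : L -> A;
  fpt : forall l, K (fbase l);
  fptK : forall l, fin (fpt l) = l;
  fbaseK : forall a k, fbase (@fin a k) = a;
  fin_inj : forall a, injective (@fin a) }.

Section Fibres.
Variables (R : realType) (A : choiceType) (K : A -> choiceType) (L : choiceType).
Variable P : fibration K L.

(** At a point [fin k] the fibre is [K a] only up to the equality [fbaseK], which
    this lemma eliminates once and for all. *)
Lemma fptE (U : Type) (F : forall a, K a -> U) a (k : K a) :
  F (fbase P (fin P k)) (fpt P (fin P k)) = F a k.
Proof.
suff H b (k' : K b) : b = a -> fin P k' = fin P k -> F b k' = F a k.
  by apply: H; [exact: fbaseK|exact: fptK].
by move=> e; case: a / e k => k /(@fin_inj _ _ _ P) ->.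
Qed.

Lemma sqsum_fibres (f : L -> R[i]) :
  sqsum f = (\esum_(a in [set: A]) sqsum (fun k => f (fin P (a := a) k)))%E.
Proof.
rewrite /sqsum; under [RHS]eq_esum => a _.
  rewrite -(@reindex_esum _ _ _ setT [set l | fbase P l = a] (fin P (a := a))
    (fun l => (abs2 (f l))%:E)); first by over.
  split; first by move=> k _; exact: fbaseK.
  - by move=> k k' _ _; exact: fin_inj.
  - by move=> l /= <-; exists (fpt P l); rewrite ?fptK.
rewrite esum_esum; last by move=> *; rewrite lee_fin abs2_ge0.
symmetry; apply: (@reindex_esum _ _ _ _ _ (fun l => (fbase P l, l)))  => //.
split; first by move=> l _; split.
- by move=> l l' _ _ [].
- by move=> [a l] /= [_ <-]; exists l.
Qed.

Lemma fib_summable (x : l2 R L) a : (fun k => x (fin P (a := a) k)) \in @sqsummable R (K a).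
Proof.
apply: (@sqsummable_le _ _ _ (l2norm x ^+ 2)); apply: sqsum_le => s us.
have := sum_abs2_le x (s := [seq fin P k | k <- s]).
by rewrite big_map; apply; rewrite map_inj_uniq//; exact: fin_inj.
Qed.

Definition fib a (x : l2 R L) : l2 R (K a) := mkl2 (fun k => x (fin P (a := a) k)).

Lemma fibE a x k : fib a x k = x (fin P (a := a) k).
Proof. exact: mkl2E (fib_summable x a) k. Qed.

Lemma fib_fun a (x : l2 R L) : fib a x = (fun k => x (fin P (a := a) k)) :> (_ -> _).
Proof. by apply/funext => k; rewrite fibE. Qed.

Lemma fib_linear a (c : R[i]) x y : fib a (c *: x + y) = c *: fib a x + fib a y.
Proof. by apply: l2_ext => k; rewrite l2DE l2ZE !fibE. Qed.

Lemma l2norm_fibres x :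
  (l2norm x ^+ 2)%:E = (\esum_(a in [set: A]) (l2norm (fib a x) ^+ 2)%:E)%E.
Proof.
rewrite l2norm_sqr sqsum_fibres; apply: eq_esum => a _.
by rewrite l2norm_sqr fib_fun.
Qed.

Lemma l2norm_fib a x : l2norm (fib a x) <= l2norm x.
Proof.
rewrite -(ler_pXn2r (n := 2)) ?nnegrE ?l2norm_ge0// -lee_fin [leRHS]l2norm_fibres.
by apply: esum_ge; exists [set a] => //; rewrite fsbig_set1.
Qed.

Lemma fib_ext x y : (forall a, fib a x = fib a y) -> x = y.
Proof.
by move=> H; apply: l2_ext => l; rewrite -(fptK P l) -!fibE H.
Qed.

End Fibres.

Section BlockDiagonal.
Variables (R : realType) (A : choiceType) (K K' : A -> choiceType) (L L' : choiceType).
Variables (P : fibration K L) (P' : fibration K' L').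
Variable T : forall a, op R (K a) (K' a).

(** The orthogonal sum of the operators [T a]. *)
Definition bdiag : op R L L' :=
  fun x => mkl2 (fun l => T (fib P (fbase P' l) x) (fpt P' l)).

Variable c : R.
Hypothesis c0 : 0 <= c.
Hypothesis Tlin : forall a, linear (T (a := a)).
Hypothesis Tc : forall a x, l2norm (T (a := a) x) <= c * l2norm x.

Let g (x : l2 R L) l := T (fib P (fbase P' l) x) (fpt P' l).

Let g_fun x a : (fun k => g x (fin P' (a := a) k)) = T (fib P a x) :> (_ -> _).
Proof.
apply/funext => k; rewrite /g.
exact: (fptE P' (fun a k => T (fib P a x) k)).
Qed.

Let g_le x : (sqsum (g x) <= ((c * l2norm x) ^+ 2)%:E)%E.
Proof.
rewrite (sqsum_fibres P') exprMn EFinM (l2norm_fibres P).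
rewrite -esumTZ ?sqr_ge0//; last by move=> a; rewrite sqr_ge0.
apply: le_esum => a _; rewrite g_fun -l2norm_sqr lee_fin -exprMn.
by rewrite ler_pXn2r ?nnegrE ?mulr_ge0 ?l2norm_ge0.
Qed.

Lemma bdiagE x l : bdiag x l = T (fib P (fbase P' l) x) (fpt P' l).
Proof. by rewrite /bdiag mkl2E//; exact: sqsummable_le (g_le x). Qed.

Lemma fib_bdiag x a : fib P' a (bdiag x) = T (fib P a x).
Proof.
apply: l2_ext => k; rewrite fibE bdiagE.
exact: (fptE P' (fun a k => T (fib P a x) k)).
Qed.

Lemma bdiag_norm x : l2norm (bdiag x) <= c * l2norm x.
Proof.
rewrite -(ler_pXn2r (n := 2)) ?nnegrE ?mulr_ge0 ?l2norm_ge0//.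
rewrite -lee_fin l2norm_sqr (_ : l2val (bdiag x) = g x)//.
by apply/funext => l; exact: bdiagE.
Qed.

Lemma bdiag_bounded : bounded_op bdiag.
Proof.
split; last by exists c; exact: bdiag_norm.
apply: mk_linear => a x y; apply: (@fib_ext _ _ _ _ P') => b.
by rewrite fib_linear !fib_bdiag fib_linear (linop (@Tlin b)).
Qed.

End BlockDiagonal.

(** ** Amplifications *)

Section Amplification.
Variables (R : realType).

Definition fib_l (I J : choiceType) : fibration (fun _ : J => I) (I * J)%type.
Proof.
apply: (@Fibration J (fun _ => I) (I * J)%type (fun j i => (i, j)) snd fst).
- by case. - by []. - by move=> j i i' [].
Defined.

Definition fib_r (I J : choiceType) : fibration (fun _ : I => J) (I * J)%type.
Proof.
apply: (@Fibration I (fun _ => J) (I * J)%type (fun i j => (i, j)) fst snd).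
- by case. - by []. - by move=> i j j' [].
Defined.

Variables (I I' J J' : choiceType).

Lemma amp_l_bdiag (T : op R I I') :
  amp_l T = bdiag (fib_l I J) (fib_l I' J) (fun _ => T) :> op R (I * J)%type (I' * J)%type.
Proof. by []. Qed.

Lemma amp_r_bdiag (T : op R J J') :
  amp_r T = bdiag (fib_r I J) (fib_r I J') (fun _ => T) :> op R (I * J)%type (I * J')%type.
Proof. by []. Qed.

(** A vector of [l2 (I * J)] is a matrix; these are its columns and its rows. *)
Definition colv (j : J) (f : l2 R (I * J)%type) : l2 R I := fib (fib_l I J) j f.
Definition rowv (i : I) (f : l2 R (I * J)%type) : l2 R J := fib (fib_r I J) i f.

Lemma colvE j f i : colv j f i = f (i, j). Proof. by rewrite /colv fibE. Qed.
Lemma rowvE i f j : rowv i f j = f (i, j). Proof. by rewrite /rowv fibE. Qed.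

Lemma colvD j f g : colv j (f + g) = colv j f + colv j g.
Proof. by apply: l2_ext => i; rewrite l2DE !colvE. Qed.
Lemma colvZ j c f : colv j (c *: f) = c *: colv j f.
Proof. by apply: l2_ext => i; rewrite l2ZE !colvE. Qed.
Lemma colv_sum j (T : Type) (s : seq T) (F : T -> l2 R (I * J)%type) :
  colv j (\sum_(t <- s) F t) = \sum_(t <- s) colv j (F t).
Proof. by apply: l2_ext => i; rewrite colvE !l2sumE; apply: eq_bigr => t _; rewrite colvE. Qed.
Lemma l2norm_colv j f : l2norm (colv j f) <= l2norm f.
Proof. exact: l2norm_fib. Qed.

Lemma colv_ext f g : (forall j, colv j f = colv j g) -> f = g.
Proof. by move=> H; apply: l2_ext => -[i j]; rewrite -!colvE H. Qed.

Lemma amp_lE (T : op R I I') : bounded_op T -> forall (f : l2 R (I * J)%type) i j,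
  amp_l T f (i, j) = T (colv j f) i.
Proof.
move=> bT f i j; have [c c0 Hc] := bounded_ge0 bT.
by rewrite amp_l_bdiag (bdiagE _ _ c0).
Qed.

Lemma amp_rE (T : op R J J') : bounded_op T -> forall (f : l2 R (I * J)%type) i j,
  amp_r T f (i, j) = T (rowv i f) j.
Proof.
move=> bT f i j; have [c c0 Hc] := bounded_ge0 bT.
by rewrite amp_r_bdiag (bdiagE _ _ c0).
Qed.

Lemma bounded_amp_l (T : op R I I') : bounded_op T ->
  bounded_op (amp_l T : op R (I * J)%type (I' * J)%type).
Proof.
move=> bT; have [c c0 Hc] := bounded_ge0 bT; have [lT _] := bT.
by rewrite amp_l_bdiag; apply: (bdiag_bounded _ _ c0).
Qed.

Lemma bounded_amp_r (T : op R J J') : bounded_op T ->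
  bounded_op (amp_r T : op R (I * J)%type (I * J')%type).
Proof.
move=> bT; have [c c0 Hc] := bounded_ge0 bT; have [lT _] := bT.
by rewrite amp_r_bdiag; apply: (bdiag_bounded _ _ c0).
Qed.

End Amplification.

Section Tensors.
Variables (R : realType) (I J : choiceType).

Lemma tens_summable (x : l2 R I) (y : l2 R J) :
  (sqsum (fun p : I * J => (x p.1 * y p.2)%R) <= ((l2norm x * l2norm y) ^+ 2)%:E)%E.
Proof.
rewrite (sqsum_fibres (fib_r I J)) exprMn EFinM l2norm_sqr muleC -esumTZ ?sqr_ge0//.
  apply: le_esum => i _; rewrite mulrC EFinM l2norm_sqr /sqsum.
  under eq_esum do rewrite abs2M.
  rewrite -esumTZ ?abs2_ge0// => j; exact: abs2_ge0.
by move=> i; exact: abs2_ge0.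
Qed.

Lemma tensE (x : l2 R I) (y : l2 R J) i j : tens x y (i, j) = x i * y j.
Proof. by rewrite /tens mkl2E//; exact: sqsummable_le (tens_summable x y). Qed.

Lemma l2norm_tens_le (x : l2 R I) (y : l2 R J) : l2norm (tens x y) <= l2norm x * l2norm y.
Proof.
rewrite -(ler_pXn2r (n := 2)) ?nnegrE ?mulr_ge0 ?l2norm_ge0//.
rewrite -lee_fin l2norm_sqr; apply: le_trans (tens_summable x y).
rewrite (_ : l2val (tens x y) = fun p => x p.1 * y p.2)//.
by apply/funext => -[i j]; rewrite tensE.
Qed.

Lemma tensDl (x x' : l2 R I) (y : l2 R J) : tens (x + x') y = tens x y + tens x' y.
Proof. by apply: l2_ext => -[i j]; rewrite l2DE !tensE l2DE mulrDl. Qed.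
Lemma tensDr (x : l2 R I) (y y' : l2 R J) : tens x (y + y') = tens x y + tens x y'.
Proof. by apply: l2_ext => -[i j]; rewrite l2DE !tensE l2DE mulrDr. Qed.
Lemma tensZl c (x : l2 R I) (y : l2 R J) : tens (c *: x) y = c *: tens x y.
Proof. by apply: l2_ext => -[i j]; rewrite l2ZE !tensE l2ZE mulrA. Qed.
Lemma tensZr c (x : l2 R I) (y : l2 R J) : tens x (c *: y) = c *: tens x y.
Proof. by apply: l2_ext => -[i j]; rewrite l2ZE !tensE l2ZE mulrCA. Qed.
Lemma bvec_tens (i : I) (j : J) : bvec R (i, j) = tens (bvec R i) (bvec R j).
Proof.
apply: l2_ext => -[k l]; rewrite [RHS]tensE !bvecE xpair_eqE.
by case: (k == i); rewrite ?mul1r ?mul0r.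
Qed.

Lemma colv_tens (x : l2 R I) (y : l2 R J) j : colv j (tens x y) = y j *: x.
Proof. by apply: l2_ext => i; rewrite colvE tensE l2ZE mulrC. Qed.

Lemma rowv_tens (x : l2 R I) (y : l2 R J) i : rowv i (tens x y) = x i *: y.
Proof. by apply: l2_ext => j; rewrite rowvE tensE l2ZE. Qed.

(** The column map is the adjoint of [x |-> x (x) e_j]. *)
Lemma dot_tens_bvec (f : l2 R (I * J)%type) (x : l2 R I) j :
  dot f (tens x (bvec R j)) = dot (colv j f) x.
Proof.
pose B1 (f : l2 R (I * J)%type) x := dot f (tens x (bvec R j)).
pose B2 (f : l2 R (I * J)%type) x := dot (colv j f) x.
apply: (@bform_ext _ _ _ B1 B2) => [||[i k] l].
- split=> [c u v w|c u v w|]; rewrite /B1 ?dotDl ?dotZl//.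
    by rewrite tensDl tensZl dotDr dotZr.
  exists 1 => // u v; rewrite mul1r; apply: le_trans (cauchy_schwarz _ _) _.
  rewrite ler_wpM2l ?l2norm_ge0// (le_trans (l2norm_tens_le _ _))//.
  by rewrite l2norm_bvec mulr1.
- split=> [c u v w|c u v w|]; rewrite /B2.
  + by rewrite colvD colvZ dotDl dotZl.
  + by rewrite dotDr dotZr.
  exists 1 => // u v; rewrite mul1r; apply: le_trans (cauchy_schwarz _ _) _.
  by rewrite ler_wpM2r ?l2norm_ge0 ?l2norm_colv.
- by rewrite /B1 /B2 -bvec_tens !dot_bvecr bvecE colvE bvecE.
Qed.

Lemma dot_tens (x x' : l2 R I) (y y' : l2 R J) :
  dot (tens x y) (tens x' y') = dot x x' * dot y y'.
Proof.
pose B1 (y y' : l2 R J) := dot (tens x y) (tens x' y').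
pose B2 (y y' : l2 R J) := dot x x' * dot y y'.
apply: (@bform_ext _ _ _ B1 B2) => [||i j].
- split=> [c u v w|c u v w|]; rewrite /B1.
  + by rewrite tensDr tensZr dotDl dotZl.
  + by rewrite tensDr tensZr dotDr dotZr.
  exists (l2norm x * l2norm x') => [|u v]; first by rewrite mulr_ge0 ?l2norm_ge0.
  apply: le_trans (cauchy_schwarz _ _) _.
  apply: le_trans (ler_pM _ _ (l2norm_tens_le _ _) (l2norm_tens_le _ _)) _.
  + exact: l2norm_ge0.
  + exact: l2norm_ge0.
  by rewrite mulrACA mulrA.
- split=> [c u v w|c u v w|]; rewrite /B2.
  + by rewrite dotDl dotZl; ring.
  + by rewrite dotDr dotZr; ring.
  exists (l2norm x * l2norm x') => [|u v]; first by rewrite mulr_ge0 ?l2norm_ge0.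
  rewrite Normc.normcM -[leRHS]mulrA.
  by apply: ler_pM; rewrite ?normc_ge0 ?cauchy_schwarz.
- by rewrite /B1 /B2 dot_tens_bvec colv_tens dotZl !dot_bvecr mulrC.
Qed.

Lemma l2norm_tens (x : l2 R I) (y : l2 R J) : l2norm (tens x y) = l2norm x * l2norm y.
Proof.
apply/eqP; rewrite -(eqrXn2 (n := 2)) ?mulr_ge0 ?l2norm_ge0// exprMn; apply/eqP/complexI.
by rewrite [RHS]rmorphM /= -!dotxx dot_tens.
Qed.

End Tensors.

(** * The ring of bounded operators and matrices over it *)

Section BoundedRing.
Variables (R : realType) (I : choiceType).

(** Bundling the bound turns bounded operators into a ring, and an operator on
    [l2 (I * 'I_n)] into an ordinary matrix with entries in that ring. *)
Record bop := MkBop { bval :> op R I I; bvalP : bounded_op bval }.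

Lemma bop_ext (a b : bop) : (forall x, a x = b x) -> a = b.
Proof.
case: a => a pa; case: b => b pb /= H.
have e : a = b by apply/funext.
by case: b / e pb H => pb _; congr MkBop; exact: Prop_irrelevance.
Qed.

HB.instance Definition _ := gen_eqMixin bop.
HB.instance Definition _ := gen_choiceMixin bop.

Lemma bop_lin (a : bop) : linear a. Proof. by case: a => a []. Qed.
Lemma bounded_op0 : bounded_op (fun _ : l2 R I => 0 : l2 R I).
Proof.
split; first by apply: mk_linear => c x y; rewrite scaler0 addr0.
by exists 0 => x; rewrite mul0r l2norm0.
Qed.

Lemma bounded_opD (J : choiceType) (a b : op R I J) : bounded_op a -> bounded_op b ->
  bounded_op (fun x => a x + b x).
Proof.
move=> ba bb; have [la _] := ba; have [lb _] := bb.
have [c c0 Hc] := bounded_ge0 ba; have [d d0 Hd] := bounded_ge0 bb.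
split.
  by apply: mk_linear => e x y; rewrite (linop la) (linop lb) scalerDr addrACA.
by exists (c + d) => x; rewrite mulrDl (le_trans (l2normD _ _))// lerD.
Qed.

Lemma bounded_opZ (J : choiceType) (e : R[i]) (a : op R I J) : bounded_op a ->
  bounded_op (fun x => e *: a x).
Proof.
move=> ba; have [la _] := ba; have [c c0 Hc] := bounded_ge0 ba.
split.
  by apply: mk_linear => d x y; rewrite (linop la) scalerDr !scalerA mulrC.
exists (normc e * c) => x; rewrite l2normZ -mulrA ler_wpM2l ?normc_ge0//.
Qed.

Lemma bounded_op_comp (J K : choiceType) (a : op R J K) (b : op R I J) :
  bounded_op a -> bounded_op b -> bounded_op (a \o b).
Proof.
move=> ba bb; have [la _] := ba; have [lb _] := bb.
have [c c0 Hc] := bounded_ge0 ba; have [d d0 Hd] := bounded_ge0 bb.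
split.
  by apply: mk_linear => e x y; rewrite /= (linop lb) (linop la).
exists (c * d) => x; rewrite /= (le_trans (Hc _))// -mulrA ler_wpM2l//.
Qed.

Lemma bounded_op_id : bounded_op (id : op R I I).
Proof. by split => //; exists 1 => x; rewrite mul1r. Qed.

Definition bzero := MkBop bounded_op0.
Definition badd (a b : bop) := MkBop (bounded_opD (bvalP a) (bvalP b)).
Definition bscale (c : R[i]) (a : bop) := MkBop (bounded_opZ c (bvalP a)).
Definition bopp (a : bop) := bscale (-1) a.
Definition bone := MkBop bounded_op_id.
Definition bmul (a b : bop) := MkBop (bounded_op_comp (bvalP a) (bvalP b)).

Fact baddA : associative badd.
Proof. by move=> a b c; apply: bop_ext => x /=; rewrite addrA. Qed.
Fact baddC : commutative badd.
Proof. by move=> a b; apply: bop_ext => x /=; rewrite addrC. Qed.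
Fact badd0 : left_id bzero badd.
Proof. by move=> a; apply: bop_ext => x /=; rewrite add0r. Qed.
Fact baddN : left_inverse bzero bopp badd.
Proof. by move=> a; apply: bop_ext => x /=; rewrite scaleN1r addNr. Qed.

HB.instance Definition _ := GRing.isZmodule.Build bop baddA baddC badd0 baddN.

Fact bmulA : associative bmul. Proof. by move=> a b c; apply: bop_ext. Qed.
Fact bmul1l : left_id bone bmul. Proof. by move=> a; apply: bop_ext. Qed.
Fact bmul1r : right_id bone bmul. Proof. by move=> a; apply: bop_ext. Qed.
Fact bmulDl : left_distributive bmul +%R. Proof. by move=> a b c; apply: bop_ext. Qed.
Fact bmulDr : right_distributive bmul +%R.
Proof. by move=> a b c; apply: bop_ext => x /=; rewrite (linopD (@bop_lin a)). Qed.

HB.instance Definition _ :=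
  GRing.Zmodule_isPzRing.Build bop bmulA bmul1l bmul1r bmulDl bmulDr.

Fact bscaleA (c d : R[i]) (a : bop) : bscale c (bscale d a) = bscale (c * d) a.
Proof. by apply: bop_ext => x /=; rewrite scalerA. Qed.
Fact bscale1 : left_id 1 bscale.
Proof. by move=> a; apply: bop_ext => x /=; rewrite scale1r. Qed.
Fact bscaleDr : right_distributive bscale +%R.
Proof. by move=> c a b; apply: bop_ext => x /=; rewrite scalerDr. Qed.
Fact bscaleDl (a : bop) : {morph bscale^~ a : c d / c + d}.
Proof. by move=> c d; apply: bop_ext => x /=; rewrite scalerDl. Qed.

HB.instance Definition _ :=
  GRing.Zmodule_isLmodule.Build R[i] bop bscaleA bscale1 bscaleDr bscaleDl.

Implicit Types (a b : bop) (c : R[i]).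

Lemma bopD a b x : (a + b) x = a x + b x. Proof. by []. Qed.
Lemma bopM a b x : (a * b) x = a (b x). Proof. by []. Qed.
Lemma bopZ c a x : (c *: a) x = c *: a x. Proof. by []. Qed.
Lemma bop0 x : (0 : bop) x = 0. Proof. by []. Qed.
Lemma bop1 x : (1 : bop) x = x. Proof. by []. Qed.
Lemma bop_sum (T : Type) (s : seq T) (P : pred T) (F : T -> bop) x :
  (\sum_(t <- s | P t) F t) x = \sum_(t <- s | P t) F t x.
Proof. by elim/big_rec2: _ => // t u v _ <-. Qed.
Lemma bvalZ c a : bval (c *: a) = c *: bval a. Proof. by []. Qed.
Lemma bvalD a b : bval (a + b) = bval a + bval b. Proof. by []. Qed.
Lemma bvalM a b : bval (a * b) = bval a \o bval b. Proof. by []. Qed.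
Lemma bval_sum (T : Type) (s : seq T) (P : pred T) (F : T -> bop) :
  bval (\sum_(t <- s | P t) F t) = \sum_(t <- s | P t) bval (F t).
Proof. by elim/big_rec2: _ => // t u v _ <-. Qed.
Lemma bval_inj : injective bval.
Proof. by move=> a b ab; apply: bop_ext => x; rewrite ab. Qed.

Lemma bscaleAl c a b : c *: (a * b) = (c *: a) * b.
Proof. by apply: bop_ext. Qed.
Lemma bscaleAr c a b : c *: (a * b) = a * (c *: b).
Proof. by apply: bop_ext => x; rewrite bopZ !bopM (linopZ (@bop_lin a)). Qed.

Definition star a : bop := MkBop (bounded_adj (bvalP a)).

Lemma dot_starl a x y : dot (star a x) y = dot x (a y).
Proof. exact: dot_adjl (bvalP a). Qed.
Lemma dot_starr a x y : dot x (star a y) = dot (a x) y.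
Proof. exact: dot_adjr (bvalP a). Qed.
Lemma bop_dot a b : (forall x y, dot (a x) y = dot (b x) y) -> a = b.
Proof. by move=> H; apply: bop_ext => x; apply: dot_eqr. Qed.

Lemma starK : involutive star.
Proof. by move=> a; apply: bop_dot => x y; rewrite dot_starl dot_starr. Qed.
Lemma starD a b : star (a + b) = star a + star b.
Proof. by apply: bop_dot => x y; rewrite bopD dotDl !dot_starl bopD dotDr. Qed.
Lemma starZ c a : star (c *: a) = c^* *: star a.
Proof. by apply: bop_dot => x y; rewrite bopZ dotZl !dot_starl bopZ dotZr. Qed.
Lemma starM a b : star (a * b) = star b * star a.
Proof. by apply: bop_dot => x y; rewrite bopM !dot_starl bopM. Qed.
Lemma star1 : star 1 = 1.
Proof. by apply: bop_dot => x y; rewrite dot_starl. Qed.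
Lemma star0 : star 0 = 0.
Proof. by apply: bop_dot => x y; rewrite dot_starl dot0r dot0l. Qed.
Lemma star_sum (T : Type) (s : seq T) (P : pred T) (F : T -> bop) :
  star (\sum_(t <- s | P t) F t) = \sum_(t <- s | P t) star (F t).
Proof. by elim/big_rec2: _ => [|t u v _ <-]; rewrite ?star0 ?starD. Qed.

Definition scal c : bop := c *: (1 : bop).

Fact scal_additive : additive scal.
Proof. by move=> c d; rewrite /scal scalerBl. Qed.
Fact scal_multiplicative : multiplicative scal.
Proof.
by split=> [c d|]; rewrite /scal ?scale1r// -bscaleAl mul1r scalerA.
Qed.

HB.instance Definition _ := GRing.isAdditive.Build R[i] bop scal scal_additive.
HB.instance Definition _ := GRing.isMultiplicative.Build R[i] bop scal scal_multiplicative.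

Lemma scal_l c a : scal c * a = c *: a.
Proof. by rewrite /scal -bscaleAl mul1r. Qed.
Lemma scal_r c a : a * scal c = c *: a.
Proof. by rewrite /scal -bscaleAr mulr1. Qed.
Lemma star_scal c : star (scal c) = scal c^*.
Proof. by rewrite /scal starZ star1. Qed.

(** ** Matrices of operators *)

Definition mxsc m n (A : 'M[R[i]]_(m, n)) : 'M[bop]_(m, n) := map_mx scal A.
Definition mxstar m n (A : 'M[bop]_(m, n)) : 'M[bop]_(n, m) := \matrix_(i, j) star (A j i).
Definition ctrmx (m n : nat) (A : 'M[R[i]]_(m, n)) : 'M[R[i]]_(n, m) := \matrix_(i, j) (A j i)^*.

Lemma mxscM m n p (A : 'M[R[i]]_(m, n)) (B : 'M[R[i]]_(n, p)) : mxsc (A *m B) = mxsc A *m mxsc B.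
Proof. exact: map_mxM. Qed.
Lemma mxsc1 n : mxsc (1%:M : 'M[R[i]]_n) = 1%:M.
Proof. exact: map_mx1. Qed.
Lemma mxscE m n (A : 'M[R[i]]_(m, n)) i j : mxsc A i j = scal (A i j).
Proof. by rewrite mxE. Qed.
Lemma mxsc_inv n (A : 'M[R[i]]_n) : A \in unitmx -> mxsc A *m mxsc (invmx A) = 1%:M.
Proof. by move=> uA; rewrite -mxscM mulmxV// mxsc1. Qed.
Lemma mxsc_invl n (A : 'M[R[i]]_n) : A \in unitmx -> mxsc (invmx A) *m mxsc A = 1%:M.
Proof. by move=> uA; rewrite -mxscM mulVmx// mxsc1. Qed.

Lemma mxstarE m n (A : 'M[bop]_(m, n)) i j : mxstar A i j = star (A j i).
Proof. by rewrite mxE. Qed.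
Lemma mxstarK m n (A : 'M[bop]_(m, n)) : mxstar (mxstar A) = A.
Proof. by apply/matrixP => i j; rewrite !mxE starK. Qed.
Lemma mxstarM m n p (A : 'M[bop]_(m, n)) (B : 'M[bop]_(n, p)) :
  mxstar (A *m B) = mxstar B *m mxstar A.
Proof.
apply/matrixP => i j; rewrite !mxE star_sum; apply: eq_bigr => k _.
by rewrite starM !mxE.
Qed.
Lemma mxstar_sc m n (A : 'M[R[i]]_(m, n)) : mxstar (mxsc A) = mxsc (ctrmx A).
Proof. by apply/matrixP => i j; rewrite !mxE star_scal. Qed.
Lemma mxstar1 n : mxstar (1%:M : 'M[bop]_n) = 1%:M.
Proof.
apply/matrixP => i j; rewrite !mxE eq_sym; case: (i == j); rewrite ?star1 ?star0//.
Qed.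

End BoundedRing.

(** ** Operators on [l2 (I * 'I_n)] as matrices *)

Section OperatorMatrix.
Variables (R : realType) (I : choiceType).
Notation bopI := (bop R I).

Definition ofmx_fun m n (A : 'M[bopI]_(m, n)) (f : l2 R (I * 'I_n)%type) : l2 R (I * 'I_m)%type :=
  \sum_i \sum_j tens (A i j (colv j f)) (bvec R i).

Lemma colv_ofmx m n (A : 'M[bopI]_(m, n)) f i :
  colv i (ofmx_fun A f) = \sum_j A i j (colv j f).
Proof.
rewrite colv_sum (bigD1 i)//= [X in _ + X]big1 ?addr0.
  by rewrite colv_sum; apply: eq_bigr => j _; rewrite colv_tens bvecE eqxx scale1r.
move=> k ki; rewrite colv_sum big1// => j _.
by rewrite colv_tens bvecE eq_sym (negPf ki) scale0r.
Qed.

Lemma bounded_colv (J : choiceType) (j : J) : bounded_op (colv j : op R (I * J)%type I).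
Proof.
split; first by apply: mk_linear => c f g; rewrite colvD colvZ.
by exists 1 => f; rewrite mul1r l2norm_colv.
Qed.

Lemma bounded_op_sum (J K : choiceType) (T : Type) (s : seq T) (F : T -> op R J K) :
  (forall t, bounded_op (F t)) -> bounded_op (fun x => \sum_(t <- s) F t x).
Proof.
move=> bF; elim: s => [|t s IH].
  split; first by apply: mk_linear => c x y; rewrite !big_nil scaler0 addr0.
  by exists 0 => x; rewrite big_nil mul0r l2norm0.
rewrite (_ : (fun x => _) = (fun x => F t x + \sum_(t <- s) F t x)).
  exact: bounded_opD.
by apply/funext => x; rewrite big_cons.
Qed.

Lemma bounded_tensl (J : choiceType) (y : l2 R J) :
  bounded_op (fun x : l2 R I => tens x y).
Proof.
split; first by apply: mk_linear => c x x'; rewrite tensDl tensZl.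
by exists (l2norm y) => x; rewrite l2norm_tens mulrC.
Qed.

Lemma bounded_ofmx m n (A : 'M[bopI]_(m, n)) : bounded_op (ofmx_fun A).
Proof.
apply: bounded_op_sum => i; apply: bounded_op_sum => j.
apply: (bounded_op_comp (a := fun x => tens x (bvec R i)) (b := fun f => A i j (colv j f))).
  exact: bounded_tensl.
apply: (bounded_op_comp (a := A i j) (b := colv j)); first exact: bvalP.
exact: bounded_colv.
Qed.

Lemma ofmxM m n p (A : 'M[bopI]_(m, n)) (B : 'M[bopI]_(n, p)) :
  ofmx_fun (A *m B) = ofmx_fun A \o ofmx_fun B.
Proof.
apply/funext => f; apply: colv_ext => i /=; rewrite !colv_ofmx.
under eq_bigr => j _.
  rewrite mxE bop_sum; under eq_bigr do rewrite bopM.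
  over.
rewrite exchange_big /=; apply: eq_bigr => k _.
by rewrite colv_ofmx (linop_sum (@bop_lin _ _ _)).
Qed.

Lemma ofmx1 n : ofmx_fun (1%:M : 'M[bopI]_n) = id.
Proof.
apply/funext => f; apply: colv_ext => i; rewrite colv_ofmx (bigD1 i)//= big1 ?addr0.
  by rewrite mxE eqxx.
by move=> j ji; rewrite mxE eq_sym (negPf ji).
Qed.

Lemma sum_colv n (f : l2 R (I * 'I_n)%type) : f = \sum_j tens (colv j f) (bvec R j).
Proof.
apply: colv_ext => i; rewrite colv_sum (bigD1 i)//= big1 ?addr0.
  by rewrite colv_tens bvecE eqxx scale1r.
by move=> j ji; rewrite colv_tens bvecE eq_sym (negPf ji) scale0r.
Qed.

Lemma ofmx_tens m n (A : 'M[bopI]_(m, n)) x j :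
  ofmx_fun A (tens x (bvec R j)) = \sum_i tens (A i j x) (bvec R i).
Proof.
apply: colv_ext => i; rewrite colv_ofmx colv_sum (bigD1 j)//= [X in _ + X = _]big1 ?addr0.
  rewrite (bigD1 i)//= big1 ?addr0.
    by rewrite !colv_tens !bvecE !eqxx !scale1r.
  by move=> k ki; rewrite colv_tens bvecE eq_sym (negPf ki) scale0r.
move=> k ki; rewrite colv_tens bvecE (negPf ki) scale0r.
exact: (linop0 (@bop_lin _ _ _)).
Qed.

Lemma op_ext_tens n (J : choiceType) (u v : op R (I * 'I_n)%type J) : linear u -> linear v ->
  (forall x j, u (tens x (bvec R j)) = v (tens x (bvec R j))) -> u = v.
Proof.
move=> lu lv H; apply/funext => f; rewrite (sum_colv f) !linop_sum//.
by apply: eq_bigr => j _; rewrite H.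
Qed.

Section Entries.
Variables (m n : nat) (u : op R (I * 'I_n)%type (I * 'I_m)%type).

Definition entry_fun i j : op R I I := fun x => colv i (u (tens x (bvec R j))).

Hypothesis bu : bounded_op u.

Lemma bounded_entry i j : bounded_op (entry_fun i j).
Proof.
apply: (bounded_op_comp (a := colv i) (b := fun x => u (tens x (bvec R j)))).
  exact: bounded_colv.
by apply: (bounded_op_comp (a := u)) => //; exact: bounded_tensl.
Qed.

Definition mxof : 'M[bopI]_(m, n) := \matrix_(i, j) MkBop (bounded_entry i j).

Lemma mxofE i j x : mxof i j x = colv i (u (tens x (bvec R j))).
Proof. by rewrite mxE. Qed.

Lemma mxofK : ofmx_fun mxof = u.
Proof.
have [lu _] := bu; have [la _] := bounded_ofmx mxof; apply: op_ext_tens => // x j.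
rewrite ofmx_tens [RHS]sum_colv; apply: eq_bigr => i _; by rewrite mxofE.
Qed.

End Entries.

Lemma ofmx_inj m n (A B : 'M[bopI]_(m, n)) : ofmx_fun A = ofmx_fun B -> A = B.
Proof.
move=> AB; apply/matrixP => i j; apply: bop_ext => x.
have := congr1 (fun u => colv i (u (tens x (bvec R j)))) AB.
rewrite !colv_ofmx !(bigD1 (P := xpredT) j)//= !big1 ?addr0.
- by rewrite !colv_tens bvecE eqxx scale1r.
- by move=> k kj; rewrite colv_tens bvecE (negPf kj) scale0r (linop0 (@bop_lin _ _ _)).
- by move=> k kj; rewrite colv_tens bvecE (negPf kj) scale0r (linop0 (@bop_lin _ _ _)).
Qed.

Lemma dot_colv n (f g : l2 R (I * 'I_n)%type) : dot f g = \sum_j dot (colv j f) (colv j g).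
Proof.
rewrite {1}(sum_colv g) dot_sumr; apply: eq_bigr => j _; by rewrite dot_tens_bvec.
Qed.

Lemma l2norm_colvs n (f : l2 R (I * 'I_n)%type) :
  l2norm f ^+ 2 = \sum_j l2norm (colv j f) ^+ 2.
Proof.
apply: complexI; rewrite -dotxx dot_colv rmorph_sum; by apply: eq_bigr => j _; rewrite dotxx.
Qed.

Lemma adj_ofmx m n (A : 'M[bopI]_(m, n)) : adj (ofmx_fun A) = ofmx_fun (mxstar A).
Proof.
apply: adj_eq; first exact: bounded_ofmx.
move=> f g; rewrite !dot_colv.
under eq_bigr do rewrite colv_ofmx dot_suml.
under [RHS]eq_bigr do rewrite colv_ofmx dot_sumr.
rewrite exchange_big; apply: eq_bigr => i _; apply: eq_bigr => j _.
by rewrite mxE dot_starl.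
Qed.

Lemma unitary_ofmx n (A : 'M[bopI]_n) :
  unitary (ofmx_fun A) <-> mxstar A *m A = 1%:M /\ A *m mxstar A = 1%:M.
Proof.
split=> [[_ H1 H2]|[H1 H2]].
  by split; apply: ofmx_inj; rewrite ofmxM -adj_ofmx ?H1 ?H2 ofmx1.
by split; rewrite ?adj_ofmx -?ofmxM ?H1 ?H2 ?ofmx1//; exact: bounded_ofmx.
Qed.

End OperatorMatrix.

Lemma coef_ofmx (R : realType) (G : cqg R) (n : nat) (A : 'M[bop R (cqg_idx G)]_n) i j :
  coef (ofmx_fun A) i j = A i j.
Proof.
apply: op_of_form_eq; first exact: bvalP.
move=> x y; rewrite ofmx_tens dot_tens_bvec colv_sum (bigD1 i)//= big1 ?addr0.
  by rewrite colv_tens bvecE eqxx scale1r.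
by move=> k ki; rewrite colv_tens bvecE eq_sym (negPf ki) scale0r.
Qed.

(* From here on these operations are used through their lemmas only. *)
Opaque mkl2 op_of_form amp_l amp_r adj tens bvec dot l2norm.

(** * Tensor products of operators, slices and von Neumann algebras *)

Section OpTens.
Variables (R : realType).

Lemma amp_l_tens (I I' J : choiceType) (T : op R I I') (x : l2 R I) (y : l2 R J) :
  bounded_op T -> amp_l T (tens x y) = tens (T x) y.
Proof.
move=> bT; apply: l2_ext => -[i j]; rewrite amp_lE// colv_tens tensE.
by have [lT _] := bT; rewrite (linopZ lT) l2ZE mulrC.
Qed.

Lemma amp_r_tens (I J J' : choiceType) (T : op R J J') (x : l2 R I) (y : l2 R J) :
  bounded_op T -> amp_r T (tens x y) = tens x (T y).
Proof.
move=> bT; apply: l2_ext => -[i j]; rewrite amp_rE// rowv_tens tensE.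
by have [lT _] := bT; rewrite (linopZ lT) l2ZE.
Qed.

Lemma op_tens_tens (I I' J J' : choiceType) (T : op R I I') (U : op R J J') x y :
  bounded_op T -> bounded_op U -> op_tens T U (tens x y) = tens (T x) (U y).
Proof. by move=> bT bU; rewrite /op_tens /= amp_r_tens// amp_l_tens. Qed.

Lemma bounded_op_tens (I I' J J' : choiceType) (T : op R I I') (U : op R J J') :
  bounded_op T -> bounded_op U -> bounded_op (op_tens T U).
Proof.
by move=> bT bU; apply: bounded_op_comp; [exact: bounded_amp_l|exact: bounded_amp_r].
Qed.

Opaque op_tens.

Lemma op_tens_ext (I J K : choiceType) (u v : op R (I * J)%type K) :
  bounded_op u -> bounded_op v -> (forall x y, u (tens x y) = v (tens x y)) -> u = v.
Proof. by move=> bu bv H; apply: bounded_op_ext => // -[i j]; rewrite bvec_tens. Qed.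

Lemma op_tens_comp (I J : choiceType) (T T' : op R I I) (U U' : op R J J) :
  bounded_op T -> bounded_op T' -> bounded_op U -> bounded_op U' ->
  op_tens T U \o op_tens T' U' = op_tens (T \o T') (U \o U').
Proof.
move=> bT bT' bU bU'; apply: op_tens_ext.
- by apply: bounded_op_comp; exact: bounded_op_tens.
- by apply: bounded_op_tens; exact: bounded_op_comp.
move=> x y; rewrite /= !op_tens_tens//; exact: bounded_op_comp.
Qed.

Lemma adj_op_tens (I J : choiceType) (T : op R I I) (U : op R J J) :
  bounded_op T -> bounded_op U -> adj (op_tens T U) = op_tens (adj T) (adj U).
Proof.
move=> bT bU; have bTU := bounded_op_tens bT bU.
have bTU' := bounded_op_tens (bounded_adj bT) (bounded_adj bU).
apply: (op_tens_ext (bounded_adj bTU) bTU') => x y; apply: l2_ext => -[i j].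
rewrite -[LHS]dot_bvecr -[RHS]dot_bvecr (dot_adjl _ _ bTU) bvec_tens (op_tens_tens _ _ bT bU).
rewrite (op_tens_tens _ _ (bounded_adj bT) (bounded_adj bU)).
by rewrite !dot_tens (dot_adjl _ _ bT) (dot_adjl _ _ bU).
Qed.

Lemma dot_amp_l (I J : choiceType) (T : op R I I) (f : l2 R (I * J)%type) b y : bounded_op T ->
  dot (amp_l T f) (tens b y) = dot f (tens (adj T b) y).
Proof.
move=> bT; have bA := bounded_amp_l J bT.
have b1 : bounded_op (id : op R J J) by exact: bounded_op_id.
rewrite -(dot_adjr _ _ bA); congr dot.
have -> : amp_l T = op_tens T id :> op R (I * J)%type (I * J)%type.
  apply: (op_tens_ext bA (bounded_op_tens bT b1)) => x z.
  by rewrite (amp_l_tens _ _ bT) (op_tens_tens _ _ bT b1).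
rewrite (adj_op_tens bT b1) (op_tens_tens _ _ (bounded_adj bT) (bounded_adj b1)).
by congr tens; apply: dot_eqr => z; rewrite (dot_adjl _ _ b1).
Qed.

End OpTens.

(** ** Slices *)

Section Slices.
Variables (R : realType) (I J : choiceType).
Implicit Types (X : op R (I * J)%type (I * J)%type).

Lemma op_of_form_norm (K L : choiceType) (B : l2 R K -> l2 R L -> R[i]) (c : R) : bform B ->
  0 <= c -> (forall x y, normc (B x y) <= c * l2norm x * l2norm y) ->
  forall x, l2norm (op_of_form B x) <= c * l2norm x.
Proof.
move=> bB c0 Hc x; have [_ H] := op_of_formP bB; set y := op_of_form B x.
have [->|n0] := eqVneq (l2norm y) 0; first by rewrite mulr_ge0 ?l2norm_ge0.
have np : 0 < l2norm y by rewrite lt_neqAle eq_sym n0 l2norm_ge0.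
rewrite -(ler_pM2r np) -expr2.
have -> : l2norm y ^+ 2 = normc (B x y).
  by rewrite -H -/y dotxx normc_real// sqr_ge0.
exact: Hc.
Qed.

Lemma slice_r_bound X (c : R) : 0 <= c -> (forall f, l2norm (X f) <= c * l2norm f) ->
  forall x y a b, normc (dot (X (tens a x)) (tens b y)) <=
    c * l2norm x * l2norm y * l2norm a * l2norm b.
Proof.
move=> c0 Hc x y a b; apply: le_trans (cauchy_schwarz _ _) _.
apply: le_trans (ler_wpM2r (l2norm_ge0 _) (Hc _)) _.
rewrite !l2norm_tens le_eqVlt; apply/orP; left; apply/eqP; ring.
Qed.

Lemma slice_r_form X x y : bounded_op X ->
  bform (fun a b => dot (X (tens a x)) (tens b y)).
Proof.
move=> bX; have [lX _] := bX; have [c c0 Hc] := bounded_ge0 bX; split.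
- by move=> *; rewrite tensDl tensZl (linop lX) dotDl dotZl.
- by move=> *; rewrite tensDl tensZl dotDr dotZr.
exists (c * l2norm x * l2norm y); first by rewrite !mulr_ge0 ?l2norm_ge0.
by move=> a b; exact: slice_r_bound.
Qed.

Lemma bounded_slice_r X x y : bounded_op X -> bounded_op (slice_r x y X).
Proof. by move=> bX; have [] := op_of_formP (slice_r_form x y bX). Qed.

Lemma dot_slice_r X x y a b : bounded_op X ->
  dot (slice_r x y X a) b = dot (X (tens a x)) (tens b y).
Proof. by move=> bX; have [_ H] := op_of_formP (slice_r_form x y bX); exact: H. Qed.

Lemma slice_r_norm X (c : R) x y : bounded_op X -> 0 <= c ->
  (forall f, l2norm (X f) <= c * l2norm f) ->
  forall a, l2norm (slice_r x y X a) <= c * l2norm x * l2norm y * l2norm a.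
Proof.
move=> bX c0 Hc; apply: op_of_form_norm; first exact: slice_r_form.
  by rewrite !mulr_ge0 ?l2norm_ge0.
by move=> a b; exact: slice_r_bound.
Qed.

Opaque slice_r.

Lemma slice_r_linl X c x x' y : bounded_op X ->
  slice_r (c *: x + x') y X = c *: slice_r x y X + slice_r x' y X.
Proof.
move=> bX; have [lX _] := bX; apply/funext => a; apply: dot_eqr => b.
rewrite (_ : (_ + _) a = c *: slice_r x y X a + slice_r x' y X a)//.
rewrite (dotDl (c *: slice_r x y X a)) (dotZl c (slice_r x y X a)).
have E z := dot_slice_r z y a b bX.
apply: etrans (E _) _; apply: etrans _ (esym (congr2 +%R (congr1 ( *%R c) (E x)) (E x'))).
by rewrite tensDr tensZr (linop lX) (dotDl (c *: X _)) (dotZl c (X _)).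
Qed.

Lemma slice_r_linr X c x y y' : bounded_op X ->
  slice_r x (c *: y + y') X = c^* *: slice_r x y X + slice_r x y' X.
Proof.
move=> bX; apply/funext => a; apply: dot_eqr => b.
rewrite (_ : (_ + _) a = c^* *: slice_r x y X a + slice_r x y' X a)//.
rewrite (dotDl (c^* *: slice_r x y X a)) (dotZl c^* (slice_r x y X a)).
have E z := dot_slice_r x z a b bX.
apply: etrans (E _) _; apply: etrans _ (esym (congr2 +%R (congr1 ( *%R c^*) (E y)) (E y'))).
by rewrite tensDr tensZr dotDr dotZr.
Qed.

(** The matrix coefficients of [X] with respect to the second leg; unlike [coef],
    for an index set of any cardinality. *)
Definition gcoef X (p q : J) : op R I I := slice_r (bvec R q) (bvec R p) X.

Lemma gcoefE X p q a : bounded_op X -> gcoef X p q a = colv p (X (tens a (bvec R q))).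
Proof.
by move=> bX; apply: dot_eqr => b; rewrite dot_slice_r// dot_tens_bvec.
Qed.

End Slices.

(** ** Commutants *)

Section Commutants.
Variables (R : realType) (I : choiceType).
Implicit Types (N : set (op R I I)) (a b : op R I I).

Section Closure.
Variable N : set (op R I I).
Let M := commutant (commutant N).

Lemma dcomm_bounded a : M a -> bounded_op a. Proof. by case. Qed.

Lemma dcomm_id : M id.
Proof. by split; [exact: bounded_op_id|]. Qed.

Lemma dcommM a b : M a -> M b -> M (a \o b).
Proof.
move=> [ba Ha] [bb Hb]; split; first exact: bounded_op_comp.
by move=> T NT; rewrite -compA Hb// compA Ha.
Qed.

Lemma dcommD a b : M a -> M b -> M (a + b).
Proof.
move=> [ba Ha] [bb Hb]; split; first exact: bounded_opD.
move=> T NT; apply/funext => x /=; have [[lT _] _] := NT.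
rewrite -[LHS]/(a (T x) + b (T x)) -[RHS]/(T (a x + b x)) (linopD lT).
by have := congr1 (fun f => f x) (Ha _ NT); have := congr1 (fun f => f x) (Hb _ NT) => /= -> ->.
Qed.

Lemma dcommZ (c : R[i]) a : M a -> M (c *: a).
Proof.
move=> [ba Ha]; split; first exact: bounded_opZ.
move=> T NT; apply/funext => x /=; have [[lT _] _] := NT.
rewrite -[LHS]/(c *: a (T x)) -[RHS]/(T (c *: a x)) (linopZ lT).
by have := congr1 (fun f => f x) (Ha _ NT) => /= ->.
Qed.

Lemma dcomm0 : M 0.
Proof. by rewrite -(scale0r (id : op R I I)); apply: dcommZ; exact: dcomm_id. Qed.

End Closure.

Variable M : set (op R I I).
Hypothesis HM : vN_algebra M.

Lemma vN_dcomm : commutant (commutant M) = M. Proof. by case: HM. Qed.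
Lemma vN_bounded a : M a -> bounded_op a. Proof. by case: HM => H _ _; exact: H. Qed.
Lemma vN_adj a : M a -> M (adj a). Proof. by case: HM => _ H _; exact: H. Qed.
Lemma vN_id : M id. Proof. by rewrite -vN_dcomm; exact: dcomm_id. Qed.
Lemma vND a b : M a -> M b -> M (a + b).
Proof. rewrite -vN_dcomm; exact: dcommD. Qed.
Lemma vNZ c a : M a -> M (c *: a).
Proof. rewrite -vN_dcomm; exact: dcommZ. Qed.
Lemma vNM a b : M a -> M b -> M (a \o b).
Proof. rewrite -vN_dcomm; exact: dcommM. Qed.
Lemma vN0 : M 0.
Proof. by rewrite -vN_dcomm; exact: dcomm0. Qed.

(** Slicing away the second leg of an element of [M (x) N] lands in [M''], as
    [T (x) 1] commutes with that element for every [T] in [M']. *)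
Lemma slice_r_vN (J : choiceType) (N : set (op R J J)) (X : op R (I * J)%type (I * J)%type) x y :
  (forall b : op R J J, N b -> bounded_op b) -> vN_tens M N X -> M (slice_r x y X).
Proof.
move=> bN HX; have [bX cX] := HX; rewrite -vN_dcomm; split; first exact: bounded_slice_r.
move=> T [bT cT].
have HT : commutant [set op_tens a b | a in M & b in N] (amp_l T).
  split; first exact: bounded_amp_l.
  move=> _ [a Ma [b Nb <-]]; have ba := vN_bounded Ma; have bb := bN _ Nb.
  apply: op_tens_ext.
  - by apply: bounded_op_comp; [exact: bounded_amp_l|exact: bounded_op_tens].
  - by apply: bounded_op_comp; [exact: bounded_op_tens|exact: bounded_amp_l].
  move=> u v /=; rewrite amp_l_tens// !op_tens_tens// amp_l_tens//.
  by have /(congr1 (fun f => f u)) /= -> := cT _ Ma.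
have cXT := cX _ HT.
apply/funext => a /=; apply: dot_eqr => b.
rewrite dot_slice_r// -amp_l_tens//.
have /(congr1 (fun f => f (tens a x))) /= -> := cXT.
by rewrite dot_amp_l// -dot_slice_r// dot_adjr.
Qed.

End Commutants.

(** ** Normal functionals *)

Section Normal.
Variables (R : realType) (I : choiceType) (M : set (op R I I)).
Hypothesis HM : vN_algebra M.
Variable w : op R I I -> R[i].
Hypothesis Hw : normal_functional M w.

Let amgm (s t : R) : 0 <= s -> 0 <= t -> s * t <= s ^+ 2 + t ^+ 2.
Proof. by move=> s0 t0; nra. Qed.

(** By Cauchy-Schwarz, as [w] is a sum of vector functionals [(a x_n, y_n)] with
    square-summable [x_n] and [y_n]. *)
Lemma normal_bound : exists2 K : R, 0 <= K & forall a c, M a -> 0 <= c ->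
  (forall x, l2norm (a x) <= c * l2norm x) -> normc (w a) <= K * c.
Proof.
have [x [y [sx sy Hxy]]] := Hw.
pose g n := l2norm (x n) ^+ 2 + l2norm (y n) ^+ 2.
have g0 n : 0 <= g n by rewrite addr_ge0 ?sqr_ge0.
have gs : (\esum_(n in [set: nat]) (g n)%:E < +oo)%E.
  rewrite esumTD; [|by move=> n; exact: sqr_ge0..].
  under eq_esum do rewrite l2norm_sqr; under [X in (_ + X)%E]eq_esum do rewrite l2norm_sqr.
  exact: lte_add_pinfty.
exists (2 * fine (\esum_(n in [set: nat]) (g n)%:E)).
  by rewrite mulr_ge0// fine_ge0// esumT_ge0.
move=> a c Ma c0 Hc; rewrite Hxy//.
have := @csum_le _ _ (fun n => dot (a (x n)) (y n)) (fun n => c * g n).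
rewrite esumTZ// fineM// ?esumT_finite// mulrCA mulrC; apply.
  move=> n; apply: le_trans (cauchy_schwarz _ _) _.
  apply: le_trans (ler_wpM2r (l2norm_ge0 _) (Hc _)) _.
  by rewrite -mulrA ler_wpM2l// amgm// l2norm_ge0.
by rewrite lte_mul_pinfty// lee_fin.
Qed.

Lemma normal_lin c a b : M a -> M b -> w (c *: a + b) = c * w a + w b.
Proof.
have [x [y [sx sy Hxy]]] := Hw.
have S d : M d -> csummable (fun n => dot (d (x n)) (y n)).
  move=> Md; have [e e0 He] := bounded_ge0 (vN_bounded HM Md).
  apply: (@le_csummable _ _ _ (fun n => e * (l2norm (x n) ^+ 2 + l2norm (y n) ^+ 2))).
    move=> n; apply: le_trans (cauchy_schwarz _ _) _.
    apply: le_trans (ler_wpM2r (l2norm_ge0 _) (He _)) _.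
    by rewrite -mulrA ler_wpM2l// amgm// l2norm_ge0.
  rewrite esumTZ//; last by move=> n; rewrite addr_ge0 ?sqr_ge0.
  rewrite lte_mul_pinfty// ?lee_fin// esumTD; [|by move=> n; exact: sqr_ge0..].
  under eq_esum do rewrite l2norm_sqr; under [X in (_ + X)%E]eq_esum do rewrite l2norm_sqr.
  exact: lte_add_pinfty.
move=> Ma Mb; rewrite !Hxy//; last by apply: (vND HM) => //; exact: (vNZ HM).
rewrite -csumZ ?S// -csumD ?S//; last by apply: csummableZ; exact: S.
by congr csum; apply/funext => n; rewrite -[(_ + _) _]/(c *: a (x n) + b (x n)) dotDl dotZl.
Qed.

Lemma normal0 : w 0 = 0.
Proof.
have := normal_lin 1 (vN0 HM) (vN0 HM).
by rewrite scale1r addr0 mul1r => /eq_addr_eq0.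
Qed.

End Normal.

Lemma vector_functional (R : realType) (I : choiceType) (M : set (op R I I)) (x y : l2 R I) :
  (forall a, M a -> bounded_op a) -> normal_functional M (fun a => dot (a x) y).
Proof.
move=> bM; exists (fun n => if n == 0%N then x else 0), (fun n => if n == 0%N then y else 0).
have S (z : l2 R I) : (\esum_(n in [set: nat]) sqsum (if n == 0%N then z else (0 : l2 R I)%R) < +oo)%E.
  rewrite (_ : (\esum_(_ in _) _)%E = (l2norm z ^+ 2)%:E) ?ltry//.
  under eq_esum do rewrite -l2norm_sqr.
  rewrite (@esum_single _ _ _ 0%N)//= ?sqr_ge0// => n n0.
  by rewrite (negPf n0) l2norm0 expr0n.
split=> // a Ma; have [la _] := bM _ Ma.
by rewrite (@csum_single _ _ _ 0%N)// => n n0; rewrite (negPf n0) dot0r.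
Qed.

(** ** Leg numbering *)

Section Legs.
Variables (R : realType).

Lemma reindex_summable (I J : choiceType) (s : I -> J) (f : l2 R J) : injective s ->
  (sqsum (f \o s) <= (l2norm f ^+ 2)%:E)%E.
Proof.
move=> si; apply: sqsum_le => t ut.
have := sum_abs2_le f (s := [seq s i | i <- t]).
by rewrite big_map; apply; rewrite map_inj_uniq.
Qed.

Lemma reindexE (I J : choiceType) (s : J -> I) (f : l2 R I) j : injective s ->
  Defs.reindex s f j = f (s j).
Proof. by move=> si; rewrite /Defs.reindex mkl2E//; exact: sqsummable_le (reindex_summable f si). Qed.

Lemma bounded_reindex (I J : choiceType) (s : J -> I) : injective s ->
  bounded_op (Defs.reindex s : op R I J).
Proof.
move=> si; split.
  by apply: mk_linear => c f g; apply: l2_ext => j; rewrite l2DE l2ZE !reindexE.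
exists 1 => f; rewrite mul1r -(ler_pXn2r (n := 2)) ?nnegrE ?l2norm_ge0//.
rewrite -lee_fin l2norm_sqr (_ : l2val (Defs.reindex s f) = f \o s) ?reindex_summable//.
by apply/funext => j; rewrite reindexE.
Qed.

Lemma assocE (I J K : choiceType) (f : l2 R (I * J * K)%type) i j k :
  assoc f (i, (j, k)) = f (i, j, k).
Proof. by rewrite /assoc reindexE// => -[? [? ?]] [? [? ?]] /= [-> -> ->]. Qed.

Lemma assoc_invE (I J K : choiceType) (f : l2 R (I * (J * K))%type) i j k :
  assoc_inv f (i, j, k) = f (i, (j, k)).
Proof. by rewrite /assoc_inv reindexE// => -[[? ?] ?] [[? ?] ?] /= [-> -> ->]. Qed.

Lemma flip12E (I J K : choiceType) (f : l2 R (I * J * K)%type) i j k :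
  flip12 f (j, i, k) = f (i, j, k).
Proof. by rewrite /flip12 reindexE// => -[[? ?] ?] [[? ?] ?] /= [-> -> ->]. Qed.

Variables (I J : choiceType) (V : op R (I * J)%type (I * J)%type).
Hypothesis bV : bounded_op V.

Lemma bounded_leg23 : bounded_op (leg23 V).
Proof.
apply: bounded_op_comp; first apply: bounded_op_comp.
- by apply: bounded_reindex => -[[? ?] ?] [[? ?] ?] /= [-> -> ->].
- exact: bounded_amp_r.
- by apply: bounded_reindex => -[? [? ?]] [? [? ?]] /= [-> -> ->].
Qed.

Lemma bounded_leg13 : bounded_op (leg13 V).
Proof.
apply: bounded_op_comp; first apply: bounded_op_comp.
- by apply: bounded_reindex => -[[? ?] ?] [[? ?] ?] /= [-> -> ->].
- exact: bounded_leg23.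
- by apply: bounded_reindex => -[[? ?] ?] [[? ?] ?] /= [-> -> ->].
Qed.

Lemma bounded_gcoef p q : bounded_op (gcoef V p q).
Proof. exact: bounded_slice_r. Qed.

Lemma colv_leg23 (z : l2 R (I * I)%type) p q :
  colv p (leg23 V (tens z (bvec R q))) = amp_r (gcoef V p q) z.
Proof.
apply: l2_ext => -[i i']; rewrite colvE /leg23 /= assoc_invE amp_rE//.
rewrite [RHS]amp_rE; last exact: bounded_gcoef.
rewrite gcoefE// colvE; congr (V _ _); apply: l2_ext => -[j k].
by rewrite rowvE assocE !tensE rowvE.
Qed.

Lemma colv_leg13 (z : l2 R (I * I)%type) p q :
  colv p (leg13 V (tens z (bvec R q))) = amp_l (gcoef V p q) z.
Proof.
apply: l2_ext => -[i i']; rewrite colvE /leg13 /= flip12E.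
rewrite [RHS]amp_lE; last exact: bounded_gcoef.
rewrite /leg23 /= assoc_invE amp_rE// gcoefE// colvE; congr (V _ _); apply: l2_ext => -[j k].
by rewrite rowvE assocE flip12E !tensE colvE.
Qed.

(** Matrix multiplication of the coefficients.  For a column with finitely many
    nonzero entries the sum over the middle index is finite, which is the case
    for direct sums of finite-dimensional representations. *)
Lemma gcoef_legs (s : seq J) p q : uniq s -> (forall r, r \notin s -> gcoef V r q = 0) ->
  gcoef (leg13 V \o leg23 V) p q = \sum_(r <- s) op_tens (gcoef V p r) (gcoef V r q).
Proof.
move=> us Hs; have bl := bounded_op_comp bounded_leg13 bounded_leg23.
apply/funext => z; rewrite gcoefE//= fct_sumE.
have -> : leg23 V (tens z (bvec R q)) =
    \sum_(r <- s) tens (amp_r (gcoef V r q) z) (bvec R r).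
  apply: colv_ext => r; rewrite colv_leg23 colv_sum.
  have [rs|rs] := boolP (r \in s).
    rewrite (bigD1_seq r)//= big1 ?addr0; first by rewrite colv_tens bvecE eqxx scale1r.
    by move=> t tr; rewrite colv_tens bvecE eq_sym (negPf tr) scale0r.
  rewrite big_seq big1 ?Hs//.
    apply: l2_ext => -[i j]; rewrite amp_rE//; exact: bounded_op0.
  move=> t ts; rewrite colv_tens bvecE; case: eqP => [e|_]; last by rewrite scale0r.
  by move: rs; rewrite e ts.
have [l13 _] := bounded_leg13; rewrite (linop_sum l13) colv_sum.
by apply: eq_bigr => r _; rewrite colv_leg13.
Qed.

End Legs.

(** An operator belongs to [M (x) B(H)] as soon as its matrix coefficients are
    in [M]: what commutes with all elementary tensors has the form [T' (x) 1]
    with [T'] in [M']. *)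
Lemma vN_tens_gcoef (R : realType) (I J : choiceType) (M : set (op R I I))
    (X : op R (I * J)%type (I * J)%type) : vN_algebra M -> bounded_op X ->
  (forall p q, M (gcoef X p q)) -> vN_tens M (Bop J) X.
Proof.
move=> HM bX MX; split=> // T [bT cT]; have [lT _] := bT.
pose E (p q : J) : op R J J := fun x => x q *: bvec R p.
have bE p q : bounded_op (E p q).
  split; first by apply: mk_linear => c x y; rewrite /E l2DE l2ZE scalerDl scalerA.
  exists 1 => x; rewrite /E l2normZ l2norm_bvec mulr1 mul1r -dot_bvecr.
  by apply: le_trans (cauchy_schwarz _ _) _; rewrite l2norm_bvec mulr1.
pose i1 : op R I I := id; pose iJ : op R J J := id.
have b1 : bounded_op i1 by exact: bounded_op_id.
have bJ : bounded_op iJ by exact: bounded_op_id.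
have Epq p q f : T (tens (colv q f) (bvec R p)) = tens (colv q (T f)) (bvec R p).
  have H g : op_tens i1 (E p q) g = tens (colv q g) (bvec R p).
    have bL : bounded_op (fun g : l2 R (I * J)%type => tens (colv q g) (bvec R p)).
      by apply: (bounded_op_comp (a := fun x => tens x (bvec R p))); [exact: bounded_tensl|exact: bounded_colv].
    suff He : op_tens i1 (E p q) = (fun g : l2 R (I * J)%type => tens (colv q g) (bvec R p)).
      by rewrite He.
    apply: (op_tens_ext (bounded_op_tens b1 (bE p q)) bL) => x y.
    by rewrite (op_tens_tens _ _ b1 (bE p q)) /E tensZr colv_tens tensZl.
  rewrite -!H; have HE : [set op_tens a b | a in M & b in Bop J] (op_tens i1 (E p q)).
    by exists i1; [exact: (vN_id HM)|exists (E p q) => //; exact: bE].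
  by have := congr1 (fun F => F f) (cT _ HE).
have bg p q : bounded_op (gcoef X p q) by exact: bounded_gcoef.
apply: bounded_op_ext; [exact: bounded_op_comp bX bT|exact: bounded_op_comp bT bX|].
move=> [i q] /=; rewrite bvec_tens.
have e0 : colv q (tens (bvec R i) (bvec R q)) = bvec R i by rewrite colv_tens bvecE eqxx scale1r.
set x := bvec R i in e0 *; apply: colv_ext => p.
pose T' q y := colv q (T (tens y (bvec R q))).
have TE f r : colv r (T f) = T' r (colv r f).
  by rewrite /T' Epq colv_tens bvecE eqxx scale1r.
have T'E r s y : T' r y = T' s y.
  rewrite {1}/T'.
  have -> : T (tens y (bvec R r)) = T (tens (colv s (tens y (bvec R s))) (bvec R r)) :> l2 R (I * J)%type.
    by rewrite colv_tens bvecE eqxx scale1r.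
  by rewrite Epq colv_tens bvecE eqxx scale1r.
have Tq : T (tens x (bvec R q)) = tens (T' q x) (bvec R q).
  by rewrite -{1}e0 Epq.
rewrite Tq -(gcoefE _ _ _ bX) TE -(gcoefE _ _ _ bX) (T'E p q).
have Ha : [set op_tens a b | a in M & b in Bop J] (op_tens (gcoef X p q) iJ).
  by exists (gcoef X p q); [exact: MX|exists iJ].
have := congr1 (fun F => colv q (F (tens x (bvec R q)))) (cT _ Ha).
rewrite /= Tq !(op_tens_tens _ _ (bg p q) bJ) -?/(T' q _).
by rewrite !colv_tens bvecE eqxx !scale1r => <-.
Qed.

(** * Matrices of coefficients of a representation *)

Section FiniteDimensional.
Variable R : realType.

Lemma l2_expand n (x : l2 R 'I_n) : x = \sum_i x i *: bvec R i.
Proof.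
apply: l2_ext => i; rewrite l2sumE (bigD1 i)// l2ZE bvecE eqxx mulr1 big1.
  by symmetry; exact: addr0.
by move=> j ji; rewrite l2ZE bvecE eq_sym (negPf ji) mulr0.
Qed.

Definition opmat m n (T : op R 'I_n 'I_m) : 'M[R[i]]_(m, n) := \matrix_(i, j) T (bvec R j) i.

Lemma amp_r_mx (I : choiceType) m n (T : op R 'I_n 'I_m) : bounded_op T ->
  amp_r T = ofmx_fun (mxsc I (opmat T)) :> op R (I * 'I_n)%type (I * 'I_m)%type.
Proof.
move=> bT; have [lA _] := bounded_amp_r I bT.
have [lO _] := bounded_ofmx (mxsc I (opmat T)).
apply: (op_ext_tens lA lO) => x j; rewrite (amp_r_tens _ _ bT) ofmx_tens.
rewrite {1}[T _]l2_expand; apply: colv_ext => k; rewrite colv_sum colv_tens l2sumE scaler_suml.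
apply: eq_bigr => i _; rewrite colv_tens mxscE mxE l2ZE bopZ bop1 scalerA.
by rewrite mulrC.
Qed.

Lemma mxopE n (A : 'M[R[i]]_n) x i : mxop A x i = \sum_j A i j * x j.
Proof.
apply: mkl2E; apply: (@sqsummable_le _ _ _ (\sum_k abs2 (\sum_j A k j * x j))).
apply: sqsum_le => s us; rewrite big_uniq//= [leRHS](bigID (mem s))/= lerDl.
by apply: sumr_ge0 => k _; exact: abs2_ge0.
Qed.

Lemma bounded_finite n (J : choiceType) (T : op R 'I_n J) : linear T -> bounded_op T.
Proof.
move=> lT; split => //; exists (\sum_i l2norm (T (bvec R i))) => x.
rewrite {1}(l2_expand x) (linop_sum lT); apply: le_trans (l2norm_sum _ _ _) _.
rewrite mulr_suml; apply: ler_sum => i _; rewrite (linopZ lT) l2normZ mulrC.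
rewrite ler_wpM2l ?l2norm_ge0// -dot_bvecr.
by apply: le_trans (cauchy_schwarz _ _) _; rewrite l2norm_bvec mulr1.
Qed.

Lemma bounded_mxop n (A : 'M[R[i]]_n) : bounded_op (mxop A).
Proof.
apply: bounded_finite; apply: mk_linear => c x y; apply: l2_ext => i.
rewrite l2DE l2ZE !mxopE mulr_sumr -big_split; apply: eq_bigr => j _.
by rewrite l2DE l2ZE mulrDr mulrCA.
Qed.

Lemma mxop_bvec n (A : 'M[R[i]]_n) j i : mxop A (bvec R j) i = A i j.
Proof.
rewrite mxopE (bigD1 j)//= bvecE eqxx mulr1 big1 ?addr0// => k kj.
by rewrite bvecE (negPf kj) mulr0.
Qed.

Lemma opmat_mxop n (A : 'M[R[i]]_n) : opmat (mxop A) = A.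
Proof. by apply/matrixP => i j; rewrite mxE mxop_bvec. Qed.

Lemma mxop_opmat n (T : op R 'I_n 'I_n) : bounded_op T -> mxop (opmat T) = T.
Proof.
move=> bT; apply: (bounded_op_ext (bounded_mxop _) bT) => j; apply: l2_ext => i.
by rewrite mxop_bvec mxE.
Qed.

Lemma amp_r_mxop (I : choiceType) n (A : 'M[R[i]]_n) :
  amp_r (mxop A) = ofmx_fun (mxsc I A) :> op R (I * 'I_n)%type (I * 'I_n)%type.
Proof. by rewrite (amp_r_mx I (bounded_mxop A)) opmat_mxop. Qed.

Lemma of_coefE (G : cqg R) n (A : 'M[bop R (cqg_idx G)]_n) :
  of_coef (fun i j => bval (A i j)) = ofmx_fun A.
Proof.
pose F i j := op_tens (A i j) (mxop (delta_mx i j)) :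
  op R (cqg_idx G * 'I_n)%type (cqg_idx G * 'I_n)%type.
have bF i j : bounded_op (F i j).
  by apply: bounded_op_tens; [exact: bvalP|exact: bounded_mxop].
have E : of_coef (fun i j => bval (A i j)) = fun f => \sum_i \sum_j F i j f.
  apply/funext => f; rewrite /of_coef fct_sumE; apply: eq_bigr => i _.
  by rewrite fct_sumE.
have [lE _] : bounded_op (of_coef (fun i j => bval (A i j))).
  rewrite E; apply: bounded_op_sum => i; apply: bounded_op_sum => j; exact: bF.
have [lO _] := bounded_ofmx A.
apply: (op_ext_tens lE lO) => x k; rewrite E ofmx_tens; apply: eq_bigr => i _.
have T j : F i j (tens x (bvec R k)) = (j == k)%:R *: tens (A i j x) (bvec R i).
  rewrite /F (op_tens_tens _ _ (bvalP _) (bounded_mxop _)) -tensZr; congr tens.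
  apply: l2_ext => l; rewrite mxop_bvec mxE l2ZE bvecE.
  by rewrite (eq_sym k j); case: (l == i); case: (j == k); rewrite /= ?mulr0 ?mulr1.
rewrite (bigD1 k)//= big1 ?addr0; first by rewrite T eqxx scale1r.
by move=> j jk; rewrite T (negPf jk) scale0r.
Qed.

End FiniteDimensional.

Section Comultiplication.
Variables (R : realType) (G : cqg R).
Notation B := (bop R (cqg_idx G)).
Notation M := (Linf G).

Let HM : vN_algebra M := Linf_vN G.

Definition inM (a : B) : Prop := M (bval a).

Lemma inM1 : inM 1. Proof. exact: vN_id HM. Qed.
Lemma inM0 : inM 0. Proof. exact: vN0 HM. Qed.
Lemma inMD a b : inM a -> inM b -> inM (a + b). Proof. exact: (vND HM). Qed.
Lemma inMZ c a : inM a -> inM (c *: a). Proof. exact: (vNZ HM). Qed.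
Lemma inMM a b : inM a -> inM b -> inM (a * b). Proof. exact: (vNM HM). Qed.
Lemma inM_star a : inM a -> inM (star a). Proof. exact: (vN_adj HM). Qed.
Lemma inM_sum (T : Type) (s : seq T) (F : T -> B) : (forall t, inM (F t)) ->
  inM (\sum_(t <- s) F t).
Proof.
move=> H; elim: s => [|t s IH]; first by rewrite big_nil; exact: inM0.
by rewrite big_cons; exact: inMD.
Qed.

Notation D := (comul G).
Notation N := (vN_tens M M).

Lemma comul_lin (c : R[i]) a b : M a -> M b -> D (c *: a + b) = c *: D a + D b.
Proof. by case: (comul_hom G) => _ H _ _ _; exact: H. Qed.
Lemma comulM a b : M a -> M b -> D (a \o b) = D a \o D b.
Proof. by case: (comul_hom G) => _ _ H _ _; exact: H. Qed.
Lemma comul_adj a : M a -> D (adj a) = adj (D a).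
Proof. by case: (comul_hom G) => _ _ _ H _; exact: H. Qed.
Lemma comul_normal w : normal_functional N w -> normal_functional M (w \o D).
Proof. by case: (comul_hom G) => _ _ _ _ [_ H]; exact: H. Qed.

Lemma comul0 : D 0 = 0.
Proof.
have := comul_lin 1 (vN0 HM) (vN0 HM).
by rewrite !scale1r addr0 => /eq_addr_eq0.
Qed.

Lemma comul_sumZ (T : Type) (s : seq T) (c : T -> R[i]) (F : T -> B) :
  (forall t, inM (F t)) ->
  D (bval (\sum_(t <- s) c t *: F t)) = \sum_(t <- s) c t *: D (bval (F t)).
Proof.
move=> HF; elim: s => [|t s IH]; first by rewrite !big_nil; exact: comul0.
rewrite !big_cons bvalD bvalZ comul_lin ?IH//; first exact: HF.
by apply: inM_sum => u; exact: inMZ.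
Qed.

Lemma comul_sum (T : Type) (s : seq T) (F : T -> B) : (forall t, inM (F t)) ->
  D (bval (\sum_(t <- s) F t)) = \sum_(t <- s) D (bval (F t)).
Proof.
move=> HF; transitivity (D (bval (\sum_(t <- s) 1 *: F t))).
  by congr (D (bval _)); apply: eq_bigr => t _; rewrite scale1r.
by rewrite comul_sumZ//; apply: eq_bigr => t _; rewrite scale1r.
Qed.

(** It is enough to test [(Delta (x) id)(V) = V_13 V_23] on matrix coefficients:
    both sides are bounded forms in the vectors that define the slices, the
    left one because [Delta] is normal. *)
Lemma hom_tens_gcoef (J : choiceType) (V : op R (cqg_idx G * J)%type (cqg_idx G * J)%type) :
  vN_tens M (Bop J) V ->
  (forall p q, gcoef (leg13 V \o leg23 V) p q = D (gcoef V p q)) ->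
  hom_tens_id D V (leg13 V \o leg23 V).
Proof.
move=> HV HD; have bV : bounded_op V by exact: dcomm_bounded HV.
set Y := leg13 V \o leg23 V.
have bY : bounded_op Y by exact: bounded_op_comp (bounded_leg13 bV) (bounded_leg23 bV).
split=> // x y; apply/funext => xi; apply: dot_eqr => eta.
have MV u v : M (slice_r u v V) by apply: (slice_r_vN HM _ _ _ HV) => b.
pose B1 x y := dot (slice_r x y Y xi) eta.
pose B2 x y := dot (D (slice_r x y V) xi) eta.
have w_normal : normal_functional M ((fun b => dot (b xi) eta) \o D).
  by apply: comul_normal; apply: vector_functional => b; exact: dcomm_bounded.
apply: (@bform_ext _ _ _ B1 B2) => [||q p].
- have [d d0 Hd] := bounded_ge0 bY; split=> [c u v z|c u v z|].
  + rewrite /B1 (slice_r_linl _ _ _ _ bY).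
    rewrite (_ : (_ + _) xi = c *: slice_r u z Y xi + slice_r v z Y xi)//.
    by rewrite (dotDl (c *: slice_r u z Y xi)) (dotZl c).
  + rewrite /B1 (slice_r_linr _ _ _ _ bY).
    rewrite (_ : (_ + _) xi = c^* *: slice_r u v Y xi + slice_r u z Y xi)//.
    by rewrite (dotDl (c^* *: slice_r u v Y xi)) (dotZl c^*).
  exists (d * l2norm xi * l2norm eta); first by rewrite !mulr_ge0 ?l2norm_ge0.
  move=> u v; rewrite /B1 (dot_slice_r _ _ _ _ bY).
  apply: le_trans (slice_r_bound d0 Hd _ _ _ _) _.
  by rewrite le_eqVlt; apply/orP; left; apply/eqP; ring.
- have [K K0 HK] := normal_bound w_normal.
  have [d d0 Hd] := bounded_ge0 bV; split=> [c u v z|c u v z|].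
  + by rewrite /B2 (slice_r_linl _ _ _ _ bV); exact: (normal_lin HM w_normal).
  + by rewrite /B2 (slice_r_linr _ _ _ _ bV); exact: (normal_lin HM w_normal).
  exists (K * d); first exact: mulr_ge0.
  move=> u v; apply: le_trans (HK _ (d * l2norm u * l2norm v) (MV u v) _ _) _.
  + by rewrite !mulr_ge0 ?l2norm_ge0.
  + exact: slice_r_norm bV d0 Hd.
  + by rewrite !mulrA.
- have := congr1 (fun f => dot (f xi) eta) (HD p q).
  by [].
Qed.

(** ** Finite-dimensional corepresentations as matrices over [Linf G] *)

Definition corep n (A : 'M[B]_n) : Prop :=
  (forall i j, inM (A i j)) /\
  (forall i j, D (bval (A i j)) = \sum_k op_tens (bval (A i k)) (bval (A k j))).

Lemma gcoef_ofmx n (A : 'M[B]_n) i j : gcoef (ofmx_fun A) i j = bval (A i j).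
Proof. exact: coef_ofmx. Qed.

Lemma gcoef_legs_ofmx n (A : 'M[B]_n) i j :
  gcoef (leg13 (ofmx_fun A) \o leg23 (ofmx_fun A)) i j =
  \sum_k op_tens (bval (A i k)) (bval (A k j)).
Proof.
rewrite (gcoef_legs (bounded_ofmx A) (s := index_enum 'I_n)).
- by apply: eq_bigr => k _; rewrite !gcoef_ofmx.
- exact: index_enum_uniq.
- by move=> r; rewrite mem_index_enum.
Qed.

Lemma corep_representation n (A : 'M[B]_n) : corep A -> representation (ofmx_fun A).
Proof.
move=> [MA DA]; have HV : vN_tens M (Bop 'I_n) (ofmx_fun A).
  by apply: (vN_tens_gcoef HM (bounded_ofmx A)) => i j; rewrite gcoef_ofmx; exact: MA.
split=> //.
apply: (hom_tens_gcoef HV) => i j.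
by rewrite gcoef_legs_ofmx gcoef_ofmx DA.
Qed.

Lemma representation_corep n (A : 'M[B]_n) : representation (ofmx_fun A) -> corep A.
Proof.
move=> [HV [_ HD]]; split=> i j.
  rewrite /inM -gcoef_ofmx; by apply: (slice_r_vN HM _ _ _ HV) => b.
rewrite -gcoef_legs_ofmx -gcoef_ofmx; symmetry; exact: HD.
Qed.

Lemma corep_inM n (A : 'M[B]_n) i j : corep A -> inM (A i j).
Proof. by case. Qed.

Lemma op_tensDZ (a1 a2 b : B) (c : R[i]) :
  op_tens (bval (c *: a1 + a2)) (bval b) = c *: op_tens (bval a1) (bval b) + op_tens (bval a2) (bval b).
Proof.
have bT a : bounded_op (op_tens (bval a) (bval b)) by apply: bounded_op_tens; exact: bvalP.
apply: op_tens_ext; [exact: bT| |].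
  by apply: bounded_opD; [apply: bounded_opZ|]; exact: bT.
move=> x y; have E a : op_tens (bval a) (bval b) (tens x y) = tens (a x) (b y).
  by apply: op_tens_tens; exact: bvalP.
rewrite E (_ : (_ + _) (tens x y) = c *: op_tens (bval a1) (bval b) (tens x y)
  + op_tens (bval a2) (bval b) (tens x y))// !E.
by rewrite bopD bopZ tensDl tensZl.
Qed.

Lemma op_tensDZr (a1 a2 b : B) (c : R[i]) :
  op_tens (bval b) (bval (c *: a1 + a2)) = c *: op_tens (bval b) (bval a1) + op_tens (bval b) (bval a2).
Proof.
have bT a : bounded_op (op_tens (bval b) (bval a)) by apply: bounded_op_tens; exact: bvalP.
apply: op_tens_ext; [exact: bT| |].
  by apply: bounded_opD; [apply: bounded_opZ|]; exact: bT.
move=> x y; have E a : op_tens (bval b) (bval a) (tens x y) = tens (b x) (a y).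
  by apply: op_tens_tens; exact: bvalP.
rewrite E (_ : (_ + _) (tens x y) = c *: op_tens (bval b) (bval a1) (tens x y)
  + op_tens (bval b) (bval a2) (tens x y))// !E.
by rewrite bopD bopZ tensDr tensZr.
Qed.

Lemma op_tens0l (b : B) : op_tens (bval (0 : B)) (bval b) = 0.
Proof.
have := op_tensDZ 0 0 b 1.
by rewrite !scale1r addr0 => /eq_addr_eq0.
Qed.

Lemma op_tens0r (b : B) : op_tens (bval b) (bval (0 : B)) = 0.
Proof.
have := op_tensDZr 0 0 b 1.
by rewrite !scale1r addr0 => /eq_addr_eq0.
Qed.

Lemma op_tens_suml (T : Type) (s : seq T) (c : T -> R[i]) (F : T -> B) (b : B) :
  op_tens (bval (\sum_(t <- s) c t *: F t)) (bval b) =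
  \sum_(t <- s) c t *: op_tens (bval (F t)) (bval b).
Proof.
elim: s => [|t s IH]; first by rewrite !big_nil op_tens0l.
by rewrite !big_cons op_tensDZ IH.
Qed.

Lemma op_tens_sumr (T : Type) (s : seq T) (c : T -> R[i]) (F : T -> B) (b : B) :
  op_tens (bval b) (bval (\sum_(t <- s) c t *: F t)) =
  \sum_(t <- s) c t *: op_tens (bval b) (bval (F t)).
Proof.
elim: s => [|t s IH]; first by rewrite !big_nil op_tens0r.
by rewrite !big_cons op_tensDZr IH.
Qed.

(** The contragredient: the adjoint is taken entrywise, without transposition. *)
Definition mxbar n (A : 'M[B]_n) : 'M[B]_n := \matrix_(i, j) star (A i j).

Lemma adj_sum (I J : choiceType) (T : Type) (s : seq T) (F : T -> op R I J) :
  (forall t, bounded_op (F t)) -> adj (\sum_(t <- s) F t) = \sum_(t <- s) adj (F t).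
Proof.
move=> bF.
have bS (U : choiceType) (V : choiceType) (H : T -> op R U V) : (forall t, bounded_op (H t)) ->
    bounded_op (\sum_(t <- s) H t).
  move=> bH; rewrite (_ : \sum_(t <- s) H t = fun x => \sum_(t <- s) H t x).
    exact: bounded_op_sum.
  by apply/funext => x; rewrite fct_sumE.
apply: adj_eq; first by apply: bS => t; exact: bounded_adj.
move=> x y; rewrite !fct_sumE dot_suml dot_sumr; apply: eq_bigr => t _.
exact: dot_adjl.
Qed.

Lemma corep_bar n (A : 'M[B]_n) : corep A -> corep (mxbar A).
Proof.
move=> [MA DA]; split=> i j; rewrite mxE; first exact: inM_star.
rewrite (comul_adj (MA i j)) DA adj_sum; last first.
  by move=> k; apply: bounded_op_tens; exact: bvalP.
by apply: eq_bigr => k _; rewrite !mxE adj_op_tens//; exact: bvalP.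
Qed.

Lemma mulmx_scE m n p q (P : 'M[R[i]]_(m, n)) (A : 'M[B]_(n, p)) (Q : 'M[R[i]]_(p, q)) i j :
  (mxsc _ P *m A *m mxsc _ Q) i j = \sum_(t : 'I_n * 'I_p) (P i t.1 * Q t.2 j) *: A t.1 t.2.
Proof.
rewrite mxE; under eq_bigr do rewrite mxE mulr_suml.
rewrite exchange_big pair_big /=; apply: eq_bigr => -[k l] _ /=.
by rewrite !mxscE scal_l scal_r scalerA mulrC.
Qed.

Lemma corep_conj n (A : 'M[B]_n) (P Q : 'M[R[i]]_n) : Q *m P = 1%:M ->
  corep A -> corep (mxsc _ P *m A *m mxsc _ Q).
Proof.
move=> QP [MA DA]; split=> i j.
  by rewrite mulmx_scE; apply: inM_sum => t; exact: inMZ.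
rewrite mulmx_scE comul_sumZ; last by move=> t; exact: MA.
transitivity (\sum_k \sum_(t : 'I_n * 'I_n) (P i t.1 * Q t.2 j) *:
    op_tens (bval (A t.1 k)) (bval (A k t.2))).
  rewrite exchange_big; apply: eq_bigr => t _; rewrite DA scaler_sumr //.
symmetry.
transitivity (\sum_k \sum_(t : 'I_n * 'I_n) \sum_(r : 'I_n * 'I_n)
   ((P i t.1 * Q t.2 k) * (P k r.1 * Q r.2 j)) *: op_tens (bval (A t.1 t.2)) (bval (A r.1 r.2))).
  apply: eq_bigr => k _; rewrite !mulmx_scE op_tens_suml; apply: eq_bigr => t _.
  by rewrite op_tens_sumr scaler_sumr; apply: eq_bigr => r _; rewrite scalerA.
rewrite exchange_big /=; under eq_bigr do rewrite exchange_big /=.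
transitivity (\sum_(t : 'I_n * 'I_n) \sum_(r : 'I_n * 'I_n)
   (P i t.1 * Q r.2 j * (t.2 == r.1)%:R) *: op_tens (bval (A t.1 t.2)) (bval (A r.1 r.2))).
  apply: eq_bigr => t _; apply: eq_bigr => r _; rewrite -scaler_suml; congr (_ *: _).
  have := congr1 (fun Z : 'M[R[i]]_n => Z t.2 r.1) QP; rewrite !mxE => <-.
  by rewrite mulr_sumr; apply: eq_bigr => k _; ring.
pose O a b c d := op_tens (bval (A a b)) (bval (A c d)).
transitivity (\sum_a \sum_b \sum_c \sum_d (P i a * Q d j * (b == c)%:R) *: O a b c d).
  rewrite (pair_bigA _ (fun a b => \sum_c \sum_d (P i a * Q d j * (b == c)%:R) *: O a b c d)).
  apply: eq_bigr => t _.
  by rewrite (pair_bigA _ (fun c d => (P i t.1 * Q d j * (t.2 == c)%:R) *: O t.1 t.2 c d)).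
transitivity (\sum_k \sum_a \sum_d (P i a * Q d j) *: O a k k d).
  rewrite exchange_big /=; apply: eq_bigr => k _; apply: eq_bigr => a _.
  rewrite (bigD1 k)//= [X in _ + X]big1 ?addr0.
    by apply: eq_bigr => d _; rewrite eqxx mulr1.
  by move=> c ck; rewrite big1// => d _; rewrite eq_sym (negPf ck) mulr0 scale0r.
by apply: eq_bigr => k _; rewrite (pair_bigA _ (fun a d => (P i a * Q d j) *: O a k k d)).
Qed.

End Comultiplication.

(** * Invariance of the Haar state and positive definite matrices *)

Section Haar.
Variables (R : realType) (G : cqg R).
Notation B := (bop R (cqg_idx G)).
Notation M := (Linf G).
Notation D := (comul G).

Let HM : vN_algebra M := Linf_vN G.
Let hnormal : normal_functional M (haar G).
Proof. by case: (haar_state G). Qed.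

Definition hb (a : B) : R[i] := haar G (bval a).

Lemma hb_lin c (a b : B) : inM a -> inM b -> hb (c *: a + b) = c * hb a + hb b.
Proof. exact: (normal_lin HM hnormal). Qed.

Lemma hb_sumZ (T : Type) (s : seq T) (c : T -> R[i]) (F : T -> B) : (forall t, inM (F t)) ->
  hb (\sum_(t <- s) c t *: F t) = \sum_(t <- s) c t * hb (F t).
Proof.
move=> HF; elim: s => [|t s IH].
  by rewrite !big_nil; exact: (normal0 HM hnormal).
by rewrite !big_cons hb_lin ?IH//; apply: inM_sum => u; exact: inMZ.
Qed.

Lemma hb_sum (T : Type) (s : seq T) (F : T -> B) : (forall t, inM (F t)) ->
  hb (\sum_(t <- s) F t) = \sum_(t <- s) hb (F t).
Proof.
move=> HF; transitivity (hb (\sum_(t <- s) 1 *: F t)).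
  by congr hb; apply: eq_bigr => t _; rewrite scale1r.
by rewrite hb_sumZ//; apply: eq_bigr => t _; rewrite mul1r.
Qed.

Lemma hb1 : hb 1 = 1. Proof. by case: (haar_state G). Qed.

Lemma hb_ge0 a : inM a -> 0 <= hb (star a * a).
Proof. by case: (haar_state G) => _ H _ _ Ma; exact: H. Qed.

Lemma hb_faithful a : inM a -> hb (star a * a) = 0 -> a = 0.
Proof.
by case: (haar_state G) => _ _ _ H Ma h0; apply: bval_inj; exact: H.
Qed.

(** Positivity of [h] on [(1 + z a)^* (1 + z a)] for [z = 1] and [z = i]. *)
Lemma hb_star a : inM a -> hb (star a) = (hb a)^*.
Proof.
move=> Ma.
have Ms := inM_star Ma; have M1 : inM (1 : B) by exact: inM1.
have H z : complex.Im (z * hb a + z^* * hb (star a)) = 0.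
  have Mz : inM (z *: a + 1) by apply: inMD => //; exact: inMZ.
  have := ger0_Im (hb_ge0 Mz).
  have -> : star (z *: a + 1) * (z *: a + 1) =
      z *: a + (z^* *: star a + ((z^* * z) *: (star a * a) + 1)).
    rewrite starD starZ star1 mulrDl mul1r mulrDr mulr1 -bscaleAl -bscaleAr scalerA.
    by rewrite [LHS](AC (2*2) (3*(2*(1*4)))).
  have Maa : inM (star a * a) by exact: inMM.
  have M2 : inM ((z^* * z) *: (star a * a) + 1) by apply: inMD => //; exact: inMZ.
  have M3 : inM (z^* *: star a + ((z^* * z) *: (star a * a) + 1)).
    by apply: inMD => //; exact: inMZ.
  rewrite hb_lin// hb_lin// hb_lin// hb1 mulrC [_ * z]mulrC mulcJ.
  have := ger0_Im (hb_ge0 Ma); move: (hb a) (hb (star a)) (hb (star a * a)) => [p q] [r s] [t u].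
  case: z {Mz M2 M3} => x y /=; rewrite /abs2 /= => ->; lra.
have := H 1; have := H 'i%C; move: (hb a) (hb (star a)) => [p q] [r s] /=.
by move=> h1 h2; apply/eqP; rewrite eq_complex /=; apply/andP; split; apply/eqP; lra.
Qed.

(** ** Invariance *)

Section Invariance.
Variables (T : Type) (s : seq T) (a : B) (b c : T -> B).
Hypotheses (Ma : inM a) (Mb : forall t, inM (b t)) (Mc : forall t, inM (c t)).
Hypothesis Da : D (bval a) = \sum_(t <- s) op_tens (bval (b t)) (bval (c t)).

Let Da_tens x y : D (bval a) (tens x y) = \sum_(t <- s) tens (b t x) (c t y).
Proof.
rewrite Da fct_sumE; apply: eq_bigr => t _; apply: op_tens_tens; exact: bvalP.
Qed.

(** Right and left invariance, evaluated on a finite expansion of [Delta a] into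
    elementary tensors. *)
Lemma haar_inv_r : \sum_(t <- s) hb (c t) *: b t = hb a *: (1 : B).
Proof.
apply: bval_inj; have [H _] := @haar_invariant _ G _ Ma.
apply: etrans _ H; symmetry; apply: op_of_form_eq; first exact: bvalP.
move=> x y.
have -> : slice_l x y (D (bval a)) = bval (\sum_(t <- s) dot (b t x) y *: c t).
  apply: op_of_form_eq; first exact: bvalP.
  move=> u v; rewrite Da_tens dot_suml bop_sum dot_suml; apply: eq_bigr => t _.
  by rewrite dot_tens bopZ dotZl.
rewrite -/(hb _) hb_sumZ// bop_sum dot_suml; apply: eq_bigr => t _.
by rewrite bopZ dotZl mulrC.
Qed.

Lemma haar_inv_l : \sum_(t <- s) hb (b t) *: c t = hb a *: (1 : B).
Proof.
apply: bval_inj; have [_ H] := @haar_invariant _ G _ Ma.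
apply: etrans _ H; symmetry; apply: op_of_form_eq; first exact: bvalP.
move=> x y.
have -> : slice_r x y (D (bval a)) = bval (\sum_(t <- s) dot (c t x) y *: b t).
  apply: op_of_form_eq; first exact: bvalP.
  move=> u v; rewrite Da_tens dot_suml bop_sum dot_suml; apply: eq_bigr => t _.
  by rewrite dot_tens bopZ dotZl mulrC.
rewrite -/(hb _) hb_sumZ// bop_sum dot_suml; apply: eq_bigr => t _.
by rewrite bopZ dotZl mulrC.
Qed.

End Invariance.

Definition hmx m n (A : 'M[B]_(m, n)) : 'M[R[i]]_(m, n) := \matrix_(i, j) hb (A i j).

Section CorepInvariance.
Variables (n : nat) (V : 'M[B]_n).
Hypothesis HV : corep V.

Let MV i j : inM (V i j). Proof. by case: HV. Qed.
Let DV i j : D (bval (V i j)) = \sum_k op_tens (bval (V i k)) (bval (V k j)).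
Proof. by case: HV. Qed.
Let DVs i j : D (bval (star (V i j))) = \sum_k op_tens (bval (star (V i k))) (bval (star (V k j))).
Proof.
by have [_ /(_ i j)] := corep_bar HV; rewrite mxE => ->; apply: eq_bigr => k _; rewrite !mxE.
Qed.

Let comp_sum (T U : Type) (s : seq T) (r : seq U) (a b : T -> B) (c d : U -> B) :
  (\sum_(t <- s) op_tens (bval (a t)) (bval (b t))) \o
  (\sum_(u <- r) op_tens (bval (c u)) (bval (d u))) =
  \sum_(t <- s) \sum_(u <- r) op_tens (bval (a t * c u)) (bval (b t * d u)).
Proof.
have bO (x y : B) : bounded_op (op_tens (bval x) (bval y)) by apply: bounded_op_tens; exact: bvalP.
apply/funext => f /=; rewrite !fct_sumE; apply: eq_bigr => t _.
have [lt_ _] := bO (a t) (b t).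
rewrite (linop_sum lt_) fct_sumE; apply: eq_bigr => u _.
have := op_tens_comp (bvalP (a t)) (bvalP (c u)) (bvalP (b t)) (bvalP (d u)).
by move/(congr1 (fun g => g f)).
Qed.

Let sum3 (W : nmodType) (F : 'I_n -> 'I_n -> 'I_n -> W) :
  \sum_(t : 'I_n * ('I_n * 'I_n)) F t.1 t.2.1 t.2.2 = \sum_k \sum_p \sum_q F k p q.
Proof.
rewrite -(pair_bigA _ (fun k pq => F k pq.1 pq.2)) /=; apply: eq_bigr => k _.
by rewrite (pair_bigA _ (fun p q => F k p q)).
Qed.

(** [h(V^* V)] is the average of the standard form over the representation [V],
    hence invariant under [V]; [h(V V^* )] is the same average on the other side. *)
Lemma corep_inv_l : mxstar V *m mxsc _ (hmx (mxstar V *m V)) *m V = mxsc _ (hmx (mxstar V *m V)).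
Proof.
apply/matrixP => i j; set F := hmx _.
have E : (mxstar V *m V) i j = \sum_k star (V k i) * V k j.
  by rewrite mxE; apply: eq_bigr => k _; rewrite mxE.
have Mk k : inM (star (V k i) * V k j) by apply: inMM => //; exact: inM_star.
have Da : D (bval ((mxstar V *m V) i j)) = \sum_(t : 'I_n * ('I_n * 'I_n))
    op_tens (bval (star (V t.1 t.2.1) * V t.1 t.2.2)) (bval (star (V t.2.1 i) * V t.2.2 j)).
  rewrite (sum3 (fun k p q => op_tens (bval (star (V k p) * V k q))
    (bval (star (V p i) * V q j)))).
  rewrite E comul_sum//; apply: eq_bigr => k _.
  by rewrite bvalM (comulM (inM_star (MV k i)) (MV k j)) DV DVs comp_sum.
have := haar_inv_l _ _ Da.
have -> : \sum_(t : 'I_n * ('I_n * 'I_n)) hb (star (V t.1 t.2.1) * V t.1 t.2.2) *: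
   (star (V t.2.1 i) * V t.2.2 j) = (mxstar V *m mxsc _ F *m V) i j.
  rewrite (sum3 (fun k p q => hb (star (V k p) * V k q) *: (star (V p i) * V q j))).
  rewrite exchange_big /=; under eq_bigr do rewrite exchange_big /=.
  rewrite exchange_big /=.
  rewrite mxE; apply: eq_bigr => q _; rewrite mxE mulr_suml; apply: eq_bigr => p _.
  rewrite -scaler_suml mxscE mxstarE scal_r -bscaleAl; congr (_ *: _).
  rewrite [RHS]mxE -hb_sum; last by move=> k; apply: inMM => //; exact: inM_star.
  by congr hb; rewrite mxE; apply: eq_bigr => k _; rewrite mxE.
move=> ->; first by rewrite mxscE /scal [F i j]mxE.
- by rewrite E; exact: inM_sum.
- by move=> t; apply: inMM => //; exact: inM_star.
Qed.

Lemma corep_inv_r : V *m mxsc _ (hmx (V *m mxstar V)) *m mxstar V = mxsc _ (hmx (V *m mxstar V)).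
Proof.
apply/matrixP => i j; set F := hmx _.
have E : (V *m mxstar V) i j = \sum_k V i k * star (V j k).
  by rewrite mxE; apply: eq_bigr => k _; rewrite mxE.
have Mk k : inM (V i k * star (V j k)) by apply: inMM => //; exact: inM_star.
have Da : D (bval ((V *m mxstar V) i j)) = \sum_(t : 'I_n * ('I_n * 'I_n))
    op_tens (bval (V i t.2.1 * star (V j t.2.2))) (bval (V t.2.1 t.1 * star (V t.2.2 t.1))).
  rewrite (sum3 (fun k p q => op_tens (bval (V i p * star (V j q)))
    (bval (V p k * star (V q k))))).
  rewrite E comul_sum//; apply: eq_bigr => k _.
  by rewrite bvalM (comulM (MV i k) (inM_star (MV j k))) DV DVs comp_sum.
have := haar_inv_r _ _ Da.
have -> : \sum_(t : 'I_n * ('I_n * 'I_n)) hb (V t.2.1 t.1 * star (V t.2.2 t.1)) *: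
   (V i t.2.1 * star (V j t.2.2)) = (V *m mxsc _ F *m mxstar V) i j.
  rewrite (sum3 (fun k p q => hb (V p k * star (V q k)) *: (V i p * star (V j q)))).
  rewrite exchange_big /=; under eq_bigr do rewrite exchange_big /=.
  rewrite exchange_big /=.
  rewrite mxE; apply: eq_bigr => q _; rewrite mxE mulr_suml; apply: eq_bigr => p _.
  rewrite -scaler_suml mxscE mxstarE scal_r -bscaleAl; congr (_ *: _).
  rewrite [RHS]mxE -hb_sum; last by move=> k; apply: inMM => //; exact: inM_star.
  by congr hb; rewrite mxE; apply: eq_bigr => k _; rewrite mxE.
move=> ->; first by rewrite mxscE /scal [F i j]mxE.
- by rewrite E; exact: inM_sum.
- by move=> t; apply: inMM => //; exact: inM_star.
Qed.

End CorepInvariance.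

End Haar.

(** ** Positive definite matrices *)

Section PosDef.
Variable R : realType.

Definition qform n (F : 'M[R[i]]_n) (c : 'I_n -> R[i]) := \sum_i \sum_j (c i)^* * F i j * c j.

Definition posdef n (F : 'M[R[i]]_n) :=
  ctrmx F = F /\ forall c, 0 <= qform F c /\ (qform F c = 0 -> forall j, c j = 0).

Lemma posdef_unit n (F : 'M[R[i]]_n) : posdef F -> F \in unitmx.
Proof.
move=> [_ HF]; rewrite unitmxE unitfE; apply/negP => /det0P [v vn0 vF].
pose c i := (v 0 i)^*.
have q0 : qform F c = 0.
  rewrite /qform exchange_big big1// => j _; rewrite -mulr_suml.
  have := congr1 (fun Z : 'M[R[i]]_(1, n) => Z 0 j) vF; rewrite !mxE => e.
  rewrite (eq_bigr (fun i => v 0 i * F i j)) ?e ?mul0r// => i _.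
  by rewrite /c conjcK.
have [_ /(_ q0) c0] := HF c.
case/negP: vn0; apply/eqP/matrixP => i j; rewrite (ord1 i) mxE.
by have := c0 j; rewrite /c => /eqP; rewrite conjc_eq0 => /eqP.
Qed.

Lemma ctrmxM m n p (A : 'M[R[i]]_(m, n)) (C : 'M[R[i]]_(n, p)) :
  ctrmx (A *m C) = ctrmx C *m ctrmx A.
Proof.
have J (F : 'I_n -> R[i]) : (\sum_k F k)^* = \sum_k (F k)^*.
  exact: (rmorph_sum (@conjc R)).
apply/matrixP => i j; rewrite !mxE J.
by apply: eq_bigr => k _; rewrite !mxE conjcM mulrC.
Qed.

Lemma ctrmxE m n (A : 'M[R[i]]_(m, n)) : ctrmx A = map_mx (@Num.conj R[i]) A^T.
Proof. by apply/matrixP => i j; rewrite !mxE. Qed.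

(** By the spectral theorem. *)
Lemma posdef_gram n (F : 'M[R[i]]_n) : posdef F ->
  exists2 C : 'M[R[i]]_n, C \in unitmx & F = ctrmx C *m C.
Proof.
move=> [hF HF].
have nF : F \is normalmx by apply/normalmxP; rewrite -ctrmxE hF.
have uP := spectral_unitarymx F; set P := spectralmx F in uP.
have /orthomx_spectralP := nF; rewrite -/P invmx_unitary// -ctrmxE => FE.
set d := spectral_diag F in FE.
have PP : P *m ctrmx P = 1%:M by rewrite ctrmxE; exact/unitarymxP.
have dE : diag_mx d = P *m F *m ctrmx P.
  by rewrite FE !mulmxA PP mul1mx -mulmxA PP mulmx1.
have dq i : d 0 i = qform F (fun j => (P i j)^*).
  transitivity (diag_mx d i i); first by rewrite mxE eqxx.
  rewrite dE mxE /qform exchange_big; apply: eq_bigr => j _.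
  rewrite !mxE mulr_suml; apply: eq_bigr => k _.
  by rewrite conjcK.
have d_gt0 i : 0 < d 0 i.
  have [q0 q1] := HF (fun j => (P i j)^*).
  rewrite lt_neqAle dq q0 andbT eq_sym; apply/eqP => /q1 Pi0.
  have := congr1 (fun Z : 'M[R[i]]_n => Z i i) PP; rewrite !mxE eqxx big1.
    by move/eqP; rewrite eq_sym oner_eq0.
  by move=> j _; rewrite mxE Pi0 mulr0.
pose e i := Num.sqrt (complex.Re (d 0 i)).
have de i : d 0 i = ((e i) ^+ 2)%:C.
  have := d_gt0 i; rewrite ltcE /= => /andP[/eqP im re].
  rewrite sqr_sqrtr ?ltW//; exact: complex_ext.
have e_neq0 i : (e i)%:C != 0.
  apply/eqP => ei; have := d_gt0 i; rewrite de rmorphXn /= ei expr0n /=.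
  by rewrite ltxx.
exists (diag_mx (\row_i (e i)%:C) *m P).
  rewrite unitmx_mul spectral_unit andbT unitmxE det_diag unitfE.
  by apply/prodf_neq0 => i _; rewrite mxE.
rewrite ctrmxM FE -!mulmxA; congr (_ *m _); rewrite !mulmxA; congr (_ *m _).
apply/matrixP => i j; rewrite mxE [RHS]mxE (bigD1 i)//= [X in _ + X]big1 ?addr0.
  rewrite !mxE eqxx mulr1n conjc_real de; case: (i == j).
    by rewrite !mulr1n rmorphXn.
  by rewrite !mulr0n mulr0.
by move=> k ki; rewrite !mxE (negPf ki) mulr0n conjc0 mul0r.
Qed.

End PosDef.

Section HaarGram.
Variables (R : realType) (G : cqg R).
Notation B := (bop R (cqg_idx G)).

(** The value of the form at [c] is the sum of the [h(y_k^* y_k)] with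
    [y_k = sum_j c_j A_kj], and [h] is faithful. *)
Lemma hmx_posdef n (A : 'M[B]_n) : (forall i j, inM (A i j)) ->
  (forall c : 'I_n -> R[i], (forall k, \sum_j c j *: A k j = 0) -> forall j, c j = 0) ->
  posdef (hmx (mxstar A *m A)).
Proof.
move=> MA HA.
have E i j : (mxstar A *m A) i j = \sum_k star (A k i) * A k j.
  by rewrite mxE; apply: eq_bigr => k _; rewrite mxE.
have MM i j k : inM (star (A k i) * A k j) by apply: inMM => //; exact: inM_star.
split.
  apply/matrixP => i j; rewrite mxE [hmx _ j i]mxE [RHS]mxE !E.
  rewrite -hb_star; last exact: inM_sum.
  by congr hb; rewrite star_sum; apply: eq_bigr => k _; rewrite starM starK.
move=> c; pose y k := \sum_j c j *: A k j.
have My k : inM (y k) by apply: inM_sum => j; exact: inMZ.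
have qE : qform (hmx (mxstar A *m A)) c = \sum_k hb (star (y k) * y k).
  have yy k : star (y k) * y k =
      \sum_(t : 'I_n * 'I_n) ((c t.1)^* * c t.2) *: (star (A k t.1) * A k t.2).
    rewrite /y star_sum mulr_suml.
    rewrite -(pair_bigA _ (fun i j => ((c i)^* * c j) *: (star (A k i) * A k j))) /=.
    apply: eq_bigr => i _; rewrite mulr_sumr; apply: eq_bigr => j _.
    by rewrite starZ -bscaleAl -bscaleAr scalerA.
  under [RHS]eq_bigr => k _.
    rewrite yy hb_sumZ; last by move=> t; exact: MM.
    rewrite -(pair_bigA _ (fun i j => ((c i)^* * c j) * hb (star (A k i) * A k j))) /=.
    over.
  rewrite exchange_big; apply: eq_bigr => i _; rewrite exchange_big; apply: eq_bigr => j _ /=.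
  rewrite mxE E hb_sum; last by move=> k; exact: MM.
  by rewrite mulr_sumr mulr_suml; apply: eq_bigr => k _; ring.
rewrite qE; split; first by apply: sumr_ge0 => k _; exact: hb_ge0.
move/psumr_eq0P => H; apply: HA => k; apply: hb_faithful; first exact: My.
by apply: H => // l _; exact: hb_ge0.
Qed.

End HaarGram.

(** * Irreducible representations as matrices *)

Section IrreducibleMatrices.
Variables (R : realType) (G : cqg R).
Notation B := (bop R (cqg_idx G)).
Notation repop J := (op R (cqg_idx G * J)%type (cqg_idx G * J)%type).

Definition unitmat n (U : 'M[B]_n) := mxstar U *m U = 1%:M /\ U *m mxstar U = 1%:M.

Definition irredmat n (U : 'M[B]_n) :=
  forall A : 'M[R[i]]_n, mxsc _ A *m U = U *m mxsc _ A -> exists c, A = c%:M.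

(** The Haar state separates scalars; this excludes that [Linf G] acts on the
    zero space. *)
Lemma scal_inj : injective (@scal R (cqg_idx G)).
Proof.
have H c : hb (scal _ c : B) = c.
  have := hb_lin c (inM1 G) (inM0 G); rewrite addr0 hb1 mulr1 => ->.
  have -> : hb (0 : B) = 0; last by rewrite addr0.
  have := hb_lin 1 (inM0 G) (inM0 G).
  by rewrite scale1r addr0 mul1r => /eq_addr_eq0.
by move=> c d /(congr1 (@hb _ G)); rewrite !H.
Qed.

Lemma mxsc_inj m n : injective (@mxsc R (cqg_idx G) m n).
Proof.
move=> A A' H; apply/matrixP => i j; apply: scal_inj.
by rewrite -!mxscE H.
Qed.

Lemma mxsc0 m n : mxsc (cqg_idx G) (0 : 'M[R[i]]_(m, n)) = 0.
Proof. by apply/matrixP => i j; rewrite mxscE !mxE /scal scale0r. Qed.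

Lemma irreducible_matrix n (u : repop 'I_n) : irreducible_unitary_rep u ->
  exists U : 'M[B]_n, [/\ u = ofmx_fun U, corep U, unitmat U, irredmat U & (0 < n)%N].
Proof.
move=> [ru uu [x x0] iu]; have [bu _ _] := uu.
exists (mxof bu); have E := mxofK bu.
split=> //.
- by apply: representation_corep; rewrite E.
- by apply/unitary_ofmx; rewrite E.
- move=> A HA.
  have [|c Hc] := iu (mxop A).
    by split; [exact: bounded_mxop|rewrite amp_r_mxop -E -!ofmxM HA].
  exists c; apply/matrixP => i j; rewrite -mxop_bvec Hc !mxE.
  rewrite -[LHS]/((c *: bvec R j : l2 R 'I_n) i) l2ZE bvecE.
  by case: (i == j); rewrite ?mulr1 ?mulr0.
- case: n u {ru uu iu bu E} x x0 => // u x /eqP []; by apply: l2_ext => -[].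
Qed.

Lemma matrix_irreducible n (U : 'M[B]_n) : corep U -> unitmat U -> irredmat U -> (0 < n)%N ->
  irreducible_unitary_rep (ofmx_fun U).
Proof.
move=> cU uU iU n0; split.
- exact: corep_representation.
- exact/unitary_ofmx.
- exists (bvec R (Ordinal n0)); apply/eqP => /(congr1 (fun x : l2 R 'I_n => x (Ordinal n0))).
  by rewrite bvecE eqxx => /eqP; rewrite oner_eq0.
- move=> T [bT HT].
  have [|c Hc] := iU (opmat T).
    by apply: ofmx_inj; rewrite !ofmxM -!(amp_r_mx _ bT).
  exists c; rewrite -(mxop_opmat bT) Hc; apply/funext => x; apply: l2_ext => i.
  rewrite mxopE (bigD1 i)//= [X in _ + X]big1 ?addr0; first by rewrite mxE eqxx.
  by move=> j ji; rewrite mxE eq_sym (negPf ji) mul0r.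
Qed.

Lemma opmat_comp m n p (T : op R 'I_n 'I_m) (T' : op R 'I_p 'I_n) : linear T ->
  opmat (T \o T') = opmat T *m opmat T'.
Proof.
move=> lT; apply/matrixP => i j; rewrite mxE /= {1}(l2_expand (T' (bvec R j))).
rewrite (linop_sum lT) l2sumE mxE; apply: eq_bigr => k _.
by rewrite (linopZ lT) l2ZE !mxE mulrC.
Qed.

Lemma opmat_id n : opmat (id : op R 'I_n 'I_n) = 1%:M.
Proof. by apply/matrixP => i j; rewrite !mxE bvecE. Qed.

Lemma equivalent_matrix m n (U : 'M[B]_m) (W : 'M[B]_n) :
  equivalent_rep (ofmx_fun U) (ofmx_fun W) ->
  exists (P : 'M[R[i]]_(n, m)) (P' : 'M[R[i]]_(m, n)),
    [/\ P *m P' = 1%:M, P' *m P = 1%:M & W = mxsc _ P *m U *m mxsc _ P'].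
Proof.
move=> [T [bT T1 T2] [_ HT]]; have [lT _] := bT; have [lT' _] := bounded_adj bT.
exists (opmat T), (opmat (adj T)).
have PP : opmat T *m opmat (adj T) = 1%:M by rewrite -opmat_comp// T2 opmat_id.
split=> //; first by rewrite -opmat_comp// T1 opmat_id.
have E : mxsc _ (opmat T) *m U = W *m mxsc _ (opmat T).
  by apply: ofmx_inj; rewrite !ofmxM -!(amp_r_mx _ bT).
by rewrite E -mulmxA -mxscM PP mxsc1 mulmx1.
Qed.

Lemma mxbar_sc n (A : 'M[R[i]]_n) (U : 'M[B]_n) :
  mxsc _ A *m mxbar U = mxbar U *m mxsc _ A ->
  mxsc _ (map_mx (@conjc R) A) *m U = U *m mxsc _ (map_mx (@conjc R) A).
Proof.
move=> H; apply/matrixP => i j.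
have := congr1 (fun Z : 'M[B]_n => star (Z i j)) H.
rewrite !mxE !star_sum => E.
transitivity (\sum_k star (mxsc (cqg_idx G) A i k * mxbar U k j)); last rewrite E.
  by apply: eq_bigr => k _; rewrite starM !mxE star_scal starK scal_l scal_r.
by apply: eq_bigr => k _; rewrite starM !mxE star_scal starK scal_l scal_r.
Qed.

(** The contragredient of an irreducible [U] is irreducible, being the entrywise
    conjugate. *)
Lemma irred_bar n (U : 'M[B]_n) : irredmat U -> irredmat (mxbar U).
Proof.
move=> iU A /mxbar_sc /iU [c Hc]; exists c^*; apply/matrixP => i j.
have := congr1 (fun Z : 'M[R[i]]_n => (Z i j)^*) Hc; rewrite !mxE conjcK => ->.
by case: (i == j); rewrite ?mulr1n// !mulr0n conjc0.
Qed.

Lemma irred_conj n (V : 'M[B]_n) (C : 'M[R[i]]_n) : C \in unitmx -> irredmat V ->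
  irredmat (mxsc _ C *m V *m mxsc _ (invmx C)).
Proof.
move=> uC iV A HA.
have [|c Hc] := iV (invmx C *m A *m C).
  have K1 := mxsc_inv (cqg_idx G) uC; have K2 := mxsc_invl (cqg_idx G) uC.
  rewrite !mxscM.
  have := congr1 (fun Z => mxsc _ (invmx C) *m Z *m mxsc _ C) HA.
  rewrite /= !mulmxA K2 mul1mx -!mulmxA K2 mulmx1.
  by rewrite !mulmxA.
exists c; have : C *m (invmx C *m A *m C) *m invmx C = C *m c%:M *m invmx C by rewrite Hc.
by rewrite !mulmxA mulmxV// mul1mx -!mulmxA mulmxV// mulmx1 mulmxA scalar_mxC -mulmxA mulmxV// mulmx1.
Qed.

End IrreducibleMatrices.

(** * The modular operator makes the contragredient unitary *)

Section DiagonalPowers.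
Variable R : realType.

Lemma mxpowE n (Q : 'M[R[i]]_n) t i j :
  mxpow Q t i j = ((complex.Re (Q i i)) `^ t)%:C *+ (i == j).
Proof. by rewrite !mxE. Qed.

Variables (n : nat) (Q : 'M[R[i]]_n).
Hypothesis Qpos : forall i, 0 < complex.Re (Q i i).
Hypothesis Qdiag : forall i j, Q i j = (complex.Re (Q i i))%:C *+ (i == j).

Lemma mxpowD s t : mxpow Q (s + t) = mxpow Q s *m mxpow Q t.
Proof.
apply/matrixP => i j; rewrite [RHS]mxE (bigD1 i)//= [X in _ = _ + X]big1 ?addr0; last first.
  by move=> k ki; rewrite mxpowE eq_sym (negPf ki) mulr0n mul0r.
rewrite !mxpowE eqxx mulr1n powRD; last by rewrite (gt_eqF (Qpos i)) implybT.
by case: (i == j); rewrite ?mulr1n ?mulr0n ?mulr0// rmorphM.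
Qed.

Lemma mxpow0 : mxpow Q 0 = 1%:M.
Proof. by apply/matrixP => i j; rewrite mxpowE powRr0 mxE. Qed.

Lemma mxpow1 : mxpow Q 1 = Q.
Proof. by apply/matrixP => i j; rewrite mxpowE powRr1 ?ltW// -Qdiag. Qed.

Lemma mxpowNr t : mxpow Q t *m mxpow Q (- t) = 1%:M.
Proof. by rewrite -mxpowD subrr mxpow0. Qed.

Lemma mxpowNl t : mxpow Q (- t) *m mxpow Q t = 1%:M.
Proof. by rewrite -mxpowD addNr mxpow0. Qed.

Lemma ctrmx_mxpow t : ctrmx (mxpow Q t) = mxpow Q t.
Proof.
apply/matrixP => i j; rewrite mxE !mxpowE eq_sym.
by case: (eqVneq i j) => [->|_]; rewrite ?mulr1n ?conjc_real// !mulr0n conjc0.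
Qed.

End DiagonalPowers.

Section Modular.
Variables (R : realType) (G : cqg R).
Notation B := (bop R (cqg_idx G)).

(** For [t = theta / 2] this is the matrix of the deformed contragredient with
    parameter [theta]; for [t = 0] it is the contragredient. *)
Definition qbar n (Q : 'M[R[i]]_n) (U : 'M[B]_n) (t : R) : 'M[B]_n :=
  mxsc _ (mxpow Q t) *m mxbar U *m mxsc _ (mxpow Q (- t)).

Lemma deformed_contragredientE n (Q : 'M[R[i]]_n) (U : 'M[B]_n) t :
  deformed_contragredient (ofmx_fun U) Q t = ofmx_fun (qbar Q U (t / 2)).
Proof.
have e i j : adj (coef (ofmx_fun U) i j) = bval (mxbar U i j) by rewrite coef_ofmx mxE.
have C : contragredient (ofmx_fun U) = ofmx_fun (mxbar U).
  apply: etrans _ (of_coefE (mxbar U)).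
  by apply: eq_bigr => i _; apply: eq_bigr => j _; rewrite -e.
have A1 := amp_r_mxop (cqg_idx G) (mxpow Q (t / 2)).
have A2 := amp_r_mxop (cqg_idx G) (mxpow Q (- (t / 2))).
apply: etrans (congr2 (fun f g => f \o contragredient (ofmx_fun U) \o g) A1 A2) _.
by rewrite C /qbar !ofmxM.
Qed.

(** With [row_kernel], the source of the independence hypothesis of
    [hmx_posdef]: multiply a linear relation by the inverse. *)
Lemma col_kernel m n (U : 'M[B]_(m, n)) (U' : 'M[B]_(n, m)) (c : 'I_n -> R[i]) :
  U' *m U = 1%:M -> (forall k, \sum_j c j *: U k j = 0) -> forall j, c j = 0.
Proof.
move=> UU H j; pose v : 'cV[R[i]]_n := \col_j c j.
have Uv : U *m mxsc _ v = 0.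
  apply/matrixP => i k; rewrite [RHS]mxE -[RHS](H i) mxE.
  by apply: eq_bigr => l _; rewrite mxscE scal_r mxE.
have : mxsc (cqg_idx G) v = mxsc _ 0.
  by rewrite mxsc0 -[LHS]mul1mx -UU -mulmxA Uv mulmx0.
by move/mxsc_inj/matrixP => /(_ j 0); rewrite !mxE.
Qed.

Lemma row_kernel m n (U : 'M[B]_(n, m)) (U' : 'M[B]_(m, n)) (c : 'I_n -> R[i]) :
  U *m U' = 1%:M -> (forall k, \sum_j c j *: U j k = 0) -> forall j, c j = 0.
Proof.
move=> UU H j; pose v : 'rV[R[i]]_n := \row_j c j.
have Uv : mxsc _ v *m U = 0.
  apply/matrixP => i k; rewrite [RHS]mxE -[RHS](H k) mxE.
  by apply: eq_bigr => l _; rewrite mxscE scal_l mxE.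
have : mxsc (cqg_idx G) v = mxsc _ 0.
  by rewrite mxsc0 -[LHS]mulmx1 -UU mulmxA Uv mul0mx.
by move/mxsc_inj/matrixP => /(_ 0 j); rewrite !mxE.
Qed.

Section Contragredient.
Variables (n : nat) (U : 'M[B]_n).
Hypotheses (cU : corep U) (uU : unitmat U).
Let V := mxbar U.
Let F := hmx (mxstar V *m V).
Let E := hmx (V *m mxstar V).

Let MV i j : inM (V i j). Proof. exact: (corep_inM _ _ (corep_bar cU)). Qed.

Lemma contragredient_posdef_l : posdef F.
Proof.
apply: hmx_posdef => // c Hc j.
have [U1 _] := uU.
have H k : \sum_j (c j)^* *: U k j = 0.
  have := congr1 (@star _ _) (Hc k); rewrite star0 star_sum => e; rewrite -[RHS]e.
  by apply: eq_bigr => l _; rewrite starZ mxE starK.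
have := col_kernel (c := fun j => (c j)^*) U1 H j.
by move/eqP; rewrite conjc_eq0 => /eqP.
Qed.

Lemma contragredient_posdef_r : posdef E.
Proof.
rewrite /E -[X in X *m _]mxstarK; apply: hmx_posdef => [i j|c Hc j].
  by rewrite mxE; exact: inM_star.
have [_ U2] := uU.
apply: (row_kernel U2) => k; rewrite -[RHS](Hc k).
by apply: eq_bigr => l _; rewrite !mxE starK.
Qed.

(** The contragredient is invertible: [F^-1 V^* F] is a left inverse by left
    invariance, [E V^* E^-1] is a right inverse by right invariance. *)
Lemma contragredient_inv_l : mxsc _ (invmx F) *m mxstar V *m mxsc _ F *m V = 1%:M.
Proof.
have := corep_inv_l (corep_bar cU); rewrite -/V -/F => H.
by rewrite -!mulmxA [X in _ *m X]mulmxA H mxsc_invl//; exact: posdef_unit contragredient_posdef_l.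
Qed.

Lemma contragredient_inv_r : V *m (mxsc _ E *m mxstar V *m mxsc _ (invmx E)) = 1%:M.
Proof.
have := corep_inv_r (corep_bar cU); rewrite -/V -/E => H.
by rewrite !mulmxA H mxsc_inv//; exact: posdef_unit contragredient_posdef_r.
Qed.

Lemma left_right_inv (A L P : 'M[B]_n) : L *m A = 1%:M -> A *m P = 1%:M -> P = L.
Proof. by move=> LA AP; rewrite -[L]mulmx1 -AP mulmxA LA mul1mx. Qed.

(** [V] preserves the form [F]; writing [F = C^* C], the matrix [C V C^-1]
    preserves the standard form, and it is unitary because [V] is invertible. *)
Lemma contragredient_unitarizable : exists2 C : 'M[R[i]]_n, C \in unitmx &
  unitmat (mxsc _ C *m V *m mxsc _ (invmx C)).
Proof.
have [C uC FC] := posdef_gram contragredient_posdef_l; exists C => //.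
set W := _ *m _ *m _.
have K1 := mxsc_inv (cqg_idx G) uC; have K2 := mxsc_invl (cqg_idx G) uC.
have W1 : mxstar W *m W = 1%:M.
  rewrite /W !mxstarM !mxstar_sc.
  have H := corep_inv_l (corep_bar cU); rewrite -/V -/F FC mxscM in H.
  transitivity (mxsc _ (ctrmx (invmx C)) *m
    (mxstar V *m (mxsc _ (ctrmx C) *m mxsc _ C) *m V) *m mxsc _ (invmx C)).
    by rewrite !mulmxA.
  rewrite H mulmxA -mulmxA K1 mulmx1 -mxscM.
  have -> : ctrmx (invmx C) *m ctrmx C = 1%:M.
    rewrite -ctrmxM mulmxV//; apply/matrixP => i j; rewrite !mxE eq_sym.
    by case: (i == j); rewrite ?mulr1n ?mulr0n ?conjc1 ?conjc0.
  by rewrite mxsc1.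
split=> //.
pose P := mxsc _ C *m (mxsc _ E *m mxstar V *m mxsc _ (invmx E)) *m mxsc _ (invmx C).
have WP : W *m P = 1%:M.
  transitivity (mxsc _ C *m (V *m (mxsc _ (invmx C) *m mxsc _ C) *m
    (mxsc _ E *m mxstar V *m mxsc _ (invmx E))) *m mxsc _ (invmx C)).
    by rewrite /W /P !mulmxA.
  by rewrite K2 mulmx1 contragredient_inv_r mulmx1 K1.
by rewrite -(left_right_inv W1 WP).
Qed.

End Contragredient.

Section Antipode.
Variables (X : irr_system G)
  (S : op R (cqg_idx G) (cqg_idx G) -> op R (cqg_idx G) (cqg_idx G)).
Hypothesis HS : antipode X S.

Lemma Pol_sum (T : Type) (s : seq T) (c : T -> R[i]) (a : T -> op R (cqg_idx G) (cqg_idx G)) :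
  (forall t, exists alpha i j, a t = coef (irr_rep X alpha) i j) ->
  Pol X (\sum_(t <- s) c t *: a t).
Proof.
move=> Ha; exists (size s), (fun i => c (tnth (in_tuple s) i)), (fun i => a (tnth (in_tuple s) i)).
by split=> [i|]; [exact: Ha|rewrite big_tnth].
Qed.

Lemma Pol_gen alpha i j : Pol X (coef (irr_rep X alpha) i j).
Proof.
have H (t : unit) : exists beta k l, coef (irr_rep X alpha) i j = coef (irr_rep X beta) k l.
  by exists alpha, i, j.
have := @Pol_sum unit [:: tt] (fun _ => 1) (fun _ => coef (irr_rep X alpha) i j) H.
by rewrite big_seq1 scale1r.
Qed.

Lemma antipode_sum (T : Type) (s : seq T) (c : T -> R[i]) (a : T -> op R (cqg_idx G) (cqg_idx G)) :
  (forall t, exists alpha i j, a t = coef (irr_rep X alpha) i j) ->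
  S (\sum_(t <- s) c t *: a t) = \sum_(t <- s) c t *: S (a t).
Proof.
have [Slin _] := HS; move=> Ha.
have P0 : Pol X 0 by have := @Pol_sum T [::] c a Ha; rewrite big_nil.
elim: s => [|t s IH].
  rewrite !big_nil; have := Slin 1 0 0 P0 P0.
  by rewrite !scale1r addr0 => /eq_addr_eq0.
rewrite !big_cons Slin ?IH//; last exact: Pol_sum.
by have [alpha [i [j ->]]] := Ha t; exact: Pol_gen.
Qed.

Section OneRep.
Variables (alpha : Irr X).
Let n := irr_dim X alpha.
Variables (U : 'M[B]_n).
Hypotheses (UE : irr_rep X alpha = ofmx_fun U) (cU : corep U) (uU : unitmat U)
  (iU : irredmat U) (n0 : (0 < n)%N).
Let V := mxbar U.
Let F := hmx (mxstar V *m V).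

(** The antipode inverts the chosen irreducible representations.  Up to a
    change of basis the contragredient is one of them, and [S], being linear,
    commutes with a change of basis. *)
Lemma antipode_contragredient i j :
  S (bval (V i j)) = bval ((mxsc _ (invmx F) *m mxstar V *m mxsc _ F) i j).
Proof.
have [C uC uW] := contragredient_unitarizable cU uU; rewrite -/V in uW.
set W := _ *m _ *m _ in uW.
have K1 := mxsc_inv (cqg_idx G) uC; have K2 := mxsc_invl (cqg_idx G) uC.
have cW : corep W.
  by apply: corep_conj; [rewrite mulVmx|exact: corep_bar].
have iW : irredmat W by apply: irred_conj => //; exact: irred_bar.
have [beta] := irr_exhaust X (matrix_irreducible cW uW iW n0).
have [Ub [Eb cUb [_ uUb] _ _]] := irreducible_matrix (irr_repP beta).
rewrite Eb => /equivalent_matrix [P [P' [PP PP' WE]]].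
pose P1 := invmx C *m P; pose P2 := P' *m C.
have P12 : P1 *m P2 = 1%:M by rewrite /P1 /P2 -mulmxA [P *m _]mulmxA PP mul1mx mulVmx.
have P21 : P2 *m P1 = 1%:M by rewrite /P1 /P2 -mulmxA [C *m _]mulmxA mulmxV// mul1mx.
have VE : V = mxsc _ P1 *m Ub *m mxsc _ P2.
  rewrite /P1 /P2 !mxscM.
  transitivity (mxsc _ (invmx C) *m W *m mxsc _ C); last by rewrite WE !mulmxA.
  by rewrite /W !mulmxA K2 mul1mx -mulmxA K2 mulmx1.
pose Z := mxsc _ P1 *m mxstar Ub *m mxsc _ P2.
have VZ : V *m Z = 1%:M.
  rewrite VE /Z -!mulmxA [mxsc _ P2 *m _]mulmxA -mxscM P21 mxsc1 mul1mx.
  by rewrite [Ub *m _]mulmxA uUb mul1mx -mxscM P12 mxsc1.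
rewrite -(left_right_inv (contragredient_inv_l cU uU) VZ).
rewrite VE /Z !mulmx_scE bval_sum [in RHS]bval_sum.
transitivity (S (\sum_(t : 'I_(irr_dim X beta) * 'I_(irr_dim X beta))
    (P1 i t.1 * P2 t.2 j) *: coef (irr_rep X beta) t.1 t.2)).
  by congr S; apply: eq_bigr => t _; rewrite bvalZ Eb coef_ofmx.
rewrite antipode_sum; last by move=> t; exists beta, t.1, t.2.
apply: eq_bigr => t _; rewrite bvalZ; congr (_ *: _).
by have [_ ->] := HS; rewrite Eb coef_ofmx mxE.
Qed.

Lemma antipode_square i j :
  S (S (bval (U i j))) = bval ((mxsc _ F^T *m U *m mxsc _ (invmx F)^T) i j).
Proof.
have -> : S (bval (U i j)) = bval (V j i).
  have [_ H] := HS; have := H alpha i j; rewrite UE !coef_ofmx => ->.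
  by rewrite mxE.
rewrite antipode_contragredient !mulmx_scE; congr bval.
rewrite -(pair_bigA _ (fun k l => (invmx F j k * F l i) *: mxstar V k l)) /=.
rewrite -(pair_bigA _ (fun k l => (F^T i k * (invmx F)^T l j) *: U k l)) /=.
rewrite exchange_big; apply: eq_bigr => k _; apply: eq_bigr => l _.
by rewrite !mxE starK mulrC.
Qed.

Variable Q : 'M[R[i]]_n.
Hypothesis HQ : modular_operator S (irr_rep X alpha) Q.

Lemma modular_pos i : 0 < complex.Re (Q i i).
Proof.
have [[Qp Qu] _ _ /is_diag_mxP dQ] := HQ.
have : 0 <= Q i i by have := Qp (bvec R i); rewrite dot_bvecr mxop_bvec.
rewrite le_eqVlt => /orP[/eqP Q0|]; last by rewrite ltcE => /andP[].
have := congr1 (fun Z : 'M[R[i]]_n => Z i i) (mulmxV Qu); rewrite !mxE eqxx big1.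
  by move/eqP; rewrite eq_sym oner_eq0.
move=> j _; have [<-|ij] := eqVneq i j; first by rewrite -Q0 mul0r.
by rewrite dQ ?mul0r.
Qed.

Lemma modular_diag i j : Q i j = (complex.Re (Q i i))%:C *+ (i == j).
Proof.
have [[Qp Qu] _ _ /is_diag_mxP dQ] := HQ.
have [<-|ij] := eqVneq i j; last by rewrite dQ.
have : 0 <= Q i i by have := Qp (bvec R i); rewrite dot_bvecr mxop_bvec.
by rewrite lecE => /andP[/eqP im _]; rewrite mulr1n; exact: complex_ext.
Qed.

(** [F^T] and [Q] both implement [S^2], so [Q^-1 F^T] commutes with [U] and is a
    scalar; as [Q] is diagonal, [F] is a multiple of [Q], and [F] is invariant
    under [V]. *)
Lemma modular_invariant : mxstar V *m mxsc _ Q *m V = mxsc _ Q.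
Proof.
have [[Qp Qu] _ QS _] := HQ.
have uF : F \in unitmx by apply: posdef_unit; exact: contragredient_posdef_l.
have E1 : mxsc _ F^T *m U *m mxsc _ (invmx F)^T = mxsc _ Q *m U *m mxsc _ (invmx Q).
  apply: ofmx_inj; rewrite [RHS]ofmxM (ofmxM (mxsc _ Q)).
  have A1 := amp_r_mxop (cqg_idx G) Q; have A2 := amp_r_mxop (cqg_idx G) (invmx Q).
  apply: etrans _ (congr2 (fun f g => f \o ofmx_fun U \o g) A1 A2).
  rewrite -UE; apply: etrans _ QS; rewrite -of_coefE.
  by apply: eq_bigr => i _; apply: eq_bigr => j _; rewrite -antipode_square UE coef_ofmx.
have [c Hc] : exists c, invmx Q *m F^T = c%:M.
  apply: iU; rewrite !mxscM.
  have E2 := congr1 (fun Z => mxsc _ (invmx Q) *m Z *m mxsc _ F^T) E1.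
  rewrite /= !mulmxA mxsc_invl// mul1mx in E2.
  rewrite -!mulmxA -mxscM -trmx_mul mulmxV// trmx1 mxsc1 mulmx1 in E2.
  by rewrite -mulmxA E2 !mulmxA.
have FQ : F = c *: Q.
  apply: trmx_inj; rewrite -[LHS](mulKVmx Qu) Hc mul_mx_scalar linearZ /=; congr (_ *: _).
  apply/matrixP => i j; rewrite mxE [LHS]modular_diag [RHS]modular_diag eq_sym.
  by case: (eqVneq i j) => [->|].
have c0 : c != 0.
  apply/eqP => c0; have := mulVmx uF; rewrite [X in _ *m X]FQ c0 scale0r mulmx0.
  move/matrixP => /(_ (Ordinal n0) (Ordinal n0)); rewrite !mxE eqxx => /eqP.
  by rewrite eq_sym oner_eq0.
have H := corep_inv_l (corep_bar cU); rewrite -/V -/F FQ in H.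
have scZ : mxsc _ (c *: Q) = mxsc (cqg_idx G) c%:M *m mxsc _ Q.
  by rewrite -mxscM mul_scalar_mx.
have cV m p (A : 'M[B]_(m, p)) : A *m mxsc _ c%:M = mxsc _ c%:M *m A.
  apply/matrixP => i j; rewrite !mxE (bigD1 j)//= (bigD1 i)//= !big1 ?addr0.
  - by rewrite !mxscE !mxE !eqxx !mulr1n scal_l scal_r.
  - by move=> k ki; rewrite mxscE !mxE eq_sym (negPf ki) mulr0n scal_l scale0r.
  - by move=> k kj; rewrite mxscE !mxE (negPf kj) mulr0n scal_r scale0r.
rewrite scZ mulmxA cV in H.
have := congr1 (fun Z => mxsc _ (c^-1)%:M *m Z) H.
rewrite /= !mulmxA -mxscM -scalar_mxM mulVf// mxsc1 !mul1mx.
by [].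
Qed.

(** [V] preserves the form [Q], so [Q^(1/2) V Q^(-1/2)] preserves the standard
    form. *)
Lemma qbar_half_unitary : unitmat (qbar Q U (1 / 2)).
Proof.
have pos := modular_pos; have dg := modular_diag.
have H : mxpow Q (1 / 2) *m mxpow Q (1 / 2) = Q.
  by rewrite -mxpowD// -mulrDl -mulr2n divff ?pnatr_eq0// mxpow1.
set W := qbar Q U (1 / 2).
have W1 : mxstar W *m W = 1%:M.
  rewrite /W /qbar !mxstarM !mxstar_sc !ctrmx_mxpow//.
  transitivity (mxsc _ (mxpow Q (- (1 / 2))) *m
    (mxstar V *m (mxsc _ (mxpow Q (1 / 2)) *m mxsc _ (mxpow Q (1 / 2))) *m V) *m
     mxsc _ (mxpow Q (- (1 / 2)))).
    by rewrite !mulmxA.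
  rewrite -mxscM H modular_invariant -!mxscM -[X in _ *m X *m _]H.
  by rewrite !mulmxA mxpowNl// mul1mx mxpowNr// mxsc1.
split=> //.
set P0 := mxsc _ (hmx (V *m mxstar V)) *m mxstar V *m mxsc _ (invmx (hmx (V *m mxstar V))).
pose P := mxsc _ (mxpow Q (1 / 2)) *m P0 *m mxsc _ (mxpow Q (- (1 / 2))).
have WP : W *m P = 1%:M.
  transitivity (mxsc _ (mxpow Q (1 / 2)) *m (V *m (mxsc _ (mxpow Q (- (1 / 2)))
    *m mxsc _ (mxpow Q (1 / 2))) *m P0) *m mxsc _ (mxpow Q (- (1 / 2)))).
    by rewrite /W /P /qbar -/V !mulmxA.
  rewrite -mxscM mxpowNl// mxsc1 mulmx1 contragredient_inv_r// mulmx1.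
  by rewrite -mxscM mxpowNr// mxsc1.
by rewrite -(left_right_inv W1 WP).
Qed.

End OneRep.
End Antipode.
End Modular.

(** * Interpolation of the norms of the deformed contragredients *)

Section RealPowers.
Variable R : realType.

Lemma bernoulli (t : R) m : 0 <= t -> 1 + t *+ m <= (1 + t) ^+ m.
Proof.
move=> t0; elim: m => [|m IH]; first by rewrite mulr0n addr0 expr0.
rewrite exprS; apply: le_trans (ler_wpM2l _ IH); last by rewrite addr_ge0.
rewrite mulrDl mul1r mulrDr mulr1 mulrS.
have : 0 <= t * (t *+ m) by rewrite mulr_ge0 ?mulrn_wge0.
by lra.
Qed.

(** Constants disappear when one takes roots of higher and higher order. *)
Lemma le_of_powers (x y K : R) : 0 <= x -> 0 <= y ->
  (forall k, x ^+ (2 ^ k) <= K * y ^+ (2 ^ k)) -> x <= y.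
Proof.
move=> x0 y0 H; have [y00|yn0] := eqVneq y 0.
  by have := H 0%N; rewrite expn0 !expr1 y00 mulr0.
have yp : 0 < y by rewrite lt_neqAle eq_sym yn0.
rewrite leNgt; apply/negP => xy.
pose t := x / y - 1.
have t0 : 0 < t by rewrite subr_gt0 ltr_pdivlMr// mul1r.
have B k : 1 + t *+ (2 ^ k) <= K.
  apply: le_trans (bernoulli _ (ltW t0)) _.
  rewrite /t addrC subrK expr_div_n ler_pdivrMr ?exprn_gt0//.
have K0 : 0 <= K by apply: le_trans (B 0%N); rewrite addr_ge0// mulrn_wge0// ltW.
have := archi_boundP (divr_ge0 K0 (ltW t0)); set m := Num.bound _ => Hm.
have := B m; apply/negP; rewrite -ltNge.
rewrite ltr_pdivrMr// in Hm; apply: (lt_le_trans Hm).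
rewrite mulr_natl; apply: le_trans (_ : t *+ 2 ^ m <= _); last by rewrite lerDr.
rewrite -[leLHS]mulr_natr -[leRHS]mulr_natr (ler_wpM2l (ltW t0))// ler_nat ltnW//.
exact: ltn_expl.
Qed.

Lemma sum_sqr_le n (a : 'I_n -> R) : (\sum_j a j) ^+ 2 <= n%:R * \sum_j a j ^+ 2.
Proof.
rewrite expr2 mulr_suml; under eq_bigr do rewrite mulr_sumr.
apply: (@le_trans _ _ (\sum_i \sum_j (a i ^+ 2 + a j ^+ 2) / 2)).
  by apply: ler_sum => i _; apply: ler_sum => j _; have := sqr_ge0 (a i - a j); rewrite sqrrB; lra.
rewrite le_eqVlt; apply/orP; left; apply/eqP.
under eq_bigr do rewrite -mulr_suml big_split /= sumr_const card_ord.
by rewrite -mulr_suml big_split /= sumrMnl sumr_const card_ord mulr_natl mulrDl -splitr.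
Qed.

End RealPowers.

Section Norms.
Variables (R : realType) (I : choiceType).
Notation B := (bop R I).

Definition mxnorm_le m n (A : 'M[B]_(m, n)) (c : R) :=
  forall f, l2norm (ofmx_fun A f) <= c * l2norm f.

Lemma mxnorm_leM m n p (A : 'M[B]_(m, n)) (A' : 'M[B]_(n, p)) a b : 0 <= a ->
  mxnorm_le A a -> mxnorm_le A' b -> mxnorm_le (A *m A') (a * b).
Proof.
move=> a0 HA HA' f; rewrite ofmxM /=; apply: le_trans (HA _) _.
by rewrite -mulrA ler_wpM2l.
Qed.

Lemma mxnorm_le_trans m n (A : 'M[B]_(m, n)) a b : a <= b -> mxnorm_le A a -> mxnorm_le A b.
Proof. by move=> ab HA f; apply: le_trans (HA f) _; rewrite ler_wpM2r ?l2norm_ge0. Qed.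

Lemma mxnorm_bound m n (A : 'M[B]_(m, n)) : exists2 c : R, 0 <= c & mxnorm_le A c.
Proof. by have [c c0 Hc] := bounded_ge0 (bounded_ofmx A); exists c. Qed.

Lemma mxnorm_star m n (A : 'M[B]_(m, n)) a : 0 <= a -> mxnorm_le A a -> mxnorm_le (mxstar A) a.
Proof.
by move=> a0 HA f; rewrite -adj_ofmx; apply: (adj_norm (bounded_ofmx A) a0 HA).
Qed.

Lemma mxnorm1 n : mxnorm_le (1%:M : 'M[B]_n) 1.
Proof. by move=> f; rewrite ofmx1 mul1r. Qed.

Lemma dot_ofmx m n (A : 'M[B]_(m, n)) f g :
  dot (ofmx_fun A f) g = dot f (ofmx_fun (mxstar A) g).
Proof. by rewrite -adj_ofmx (dot_adjr _ _ (bounded_ofmx A)). Qed.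

Lemma l2norm_ofmx_sqr m n (A : 'M[B]_(m, n)) f :
  l2norm (ofmx_fun A f) ^+ 2 = complex.Re (dot (ofmx_fun (mxstar A *m A) f) f).
Proof.
have -> : ofmx_fun (mxstar A *m A) f = ofmx_fun (mxstar A) (ofmx_fun A f) by rewrite ofmxM.
by rewrite dot_ofmx mxstarK dotxx.
Qed.

Lemma mxnorm_sqr m n (A : 'M[B]_(m, n)) c : 0 <= c -> mxnorm_le (mxstar A *m A) (c ^+ 2) ->
  mxnorm_le A c.
Proof.
move=> c0 H f; rewrite -(ler_pXn2r (n := 2)) ?nnegrE ?mulr_ge0 ?l2norm_ge0//.
rewrite l2norm_ofmx_sqr; apply: le_trans (ler_norm _) _; apply: le_trans (Re_normc _) _.
apply: le_trans (cauchy_schwarz _ _) _.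
apply: le_trans (ler_wpM2r (l2norm_ge0 _) (H f)) _.
by rewrite exprMn -mulrA -expr2.
Qed.

Lemma mxnorm_isometry m n (A : 'M[B]_(m, n)) : mxstar A *m A = 1%:M -> mxnorm_le A 1.
Proof. by move=> HA; apply: mxnorm_sqr => //; rewrite HA expr1n; exact: mxnorm1. Qed.

Definition powmx n (A : 'M[B]_n) m := iter m (mulmx A) 1%:M.

Lemma powmxD n (A : 'M[B]_n) a b : powmx A (a + b) = powmx A a *m powmx A b.
Proof.
elim: a => [|a IH]; first by rewrite mul1mx.
by rewrite addSn /= -/(powmx A (a + b)) IH mulmxA.
Qed.

Lemma powmx_star n (A : 'M[B]_n) m : mxstar A = A -> mxstar (powmx A m) = powmx A m.
Proof.
move=> HA; elim: m => [|m IH]; first by rewrite mxstar1.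
have S : powmx A m.+1 = powmx A m *m A.
  by rewrite -[m.+1]addn1 powmxD /= mulmx1.
by rewrite {1}S mxstarM IH HA.
Qed.

Lemma powmx_conj n (A P P' : 'M[B]_n) m : P *m P' = 1%:M -> P' *m P = 1%:M ->
  powmx (P *m A *m P') m = P *m powmx A m *m P'.
Proof.
move=> PP PP'; elim: m => [|m IH]; first by rewrite mulmx1 PP.
rewrite /= -/(powmx (P *m A *m P') m) IH.
transitivity (P *m A *m (P' *m P) *m powmx A m *m P'); first by rewrite !mulmxA.
by rewrite PP' mulmx1 !mulmxA.
Qed.

Lemma powmx_norm n (A : 'M[B]_n) c m : 0 <= c -> mxnorm_le A c -> mxnorm_le (powmx A m) (c ^+ m).
Proof.
move=> c0 HA; elim: m => [|m IH]; first by rewrite expr0; exact: mxnorm1.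
by rewrite exprS; exact: mxnorm_leM.
Qed.

(** The norm of a selfadjoint matrix is at most its spectral radius: from
    |H^m f|^2 <= |H^2m f| |f| the growth of [H^(2^k) f] controls [H f]. *)
Lemma selfadjoint_norm n (H : 'M[B]_n) c K : mxstar H = H -> 0 <= c ->
  (forall m, mxnorm_le (powmx H m) (K * c ^+ m)) -> mxnorm_le H c.
Proof.
move=> sH c0 HK f; have [f0|fn0] := eqVneq (l2norm f) 0.
  have [lH _] := bounded_ofmx H.
  by rewrite f0 (l2norm_eq0 f0) (linop0 lH) l2norm0 mulr0.
have fp : 0 < l2norm f by rewrite lt_neqAle eq_sym fn0 l2norm_ge0.
pose r m := l2norm (ofmx_fun (powmx H m) f) / l2norm f.
have r0 m : 0 <= r m by rewrite divr_ge0 ?l2norm_ge0.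
have r2 m : r m ^+ 2 <= r (m + m)%N.
  rewrite /r expr_div_n ler_pdivrMr ?exprn_gt0// [in leRHS]expr2 mulrA divfK//.
  rewrite l2norm_ofmx_sqr powmx_star// -powmxD.
  apply: le_trans (ler_norm _) _; apply: le_trans (Re_normc _) _.
  exact: cauchy_schwarz.
have rk k : r 1%N ^+ (2 ^ k) <= r (2 ^ k)%N.
  elim: k => [|k IH]; first by rewrite expn0 expr1.
  rewrite expnS mulnC exprM; apply: le_trans (_ : r (2 ^ k)%N ^+ 2 <= _).
    by rewrite ler_pXn2r ?nnegrE ?exprn_ge0.
  by rewrite muln2 -addnn r2.
have : r 1%N <= c.
  apply: (@le_of_powers _ _ _ K) => // k; apply: le_trans (rk k) _.
  by rewrite /r ler_pdivrMr// HK.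
rewrite /r ler_pdivrMr// => h; apply: le_trans h.
by rewrite /powmx /= mulmx1.
Qed.

Lemma mxnorm_diag n (d : 'I_n -> R) c : (forall i, `|d i| <= c) ->
  mxnorm_le (mxsc I (diag_mx (\row_i (d i)%:C))) c.
Proof.
move=> Hd f.
have [n0 _|i0] := pickP (fun _ : 'I_n => true); last first.
  have f0 : forall g : l2 R (I * 'I_n)%type, g = 0.
    by move=> g; apply: l2_ext => -[a j]; have := i0 j.
  by rewrite (f0 (ofmx_fun _ _)) (f0 f) !l2norm0 mulr0.
have c0 : 0 <= c by apply: le_trans (Hd n0).
rewrite -(ler_pXn2r (n := 2)) ?nnegrE ?mulr_ge0 ?l2norm_ge0//.
rewrite exprMn !l2norm_colvs mulr_sumr; apply: ler_sum => i _.
rewrite colv_ofmx (bigD1 i)//= [X in _ + X]big1 ?addr0; last first.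
  by move=> j ji; rewrite mxscE !mxE eq_sym (negPf ji) mulr0n /scal scale0r.
rewrite mxscE !mxE eqxx mulr1n bopZ bop1 l2normZ exprMn -abs2E /abs2 /= expr0n addr0.
rewrite ler_wpM2r ?sqr_ge0// -[d i ^+ 2]real_normK ?num_real//.
by rewrite ler_pXn2r ?nnegrE.
Qed.

(** Cauchy-Schwarz in each row.  The bound [n] is what entrywise contractions
    give without any relation between the entries. *)
Lemma mxnorm_entries n (V : 'M[B]_n) :
  (forall i j x, l2norm (V i j x) <= l2norm x) -> mxnorm_le V n%:R.
Proof.
move=> HV f; rewrite -(ler_pXn2r (n := 2)) ?nnegrE ?mulr_ge0 ?l2norm_ge0//.
rewrite l2norm_colvs exprMn l2norm_colvs.
set A := \sum_j l2norm (colv j f).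
apply: (@le_trans _ _ (\sum_(i < n) A ^+ 2)).
  apply: ler_sum => i _; rewrite ler_pXn2r ?nnegrE ?l2norm_ge0//; last first.
    by apply: sumr_ge0 => j _; exact: l2norm_ge0.
  rewrite colv_ofmx; apply: le_trans (l2norm_sum _ _ _) _.
  by apply: ler_sum => j _; exact: HV.
rewrite sumr_const card_ord -[A ^+ 2 *+ n]mulr_natl (expr2 (n%:R : R)) -mulrA (ler_wpM2l (ler0n R n))//.
exact: sum_sqr_le.
Qed.

End Norms.

Section Interpolation.
Variables (R : realType) (G : cqg R) (n : nat) (Q : 'M[R[i]]_n).
Notation B := (bop R (cqg_idx G)).
Hypothesis Qpos : forall i, 0 < complex.Re (Q i i).
Variable U : 'M[B]_n.
Hypothesis uU : unitmat U.
Hypothesis uW : unitmat (qbar Q U (1 / 2)).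

Let X := qbar Q U.

Lemma star_qbar s : mxstar (X s) =
  mxsc _ (mxpow Q (- s)) *m mxstar (mxbar U) *m mxsc _ (mxpow Q s).
Proof. by rewrite /X /qbar !mxstarM !mxstar_sc !ctrmx_mxpow mulmxA. Qed.

Lemma qbar_star_mul s t r : s + t = r -> mxstar (X s) *m X t = mxsc _ (mxpow Q (- s)) *m
  (mxstar (mxbar U) *m mxsc _ (mxpow Q r) *m mxbar U) *m mxsc _ (mxpow Q (- t)).
Proof. by move=> <-; rewrite star_qbar /X /qbar (mxpowD Qpos s t) mxscM !mulmxA. Qed.

(** [X_m^* X_m] is similar to [X_(m+d)^* X_(m-d)], so its spectral radius, which
    is |X_m|^2, is at most |X_(m+d)| |X_(m-d)|. *)
Lemma qbar_midpoint m d a b : 0 <= a -> 0 <= b ->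
  mxnorm_le (X (m + d)) a -> mxnorm_le (X (m - d)) b -> mxnorm_le (X m) (Num.sqrt (a * b)).
Proof.
move=> a0 b0 Ha Hb; apply: mxnorm_sqr; first exact: sqrtr_ge0.
rewrite sqr_sqrtr ?mulr_ge0//.
set H := mxstar (X m) *m X m; set Z := mxstar (X (m + d)) *m X (m - d).
have P1 : mxsc (cqg_idx G) (mxpow Q d) *m mxsc _ (mxpow Q (- d)) = 1%:M.
  by rewrite -mxscM mxpowNr// mxsc1.
have P2 : mxsc (cqg_idx G) (mxpow Q (- d)) *m mxsc _ (mxpow Q d) = 1%:M.
  by rewrite -mxscM mxpowNl// mxsc1.
have HZ : H = mxsc _ (mxpow Q d) *m Z *m mxsc _ (mxpow Q (- d)).
  pose Y := mxstar (mxbar U) *m mxsc _ (mxpow Q (m + m)) *m mxbar U.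
  pose u := mxsc (cqg_idx G) (mxpow Q (- m)).
  have HE : H = u *m Y *m u := qbar_star_mul erefl.
  have sm : m + d + (m - d) = m + m by lra.
  have ZE : Z = _ *m Y *m _ := qbar_star_mul sm.
  have D1 : - (m + d) = - d + - m by lra.
  have D2 : - (m - d) = - m + d by lra.
  have e1 : mxsc _ (mxpow Q (- (m + d))) = mxsc _ (mxpow Q (- d)) *m u.
    exact: etrans (congr1 (fun r => mxsc _ (mxpow Q r)) D1)
      (etrans (congr1 (@mxsc _ _ _ _) (mxpowD Qpos (- d) (- m))) (mxscM _ _ _)).
  have e2 : mxsc _ (mxpow Q (- (m - d))) = u *m mxsc _ (mxpow Q d).
    exact: etrans (congr1 (fun r => mxsc _ (mxpow Q r)) D2)
      (etrans (congr1 (@mxsc _ _ _ _) (mxpowD Qpos (- m) d)) (mxscM _ _ _)).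
  have ZE' := etrans ZE (congr2 (fun a b => a *m Y *m b) e1 e2).
  rewrite HE ZE' /=; clearbody u Y.
  transitivity ((mxsc _ (mxpow Q d) *m mxsc _ (mxpow Q (- d))) *m (u *m Y *m u) *m
    (mxsc _ (mxpow Q d) *m mxsc _ (mxpow Q (- d)))); first by rewrite P1 mul1mx mulmx1.
  by rewrite !mulmxA.
have nZ : mxnorm_le Z (a * b) := mxnorm_leM a0 (mxnorm_star a0 Ha) Hb.
have [k1 k10 Hk1] := mxnorm_bound (mxsc (cqg_idx G) (mxpow Q d)).
have [k2 k20 Hk2] := mxnorm_bound (mxsc (cqg_idx G) (mxpow Q (- d))).
apply: (@selfadjoint_norm _ _ _ _ _ (k1 * k2)).
- by rewrite /H mxstarM mxstarK.
- exact: mulr_ge0.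
move=> l; rewrite HZ powmx_conj//.
have -> : k1 * k2 * (a * b) ^+ l = k1 * (a * b) ^+ l * k2 by ring.
apply: mxnorm_leM => //; first by rewrite mulr_ge0 ?exprn_ge0 ?mulr_ge0.
by apply: mxnorm_leM => //; apply: powmx_norm => //; exact: mulr_ge0.
Qed.

Let N : R := 1 + n%:R.

Let N1 : 1 <= N. Proof. by rewrite lerDl. Qed.
Let N0 : 0 < N. Proof. exact: lt_le_trans N1. Qed.
Let Nge0 : 0 <= N. Proof. exact: ltW. Qed.

(** Because the [U_ik U_ik^*] sum to 1 over [k]. *)
Lemma star_entry_norm i j x : l2norm (star (U i j) x) <= l2norm x.
Proof.
have [_ U2] := uU.
have H : \sum_k l2norm (star (U i k) x) ^+ 2 = l2norm x ^+ 2.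
  apply: complexI; rewrite -dotxx rmorph_sum.
  transitivity (dot ((U *m mxstar U) i i x) x); last by rewrite U2 mxE eqxx.
  rewrite mxE bop_sum dot_suml; apply: eq_bigr => k _.
  by rewrite bopM mxstarE -dot_starr dotxx.
rewrite -(ler_pXn2r (n := 2)) ?nnegrE ?l2norm_ge0// -H (bigD1 j)//= lerDl.
by apply: sumr_ge0 => k _; exact: sqr_ge0.
Qed.

Lemma qbar0_norm : mxnorm_le (X 0) N.
Proof.
rewrite /X /qbar oppr0 mxpow0 mxsc1 mul1mx mulmx1.
apply: (@mxnorm_le_trans _ _ _ _ _ n%:R); first by rewrite lerDr.
by apply: mxnorm_entries => i j x; rewrite mxE star_entry_norm.
Qed.

Lemma qbar_half_norm : mxnorm_le (X (1 / 2)) 1.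
Proof. by apply: mxnorm_isometry; case: uW. Qed.

Lemma powR_le1D (q s : R) : 0 < q -> 0 <= s <= 1 -> q `^ s <= 1 + q.
Proof.
move=> q0 /andP[s0 s1]; have [q1|q1] := leP 1 q.
  apply: le_trans (ler_powR q1 s1) _.
  by rewrite powRr1 ?lerDr// ltW.
have : q `^ s <= 1 `^ s by apply: ge0_ler_powR => //; rewrite ?nnegrE ltW.
by rewrite powR1 => /le_trans; apply; rewrite lerDl ltW.
Qed.

(** A bound that is only uniform in [s], to start the iteration of
    [qbar_improve]. *)
Lemma qbar_rough_norm : exists2 K : R, 0 <= K &
  forall s, 0 <= s <= 1 / 2 -> mxnorm_le (X s) K.
Proof.
pose q i := complex.Re (Q i i).
pose k := \sum_i (1 + q i + (q i)^-1).
have kt i : 0 <= 1 + q i + (q i)^-1.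
  by have := Qpos i => /ltW qi; rewrite !addr_ge0 ?invr_ge0.
have ki i : 1 + q i + (q i)^-1 <= k.
  by rewrite /k (bigD1 i)//= lerDl sumr_ge0.
have k0 : 0 <= k by exact: sumr_ge0.
exists (k * N * k); first by rewrite !mulr_ge0.
move=> s /andP[s0 s1]; have sb : 0 <= s <= 1 by rewrite s0 (le_trans s1)//; lra.
have V0 : mxnorm_le (mxbar U) N.
  by have := qbar0_norm; rewrite /X /qbar oppr0 mxpow0 mxsc1 mul1mx mulmx1.
apply: mxnorm_leM; first by rewrite mulr_ge0.
  apply: mxnorm_leM => //; apply: mxnorm_diag => i.
  rewrite ger0_norm ?powR_ge0//; apply: le_trans (powR_le1D (Qpos i) sb) _.
  by apply: le_trans (ki i); rewrite lerDl invr_ge0 ltW// Qpos.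
apply: mxnorm_diag => i; rewrite ger0_norm ?powR_ge0//.
have qi0 := Qpos i; have qV : 0 < (q i)^-1 by rewrite invr_gt0.
have -> : complex.Re (Q i i) `^ (- s) = (q i)^-1 `^ s.
  rewrite powRN; apply: (mulIf (lt0r_neq0 (powR_gt0 s qi0))).
  by rewrite mulVf ?gt_eqF ?powR_gt0// -powRM ?ltW// mulVf ?gt_eqF// powR1.
apply: le_trans (powR_le1D qV sb) _; apply: le_trans (ki i).
by rewrite addrAC lerDl ltW.
Qed.

(** The constant [K] of a bound [K N^(1 - 2 s)] that is uniform in [s] can be
    replaced by its square root: each [s] in [0, 1/2] is the midpoint of an
    endpoint, where the bound holds with constant 1, and of another point. *)
Lemma qbar_improve K : 0 <= K ->
  (forall s, 0 <= s <= 1 / 2 -> mxnorm_le (X s) (K * N `^ (1 - 2 * s))) ->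
  forall s, 0 <= s <= 1 / 2 -> mxnorm_le (X s) (Num.sqrt K * N `^ (1 - 2 * s)).
Proof.
move=> K0 HK s /andP[s0 s1].
have NR t : N `^ (2 * t) = (N `^ t) ^+ 2.
  have -> : 2 * t = t + t by lra.
  by rewrite powRD ?(gt_eqF N0) ?implybT// expr2.
have E : Num.sqrt (K * N `^ (2 * (1 - 2 * s))) = Num.sqrt K * N `^ (1 - 2 * s).
  by rewrite NR sqrtrM// sqrtr_sqr ger0_norm// powR_ge0.
rewrite -E; have [s4|s4] := leP s (1 / 4).
  have -> : K * N `^ (2 * (1 - 2 * s)) = (K * N `^ (1 - 2 * (2 * s))) * N.
    rewrite -mulrA -[X in _ = _ * (_ * X)](powRr1 (ltW N0)) -powRD ?(gt_eqF N0) ?implybT//.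
    by congr (_ * _ `^ _); lra.
  apply: (@qbar_midpoint s s); rewrite ?mulr_ge0 ?powR_ge0//.
    have -> : s + s = 2 * s by lra.
    by apply: HK; apply/andP; split; lra.
  by rewrite subrr; exact: qbar0_norm.
have -> : K * N `^ (2 * (1 - 2 * s)) = 1 * (K * N `^ (1 - 2 * (2 * s - 1 / 2))).
  by rewrite mul1r; congr (_ * _ `^ _); lra.
apply: (@qbar_midpoint s (1 / 2 - s)); rewrite ?mulr_ge0 ?powR_ge0//.
  have -> : s + (1 / 2 - s) = 1 / 2 by lra.
  exact: qbar_half_norm.
have -> : s - (1 / 2 - s) = 2 * s - 1 / 2 by lra.
by apply: HK; apply/andP; split; lra.
Qed.

(** Iterating [qbar_improve] replaces [K] by its [2^k]-th root for every [k]. *)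
Lemma qbar_norm s : 0 <= s <= 1 / 2 -> mxnorm_le (X s) (N `^ (1 - 2 * s)).
Proof.
have [K K0 HK] := qbar_rough_norm.
have K1 t : 0 <= t <= 1 / 2 -> mxnorm_le (X t) (K * N `^ (1 - 2 * t)).
  move=> ht; apply: mxnorm_le_trans (HK _ ht); rewrite ler_peMr//.
  by rewrite -[leLHS](powRr0 N) ler_powR//; move: ht => /andP[]; lra.
pose L k := iter k Num.sqrt K.
have L0 k : 0 <= L k by elim: k => [|k IH] //=; exact: sqrtr_ge0.
have LK k : L k ^+ (2 ^ k) = K.
  by elim: k => [|k IH]; rewrite ?expn0 ?expr1// expnS exprM sqr_sqrtr.
have HL k : forall t, 0 <= t <= 1 / 2 -> mxnorm_le (X t) (L k * N `^ (1 - 2 * t)).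
  by elim: k => [|k IH] //=; exact: qbar_improve.
move=> hs f; apply: (@le_of_powers _ _ _ K).
- exact: l2norm_ge0.
- by rewrite mulr_ge0 ?powR_ge0 ?l2norm_ge0.
move=> k; rewrite -(LK k) -exprMn ler_pXn2r ?nnegrE ?expn_gt0//.
- by rewrite mulrA HL.
- exact: l2norm_ge0.
- by rewrite !mulr_ge0 ?powR_ge0 ?l2norm_ge0.
Qed.

End Interpolation.

(** * Direct sums of corepresentations *)

Lemma l2norm_le_abs2 (R : realType) (I : choiceType) (x y : l2 R I) :
  (forall i, abs2 (x i) <= abs2 (y i)) -> l2norm x <= l2norm y.
Proof.
move=> H; rewrite -(ler_pXn2r (n := 2)) ?nnegrE ?l2norm_ge0// -lee_fin !l2norm_sqr.
by apply: le_esum => i _; rewrite lee_fin.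
Qed.

(** ** Inclusions of summands *)

Section Inclusion.
Variables (R : realType) (A : choiceType) (J : A -> choiceType).
Notation JA := {a : A & J a}.

Definition fib_sigma : fibration J JA.
Proof.
apply: (@Fibration A J JA (fun a k => Tagged J k) (fun p => tag p) (fun p => tagged p)).
- by case. - by []. - by move=> a k k' /eqP; rewrite eq_Tagged => /eqP.
Defined.

Lemma untag_Tagged (U : Type) (u0 : U) a (f : J a -> U) k : untag u0 f (Tagged J k) = f k.
Proof. by rewrite (untagE u0 f (erefl : tag (Tagged J k) = a)). Qed.

Lemma incl_sqsum a (f : l2 R (J a)) :
  sqsum (fun p : JA => untag 0 (fun k : J a => f k) p) = (l2norm f ^+ 2)%:E.
Proof.
rewrite (sqsum_fibres fib_sigma) /=.
pose h b := if b == a then l2norm f ^+ 2 else 0.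
have -> : l2norm f ^+ 2 = h a by rewrite /h eqxx.
rewrite -(@esum_single _ _ h a) /h {h}.
- apply: eq_esum => b _; case: (eqVneq b a) => [e|ba].
    case: a / e f => f; rewrite l2norm_sqr; congr sqsum; apply/funext => k.
    by rewrite untag_Tagged.
  rewrite /sqsum esum1// => k _; rewrite untag_dflt ?abs20//.
- by rewrite eqxx sqr_ge0.
- by move=> b /negPf ->.
Qed.

Lemma inclE a (f : l2 R (J a)) p : Defs.incl f p = untag 0 (fun k : J a => f k) p.
Proof. by apply: mkl2E; apply: (@sqsummable_le _ _ _ (l2norm f ^+ 2)); rewrite incl_sqsum. Qed.

Lemma incl_Tagged a (f : l2 R (J a)) k : Defs.incl f (Tagged J k) = f k.
Proof. by rewrite inclE untag_Tagged. Qed.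

Lemma incl_other a (f : l2 R (J a)) p : tag p != a -> Defs.incl f p = 0.
Proof. by move=> pa; rewrite inclE untag_dflt. Qed.

Lemma bounded_incl a : bounded_op (@Defs.incl R A J a).
Proof.
split.
  apply: mk_linear => c f g; apply: l2_ext => p; rewrite l2DE l2ZE.
  have [e|pa] := eqVneq (tag p) a; last by rewrite !incl_other// mulr0 addr0.
  by case: p e => b k /= e; case: a / e f g => f g; rewrite !incl_Tagged l2DE l2ZE.
exists 1 => f; rewrite mul1r -(ler_pXn2r (n := 2)) ?nnegrE ?l2norm_ge0//.
rewrite -lee_fin -incl_sqsum l2norm_sqr (_ : l2val (Defs.incl f) = untag 0 (fun k : J a => f k))//.
by apply/funext => p; exact: inclE.
Qed.

Lemma bounded_fib (K : A -> choiceType) (L : choiceType) (P : fibration K L) a :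
  bounded_op (fib P a : op R L (K a)).
Proof.
split; first by apply: mk_linear => c x y; exact: fib_linear.
by exists 1 => x; rewrite mul1r l2norm_fib.
Qed.

Lemma adj_incl a : adj (@Defs.incl R A J a) = fib fib_sigma a.
Proof.
have bi := bounded_incl a; have bf := bounded_fib fib_sigma a.
apply: (adj_eq bf) => x y.
apply: (bform_ext (bform_of_op bf) (adj_form bi)) => p k {x y}.
rewrite [LHS]dot_bvecr [RHS]dot_bvecl [in LHS]fibE [in LHS]/= [in LHS]bvecE.
have [e|pa] := eqVneq (tag p) a; last first.
  rewrite incl_other// conjc0 (_ : (Tagged J k == p) = false)//.
  by apply/eqP => e; rewrite -e eqxx in pa.
case: p e => b l /= e; case: a / e k {bi bf} => k.
rewrite incl_Tagged bvecE eq_Tagged /= eq_sym.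
by case: (l == k); rewrite ?conjc1 ?conjc0.
Qed.

End Inclusion.

Section DirectSum.
Variables (R : realType) (G : cqg R) (A : choiceType) (n : A -> nat).
Notation I := (cqg_idx G).
Notation B := (bop R I).
Notation Jn := (fun a => 'I_(n a) : choiceType).
Notation JA := {a : A & 'I_(n a)}.
Variable u : forall a, 'M[B]_(n a).
Variable c : R.
Hypotheses (c0 : 0 <= c) (uc : forall a, mxnorm_le (u a) c).

Definition fib_block : fibration (fun a => (I * 'I_(n a))%type) (I * JA)%type.
Proof.
apply: (@Fibration A (fun a => (I * 'I_(n a))%type) (I * JA)%type
  (fun a p => (p.1, Tagged (fun a => 'I_(n a)) p.2)) (fun p => tag p.2)
  (fun p => (p.1, tagged p.2))).
- by case=> i []. - by [].
- by move=> a [i k] [j l] /= [-> /eqP]; rewrite eq_Tagged /= => /eqP ->.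
Defined.

Definition dsum : op R (I * JA)%type (I * JA)%type :=
  bdiag fib_block fib_block (fun a => ofmx_fun (u a)).

Let ulin a : linear (ofmx_fun (u a)). Proof. by have [] := bounded_ofmx (u a). Qed.

Lemma bounded_dsum : bounded_op dsum.
Proof. exact: (bdiag_bounded fib_block fib_block c0 ulin uc). Qed.

Lemma dsum_norm f : l2norm (dsum f) <= c * l2norm f.
Proof. exact: (bdiag_norm fib_block fib_block c0 uc). Qed.

Lemma fib_dsum f a : fib fib_block a (dsum f) = ofmx_fun (u a) (fib fib_block a f).
Proof. exact: (fib_bdiag fib_block fib_block c0 uc). Qed.

Let tg a (k : 'I_(n a)) : JA := Tagged (fun a => 'I_(n a)) k.

Lemma colv_fib_block (f : l2 R (I * JA)%type) a (k : 'I_(n a)) : colv k (fib fib_block a f) = colv (tg k) f.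
Proof. by apply: l2_ext => i; rewrite [LHS]colvE [LHS]fibE [RHS]colvE. Qed.

Lemma colv_dsum (f : l2 R (I * JA)%type) a (k : 'I_(n a)) : colv (tg k) (dsum f) = \sum_l u a k l (colv (tg l) f).
Proof.
apply: etrans (esym (colv_fib_block (dsum f) k)) _; rewrite fib_dsum colv_ofmx.
by apply: eq_bigr => l _; rewrite (colv_fib_block f l).
Qed.

Lemma gcoef_dsum a (k l : 'I_(n a)) : gcoef dsum (tg k) (tg l) = bval (u a k l).
Proof.
apply/funext => x; rewrite (gcoefE _ _ _ bounded_dsum) colv_dsum (bigD1 l)//= [X in _ + X]big1.
  by rewrite colv_tens bvecE eqxx scale1r addr0.
move=> m ml; rewrite colv_tens bvecE eq_Tagged /= (negPf ml) scale0r.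
exact: (linop0 (@bop_lin _ _ _)).
Qed.

Lemma gcoef_dsum_other (p q : JA) : tag p != tag q -> gcoef dsum p q = 0.
Proof.
case: p q => a k [b l] /= ab; apply/funext => x.
rewrite (gcoefE _ _ _ bounded_dsum) -/(tg k) colv_dsum big1// => m _.
rewrite colv_tens bvecE (_ : (tg m == _) = false) ?scale0r; last first.
  by apply/eqP => e; move: ab; rewrite -[a]/(tag (tg m)) e eqxx.
exact: (linop0 (@bop_lin _ _ _)).
Qed.

Lemma amp_r_incl a (f : l2 R (I * 'I_(n a))%type) i p :
  amp_r (@Defs.incl R A Jn a) f (i, p) = @Defs.incl R A Jn a (rowv i f) p.
Proof. exact: (amp_rE (@bounded_incl R A Jn a)). Qed.

Lemma amp_r_adj_incl a (f : l2 R (I * JA)%type) :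
  amp_r (adj (@Defs.incl R A Jn a)) f = fib fib_block a f.
Proof.
apply: l2_ext => -[i k]; rewrite (amp_rE (bounded_adj (@bounded_incl R A Jn a))).
apply: etrans (congr1 (fun F : op R JA 'I_(n a) => F (rowv i f) k) (@adj_incl R A Jn a)) _.
apply: etrans (@fibE R A Jn JA (fib_sigma Jn) a (rowv i f) k) _.
apply: etrans (rowvE i f (Tagged (fun a => 'I_(n a)) k)) _.
exact: esym (@fibE R A _ _ fib_block a f (i, k)).
Qed.

(** The strong convergence required of a direct sum: once the summands met by a
    truncation of [f] are included, the error is at most its tail. *)
Lemma sum_summands (f : l2 R (I * JA)%type) (e : R) : 0 < e ->
  exists F : {fset A}, forall F' : {fset A}, (F `<=` F')%fset ->
  l2norm (\sum_(a <- F') amp_r (@Defs.incl R A Jn a) (fib fib_block a f) - f) < e.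
Proof.
move=> e0; have [s us hs] := l2_approx f e0.
exists [fset x in [seq tag p.2 | p <- s]]%fset => F' FF'.
apply: le_lt_trans hs; rewrite -l2normN opprB; apply: l2norm_le_abs2 => -[i p].
have term a : amp_r (@Defs.incl R A Jn a) (fib fib_block a f) (i, p) = if tag p == a then f (i, p) else 0.
  rewrite amp_r_incl; case: eqVneq => [pa|pa]; last exact: incl_other.
  case: p pa => b k /= pa; case: a / pa.
  apply: etrans (@incl_Tagged R A Jn b (rowv i (fib fib_block b f)) k) _.
  by rewrite [LHS]rowvE [LHS]fibE.
have S : \sum_(a <- F') amp_r (@Defs.incl R A Jn a) (fib fib_block a f) (i, p) =
    if tag p \in F' then f (i, p) else 0.
  rewrite (eq_bigr _ (fun a _ => term a)); case: ifPn => pF.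
    rewrite (bigD1_seq (tag p)) ?fset_uniq//= eqxx big1 ?addr0// => a /negPf ap.
    by rewrite eq_sym ap.
  rewrite big_seq big1// => a aF; case: eqP => // pa.
  by rewrite pa aF in pF.
rewrite !l2DE !l2NE l2sumE S l2truncE//; case: ifPn => pF.
  by rewrite subrr abs20 abs2_ge0.
rewrite ifF//; apply/negP => ps; move/negP: pF; apply.
by apply: (fsubsetP FF'); rewrite in_fset; apply/mapP; exists (i, p).
Qed.

Lemma is_direct_sum_dsum : is_direct_sum (fun a => ofmx_fun (u a)) dsum.
Proof.
split.
- exists c => a; split; first exact: bounded_ofmx.
  apply: ge_sup; first by exists (l2norm (ofmx_fun (u a) 0)), 0 => //=; rewrite l2norm0.
  move=> _ [x /= x1 <-]; apply: le_trans (uc x) _.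
  by rewrite -[leRHS]mulr1 ler_wpM2l.
- exact: bounded_dsum.
move=> z e e0; have [F HF] := sum_summands (dsum z) e0; exists F => F' FF'; cbv zeta.
have E : \sum_(a <- F') amp_r (@Defs.incl R A Jn a)
      (ofmx_fun (u a) (amp_r (adj (@Defs.incl R A Jn a)) z)) =
    \sum_(a <- F') amp_r (@Defs.incl R A Jn a) (fib fib_block a (dsum z)).
  apply: eq_bigr => a _; rewrite fib_dsum.
  exact: (congr1 (fun g => amp_r (@Defs.incl R A Jn a) (ofmx_fun (u a) g)) (amp_r_adj_incl a z)).
exact: (eq_ind_r (fun s => is_true (l2norm (s - dsum z) < e)) (HF F' FF') E).
Qed.

Lemma opnorm_dsum : opnorm dsum <= c.
Proof.
apply: ge_sup; first by exists (l2norm (dsum 0)), 0 => //=; rewrite l2norm0.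
move=> _ [x /= x1 <-]; apply: le_trans (dsum_norm x) _.
by rewrite -[leRHS]mulr1 ler_wpM2l.
Qed.

Lemma representation_dsum : (forall a, corep (u a)) -> representation dsum.
Proof.
move=> cu; have HM := Linf_vN G.
have HV : vN_tens (Linf G) (Bop _) dsum.
  apply: (vN_tens_gcoef HM bounded_dsum) => -[a k] [b l].
  have [e|ab] := eqVneq a b; last by rewrite gcoef_dsum_other//; exact: vN0 HM.
  by case: b / e l => l; rewrite gcoef_dsum; have [H _] := cu a; exact: H.
split=> //; apply: (hom_tens_gcoef HV) => p [b l].
rewrite (gcoef_legs bounded_dsum (s := [seq tg k | k <- index_enum 'I_(n b)])); last 2 first.
- rewrite map_inj_uniq ?index_enum_uniq// => k k' /eqP.
  by rewrite eq_Tagged => /eqP.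
- move=> r rs; apply: gcoef_dsum_other; apply/eqP => /= e.
  case: r e rs => a m /= e; case: b / e l => l /negP; apply.
  by apply/mapP; exists m => //; rewrite mem_index_enum.
rewrite big_map.
case: p => a k; have [e|ab] := eqVneq a b.
  case: b / e l => l; rewrite gcoef_dsum; have [_ ->] := cu a.
  by apply: eq_bigr => m _; rewrite !gcoef_dsum.
rewrite (gcoef_dsum_other (p := tg k) (q := tg l) ab) comul0 big1// => m _.
rewrite (gcoef_dsum_other (p := tg k) (q := tg m) ab) gcoef_dsum.
exact: (op_tens0l (u b m l)).
Qed.

End DirectSum.

(** * Nondegeneracy and compression to the summands *)

Section LinSpan.
Variables (R : realType) (V : lmodType R[i]) (D : set V).

Lemma lin_span0 : lin_span D 0.
Proof.
exists 0%N, (fun _ => 0), (fun _ => 0).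
by split=> [[]//|]; rewrite big_ord0.
Qed.

Lemma lin_spanDZ (c : R[i]) x y : D x -> lin_span D y -> lin_span D (c *: x + y).
Proof.
move=> Dx [n [a [d [Hd ->]]]].
exists n.+1, (fun i => if unlift ord0 i is Some j then a j else c),
  (fun i => if unlift ord0 i is Some j then d j else x).
split=> [i|]; first by case: unliftP.
rewrite big_ord_recl unlift_none; congr (_ + _).
by apply: eq_bigr => i _; rewrite liftK.
Qed.

Lemma lin_span_add (x y : V) : lin_span D x -> lin_span D y -> lin_span D (x + y).
Proof.
move=> [n [a [d [Hd ->]]]] Hy; elim: n a d Hd => [|n IH] a d Hd.
  by rewrite big_ord0 add0r.
rewrite big_ord_recl -addrA; apply: lin_spanDZ; first exact: Hd.
by apply: (IH (fun i => a (lift ord0 i)) (fun i => d (lift ord0 i))) => i; exact: Hd.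
Qed.

Lemma lin_spanZ (c : R[i]) x : lin_span D x -> lin_span D (c *: x).
Proof.
move=> [n [a [d [Hd ->]]]]; exists n, (fun i => c * a i), d; split=> //.
by rewrite scaler_sumr; apply: eq_bigr => i _; rewrite scalerA.
Qed.

Lemma lin_span_sum (T : Type) (s : seq T) (F : T -> V) :
  (forall t, lin_span D (F t)) -> lin_span D (\sum_(t <- s) F t).
Proof.
move=> H; elim: s => [|t s IH]; first by rewrite big_nil; exact: lin_span0.
by rewrite big_cons; exact: lin_span_add.
Qed.

Lemma lin_span_gen x : D x -> lin_span D x.
Proof.
by move=> Dx; rewrite -[x]addr0 -[x]scale1r; apply: lin_spanDZ => //; exact: lin_span0.
Qed.

End LinSpan.

(** For a vector functional, slicing the first leg is again slicing with two
    vectors. *)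
Lemma dot_fslice_l (R : realType) (I J : choiceType) (X : op R (I * J)%type (I * J)%type)
    (x y : l2 R I) a b : bounded_op X ->
  dot (fslice_l (fun T : op R I I => dot (T x) y) X a) b = dot (X (tens x a)) (tens y b).
Proof.
move=> bX; have [lX _] := bX; have [c c0 Hc] := bounded_ge0 bX.
pose B1 (a b : l2 R J) := dot (X (tens x a)) (tens y b).
have bB : bform B1.
  split=> [d u v w|d u v w|]; rewrite /B1.
  - by rewrite tensDr tensZr (linop lX) (dotDl (d *: X _)) (dotZl d (X _)).
  - by rewrite tensDr tensZr dotDr dotZr.
  exists (c * l2norm x * l2norm y); first by rewrite !mulr_ge0 ?l2norm_ge0.
  move=> u v; apply: le_trans (slice_r_bound c0 Hc u v x y) _.
  by rewrite le_eqVlt; apply/orP; left; apply/eqP; ring.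
have [_ H] := op_of_formP bB.
rewrite -[RHS](H a b); congr (dot (op_of_form _ a) b).
apply/funext => u; apply/funext => v; exact: dot_slice_r.
Qed.

Section DirectSumProperties.
Variables (R : realType) (G : cqg R) (A : choiceType) (n : A -> nat).
Notation I := (cqg_idx G).
Notation B := (bop R I).
Notation JA := {a : A & 'I_(n a)}.
Variable u : forall a, 'M[B]_(n a).
Variable c : R.
Hypotheses (c0 : 0 <= c) (uc : forall a, mxnorm_le (u a) c).

Let v := dsum u.
Let bv : bounded_op v. Proof. exact: bounded_dsum c0 uc. Qed.
Let tg a (k : 'I_(n a)) : JA := Tagged (fun a => 'I_(n a)) k.

Lemma unit_vector : exists x : l2 R I, dot x x = 1.
Proof.
have [[i _]|none] := pselect (exists i : I, True).
  by exists (bvec R i); rewrite dot_bvecr bvecE eqxx.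
have H (x : l2 R I) : x = 0 by apply: l2_ext => i; case: none; exists i.
have : scal I (1 : R[i]) = scal I 0 by apply: bop_ext => x; rewrite [LHS]H [RHS]H.
by move/(@scal_inj R G)/eqP; rewrite oner_eq0.
Qed.

(** If [u_a p = 1] then the vector functionals [T |-> (T p_jk x, x)] recover
    the basis vector [e_k] of the summand [a] from [u_a]. *)
Lemma nondegenerate_dsum : (forall a, exists p, u a *m p = 1%:M) -> nondegenerate_rep v.
Proof.
move=> Hp; have HM := Linf_vN G; have [x x1] := unit_vector.
pose D : set (l2 R JA) := [set y | exists w x, normal_functional (Linf G) w /\ y = fslice_l w v x].
have Dq (y : l2 R I) q : D (fslice_l (fun T : op R I I => dot (T y) x) v (bvec R q)).
  exists (fun T : op R I I => dot (T y) x), (bvec R q); split=> //.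
  by apply: vector_functional => b; exact: (vN_bounded HM).
have Hb (q : JA) : lin_span D (bvec R q).
  case: q => a k; have [p up] := Hp a.
  have -> : bvec R (tg k) = \sum_j fslice_l (fun T : op R I I => dot (T (p j k x)) x) v (bvec R (tg j)).
    apply: l2_ext => -[b i]; rewrite -/(tg i) bvecE l2sumE.
    have E j : fslice_l (fun T : op R I I => dot (T (p j k x)) x) v (bvec R (tg j)) (tg i) =
        dot (gcoef v (tg i) (tg j) (p j k x)) x.
      by rewrite -[LHS]dot_bvecr (dot_fslice_l _ _ _ _ bv) dot_tens_bvec (gcoefE _ _ _ bv).
    rewrite (eq_bigr _ (fun j _ => E j)).
    have [ba|ba] := eqVneq b a; last first.
      rewrite big1 => [|j _]; last by rewrite (gcoef_dsum_other c0 uc)// dot0l.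
      by rewrite (_ : (tg i == tg k) = false)//; apply/eqP => /(congr1 tag)/= /eqP; rewrite (negPf ba).
    case: a / ba k p up {E} => k p up.
    rewrite eq_Tagged /=.
    transitivity (dot ((u b *m p) i k x) x).
      by rewrite up mxE; case: (i == k); rewrite ?bop1 ?x1// bop0 dot0l.
    rewrite mxE bop_sum dot_suml; apply: eq_bigr => j _.
    by rewrite (gcoef_dsum c0 uc) bopM.
  by apply: lin_span_sum => j; apply: lin_span_gen; exact: Dq.
move=> z e e0; have [s us hs] := l2_approx z e0; exists (l2trunc s z) => //.
by apply: lin_span_sum => q; apply: lin_spanZ; exact: Hb.
Qed.

Lemma dsum_tens x a (j : 'I_(n a)) :
  v (tens x (bvec R (tg j))) = \sum_l tens (u a l j x) (bvec R (tg l)).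
Proof.
apply: colv_ext => -[b i]; rewrite -/(tg i) -(gcoefE _ _ _ bv) colv_sum.
have [ba|ba] := eqVneq b a; last first.
  rewrite (gcoef_dsum_other c0 uc)// big1// => l _; rewrite colv_tens bvecE.
  rewrite (_ : (tg i == tg l) = false) ?scale0r//.
  by apply/eqP => /(congr1 tag)/= /eqP; rewrite (negPf ba).
case: a / ba j => j; rewrite (gcoef_dsum c0 uc) (bigD1 i)//= [X in _ + X]big1 ?addr0.
  by rewrite colv_tens bvecE eqxx scale1r.
by move=> l li; rewrite colv_tens bvecE eq_Tagged /= eq_sym (negPf li) scale0r.
Qed.

(** ** Compressing a similarity to a summand *)

Variables (T T' : op R JA JA).
Hypotheses (bT : bounded_op T) (bT' : bounded_op T') (TT : T' \o T = id).
Hypothesis uT : unitary (amp_r T \o v \o amp_r T' : op R (I * JA)%type (I * JA)%type).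

Definition gram a : 'M[R[i]]_(n a) :=
  \matrix_(i, j) dot (T (bvec R (tg j))) (T (bvec R (tg i))).

Let amp_inv f : amp_r T' (amp_r T f) = f :> l2 R (I * JA)%type.
Proof.
have bA := bounded_amp_r I bT; have bA' := bounded_amp_r I bT'.
suff H : amp_r T' \o amp_r T = id :> op R (I * JA)%type (I * JA)%type.
  exact: (congr1 (fun F => F f) H).
apply: (op_tens_ext (bounded_op_comp bA' bA) (bounded_op_id _ _)) => x y.
rewrite /= (amp_r_tens _ _ bT) (amp_r_tens _ _ bT').
by congr tens; have := congr1 (fun F => F y) TT.
Qed.

Let dot_inv f g : dot (amp_r T (v f)) (amp_r T (v g)) = dot (amp_r T f) (amp_r T g).
Proof.
have [bU U1 _] := uT.
have H := congr1 (fun F => F (amp_r T g)) U1; rewrite /= amp_inv in H.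
have := dot_adjr (amp_r T f) (amp_r T (v g)) bU.
by rewrite /= amp_inv H => <-.
Qed.

(** The similarity makes the direct sum unitary for the inner product
    [(T x, T y)], and each summand is invariant. *)
Lemma gram_invariant a : mxstar (u a) *m mxsc _ (gram a) *m u a = mxsc _ (gram a).
Proof.
apply/matrixP => i j; apply: bop_dot => x y.
have e k (z : l2 R I) : amp_r T (tens z (bvec R (tg k))) = tens z (T (bvec R (@tg a k))).
  exact: amp_r_tens.
have E := dot_inv (tens x (bvec R (tg j))) (tens y (bvec R (@tg a i))).
have [lA _] := bounded_amp_r I bT.
have vE w k : amp_r T (v (tens w (bvec R (tg k)))) =
    \sum_l tens (u a l k w) (T (bvec R (tg l))).
  by rewrite dsum_tens (linop_sum lA); apply: eq_bigr => l _; rewrite e.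
have {}E := etrans (esym (congr2 (@dot _ _) (vE x j) (vE y i)))
  (etrans E (congr2 (@dot _ _) (e j x) (e i y))).
rewrite [RHS]dot_tens dot_suml in E.
rewrite mxscE /scal bopZ bop1 dotZl [gram a i j]mxE [RHS]mulrC -E mxE bop_sum dot_suml.
apply: eq_bigr => l _; rewrite mxE mulr_suml bop_sum dot_suml dot_sumr.
apply: eq_bigr => k _; rewrite dot_tens mxscE mxstarE scal_r -bscaleAl bopZ bopM.
rewrite dotZl dot_starl; apply: etrans (mulrC _ _) _.
exact: (congr1 ( *%R (dot (u a l j x) (u a k i y))) (mxE _ _ k l)).
Qed.

End DirectSumProperties.

(** * Invariant forms on a deformed contragredient *)

Section InvariantForms.
Variables (R : realType) (G : cqg R) (n : nat) (Q : 'M[R[i]]_n).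
Notation B := (bop R (cqg_idx G)).
Hypothesis Qpos : forall i, 0 < complex.Re (Q i i).
Hypothesis Qdiag : forall i j, Q i j = (complex.Re (Q i i))%:C *+ (i == j).
Variable U : 'M[B]_n.
Hypotheses (iU : irredmat U) (cU : corep U) (uU : unitmat U).
Let V := mxbar U.
Hypothesis VQ : mxstar V *m mxsc _ Q *m V = mxsc _ Q.

Let Qs t := mxsc (cqg_idx G) (mxpow Q t).

Let QsNr t : Qs t *m Qs (- t) = 1%:M.
Proof. by rewrite /Qs -mxscM mxpowNr// mxsc1. Qed.
Let QsNl t : Qs (- t) *m Qs t = 1%:M.
Proof. by rewrite /Qs -mxscM mxpowNl// mxsc1. Qed.

Lemma qbar_right_inv t : exists P, qbar Q U t *m P = 1%:M.
Proof.
set W := mxsc _ (hmx (V *m mxstar V)) *m mxstar V *m mxsc _ (invmx (hmx (V *m mxstar V))).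
have VW : V *m W = 1%:M by exact: contragredient_inv_r.
exists (Qs t *m W *m Qs (- t)).
transitivity (Qs t *m (V *m (Qs (- t) *m Qs t) *m W) *m Qs (- t)).
  by rewrite /qbar -/V -/(Qs t) -/(Qs (- t)) !mulmxA.
by rewrite QsNl mulmx1 VW mulmx1 QsNr.
Qed.

(** If [P] is invariant under [Q^t V Q^-t], then [Y = Q^t P Q^t] is invariant
    under [V], as [Q] is.  Comparing the two, [Y Q^-1] commutes with [V^*], so by
    irreducibility [Y] is a multiple of [Q]. *)
Lemma invariant_form t (P : 'M[R[i]]_n) :
  mxstar (qbar Q U t) *m mxsc _ P *m qbar Q U t = mxsc _ P ->
  exists c, P = c *: mxpow Q (1 - 2 * t).
Proof.
move=> HP; pose Y := mxpow Q t *m P *m mxpow Q t.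
have [W VW] : exists W, V *m W = 1%:M.
  exists (mxsc _ (hmx (V *m mxstar V)) *m mxstar V *m mxsc _ (invmx (hmx (V *m mxstar V)))).
  exact: contragredient_inv_r.
have HY : mxstar V *m mxsc _ Y *m V = mxsc _ Y.
  have -> : mxsc _ Y = Qs t *m mxsc _ P *m Qs t by rewrite /Y !mxscM.
  have HP' := congr1 (fun Z => Qs t *m Z *m Qs t) HP.
  rewrite (star_qbar Q U t) /= in HP'; rewrite -[RHS]HP' /qbar -/V -/(Qs t) -/(Qs (- t)).
  transitivity ((Qs t *m Qs (- t)) *m mxstar V *m Qs t *m mxsc _ P *m Qs t *m V *m
    (Qs (- t) *m Qs t)); first by rewrite QsNr QsNl mul1mx mulmx1 !mulmxA.
  by rewrite !mulmxA.
have Q1 : mxsc (cqg_idx G) (mxpow Q (- 1)) *m mxsc _ Q = 1%:M.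
  by rewrite -{2}(mxpow1 Qpos Qdiag) QsNl.
have WE : W = Qs (- 1) *m mxstar V *m mxsc _ Q.
  apply: (left_right_inv _ VW); rewrite -!mulmxA [X in _ *m X]mulmxA VQ.
  exact: Q1.
pose Z := Y *m mxpow Q (- 1).
have HZ : mxstar V *m mxsc _ Z = mxsc _ Z *m mxstar V.
  have h : mxstar V *m mxsc _ Y = mxsc _ Y *m W.
    by rewrite -{2}HY -mulmxA VW mulmx1.
  rewrite /Z mxscM mulmxA h WE -!mulmxA.
  have Q1r : mxsc (cqg_idx G) Q *m mxsc _ (mxpow Q (- 1)) = 1%:M.
    by rewrite -{1}(mxpow1 Qpos Qdiag) QsNr.
  by rewrite Q1r mulmx1.
have HZ' : mxsc _ (ctrmx Z) *m V = V *m mxsc _ (ctrmx Z).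
  have := congr1 (@mxstar _ _ _ _) HZ.
  by rewrite !mxstarM mxstarK !mxstar_sc.
have [c Hc] := irred_bar iU HZ'.
exists c^*.
have ZE : Z = (c^*)%:M.
  have <- : ctrmx (ctrmx Z) = Z by apply/matrixP => i j; rewrite mxE [ctrmx Z j i]mxE conjcK.
  rewrite Hc; apply/matrixP => i j; rewrite !mxE eq_sym.
  by case: (i == j); rewrite ?mulr1n// !mulr0n conjc0.
have YE : Y = c^* *: Q.
  have := congr1 (fun M => M *m Q) ZE; rewrite /= /Z -mulmxA.
  have := mxpowNl Qpos 1; rewrite (mxpow1 Qpos Qdiag) => ->.
  by rewrite mulmx1 mul_scalar_mx.
have PE : P = mxpow Q (- t) *m Y *m mxpow Q (- t).
  by rewrite /Y !mulmxA mxpowNl// mul1mx -mulmxA mxpowNr// mulmx1.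
rewrite PE YE -scalemxAr -scalemxAl; congr (_ *: _).
have -> : 1 - 2 * t = - t + 1 + - t by lra.
by rewrite (mxpowD Qpos (- t + 1)) (mxpowD Qpos (- t) 1) (mxpow1 Qpos Qdiag).
Qed.

End InvariantForms.

(** * Boundedness and failure of unitarizability *)

Lemma opnorm_diag (R : realType) n (D : 'M[R[i]]_n) (d : 'I_n -> R) (c : R) : 0 <= c ->
  (forall i j, D i j = (d i)%:C *+ (i == j)) -> (forall i, `|d i| <= c) ->
  opnorm (mxop D) <= c.
Proof.
move=> c0 HD Hd; apply: ge_sup; first by exists (l2norm (mxop D 0)), 0 => //=; rewrite l2norm0.
move=> _ [x /= x1 <-].
suff H : l2norm (mxop D x) <= l2norm (c%:C *: x).
  apply: le_trans H _; rewrite l2normZ normc_real// -[leRHS]mulr1 ler_wpM2l//.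
have DE i : mxop D x i = (d i)%:C * x i.
  rewrite mxopE (bigD1 i)//= [X in _ + X]big1 ?addr0; first by rewrite HD eqxx.
  by move=> j ji; rewrite HD eq_sym (negPf ji) mulr0n mul0r.
apply: l2norm_le_abs2 => i; rewrite DE l2ZE !abs2M; apply: ler_wpM2r; first exact: abs2_ge0.
rewrite /abs2 /= !expr0n /= !addr0 -[d i ^+ 2]real_normK ?num_real//.
by rewrite ler_pXn2r ?nnegrE.
Qed.

Lemma opnorm_ge0 (R : realType) (I J : choiceType) (T : op R I J) : bounded_op T -> 0 <= opnorm T.
Proof.
move=> bT; have [c c0 Hc] := bounded_ge0 bT; have [lT _] := bT.
apply: ub_le_sup; last by exists 0; rewrite /= ?l2norm0// (linop0 lT) l2norm0.
exists c => _ [x /= x1 <-]; apply: le_trans (Hc x) _.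
by rewrite -[leRHS]mulr1 ler_wpM2l.
Qed.

Lemma exists_max (R : realType) n (f : 'I_n -> R) : (0 < n)%N -> exists i, forall j, f j <= f i.
Proof.
move=> n0; case: (@arg_maxP _ _ _ (Ordinal n0) xpredT f isT) => i _ Hi.
by exists i => j; exact: Hi.
Qed.

Theorem corollary3p8 (R : realType) (G : cqg R) (X : irr_system G)
    (S : op R (cqg_idx G) (cqg_idx G) -> op R (cqg_idx G) (cqg_idx G))
    (Q : forall alpha : Irr X, 'M[R[i]]_(irr_dim X alpha))
    (E : set (Irr X)) (C : R) :
  ~ Kac G ->
  antipode X S ->
  (forall alpha, modular_operator S (irr_rep X alpha) (Q alpha)) ->
  ereal_sup [set (ln (opnorm (mxop (Q alpha)) * opnorm (mxop (invmx (Q alpha))))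
                  / ln (1 + (irr_dim X alpha)%:R))%:E | alpha in E] = +oo%E ->
  1 < C < 2 ->
  let theta (alpha : Irr X) : R := 1 - ln C / ln (1 + (irr_dim X alpha)%:R) in
  (forall alpha, E alpha -> 0 <= theta alpha <= 1) /\
  exists v : op R (cqg_idx G * {alpha : E & 'I_(irr_dim X (val alpha))})%type
                  (cqg_idx G * {alpha : E & 'I_(irr_dim X (val alpha))})%type,
    [/\ is_direct_sum (fun alpha : E =>
          deformed_contragredient (irr_rep X (val alpha)) (Q (val alpha))
            (theta (val alpha))) v,
        representation v /\ nondegenerate_rep v,
        opnorm v <= C
      & ~ unitarizable v].
Proof.
move=> _ HS HQ Hsup /andP[C1 C2] theta.
pose N (alpha : Irr X) : R := 1 + (irr_dim X alpha)%:R.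
pose U (alpha : Irr X) := projT1 (cid (irreducible_matrix (irr_repP alpha))).
have HU (alpha : Irr X) := projT2 (cid (irreducible_matrix (irr_repP alpha))).
have UE alpha : irr_rep X alpha = ofmx_fun (U alpha) by have [] := HU alpha.
have cU alpha : corep (U alpha) by have [] := HU alpha.
have uU alpha : unitmat (U alpha) by have [] := HU alpha.
have iU alpha : irredmat (U alpha) by have [] := HU alpha.
have n0 alpha : (0 < irr_dim X alpha)%N by have [] := HU alpha.
have pos (alpha : Irr X) := modular_pos (HQ alpha).
have dg (alpha : Irr X) := modular_diag (HQ alpha).
have inv (alpha : Irr X) := modular_invariant HS (UE alpha) (cU alpha) (uU alpha) (iU alpha) (n0 alpha) (HQ alpha).
have uW (alpha : Irr X) := qbar_half_unitary HS (UE alpha) (cU alpha) (uU alpha) (iU alpha) (n0 alpha) (HQ alpha).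
have C0 : 0 < C by apply: lt_trans C1.
have lnC0 : 0 < ln C by rewrite ln_gt0.
have N2 alpha : 2 <= N alpha.
  by rewrite /N -[2]/(1 + 1) lerD2l ler1n.
have lnCN alpha : ln C <= ln (N alpha).
  by rewrite ler_ln ?posrE ?(lt_le_trans _ (N2 alpha))// ltW// (lt_le_trans C2).
have lnN0 alpha : 0 < ln (N alpha) by apply: lt_le_trans (lnCN alpha).
have th alpha : 0 <= theta alpha <= 1.
  rewrite /theta -/(N alpha) subr_ge0 (ler_pdivrMr _ _ (lnN0 alpha)) mul1r lnCN /=.
  by rewrite gerBl; apply: divr_ge0; exact: ltW.
split=> [alpha _|]; first exact: th.
(* The summands, as matrices; their norms are at most [N^(1 - theta)], which is [C]. *)
pose u (alpha : E) := qbar (Q (val alpha)) (U (val alpha)) (theta (val alpha) / 2).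
have cu alpha : corep (u alpha).
  by apply: corep_conj; [exact: mxpowNl (pos _) _|exact: corep_bar].
have uC alpha : mxnorm_le (u alpha) C.
  have /andP[t0 t1] := th (val alpha).
  have -> : C = N (val alpha) `^ (1 - 2 * (theta (val alpha) / 2)).
    have -> : 1 - 2 * (theta (val alpha) / 2) = ln C / ln (N (val alpha)).
      by rewrite /theta -/(N _); lra.
    rewrite /powR gt_eqF ?(lt_le_trans _ (N2 _))// divfK ?gt_eqF//.
    by rewrite lnK ?posrE.
  by apply: (qbar_norm (pos _) (uU _) (uW _)); apply/andP; split; lra.
have VE : (fun alpha : E => deformed_contragredient (irr_rep X (val alpha)) (Q (val alpha))
    (theta (val alpha))) = (fun alpha : E => ofmx_fun (u alpha)).
  apply: functional_extensionality_dep => alpha.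
  by rewrite UE deformed_contragredientE.
have C0' := ltW C0.
exists (dsum u); split.
- by rewrite VE; exact: is_direct_sum_dsum C0' uC.
- split; first exact: representation_dsum C0' uC cu.
  have HR (alpha : E) : exists p, u alpha *m p = 1%:M.
    exact: (qbar_right_inv (pos (val alpha)) (cU _) (uU _)).
  exact: (nondegenerate_dsum C0' uC HR).
- exact: opnorm_dsum C0' uC.
move=> [T [T' [bT bT' TT' T'T uT]]].
have [k k0 Hk] := bounded_ge0 bT; have [k' k'0 Hk'] := bounded_ge0 bT'.
(* The square of a bound on the condition number of the similarity. *)
pose kappa := (k * k') ^+ 2.
pose q alpha i := complex.Re (Q alpha i i).
(* The exponent [1 - theta] of the invariant forms. *)
pose r alpha := ln C / ln (N alpha).
have r0 alpha : 0 < r alpha by rewrite divr_gt0.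
(* The invariant form on each summand is [c Q^r]; its diagonal entries are the
   squared norms of the [T e_l], which lie between [k'^-2] and [k^2]. *)
have ratio (alpha : E) i j : q (val alpha) i `^ r (val alpha) <=
    kappa * q (val alpha) j `^ r (val alpha).
  have [c Hc] := invariant_form (pos _) (dg _) (iU _) (cU _) (uU _) (inv _)
    (gram_invariant C0' uC bT bT' T'T uT alpha).
  pose tv (l : 'I_(irr_dim X (val alpha))) := l2norm (T (bvec R (Tagged (fun alpha : E => 'I_(irr_dim X (val alpha))) l)
    : l2 R {alpha : E & 'I_(irr_dim X (val alpha))})).
  have tE l : complex.Re c * q (val alpha) l `^ r (val alpha) = tv l ^+ 2.
    have := congr1 (fun Z : 'M[R[i]]_(irr_dim X (val alpha)) => Z l l) Hc.
    rewrite [LHS]mxE dotxx [RHS]mxE mxpowE eqxx mulr1n.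
    move/(congr1 (@complex.Re R)); rewrite cReM => /esym.
    have -> : 1 - 2 * (theta (val alpha) / 2) = r (val alpha).
      by rewrite /theta -/(N _) -/(r _); lra.
    by move=> e; apply: etrans e; rewrite /= mulr0 subr0.
  have t_up l : tv l <= k.
    by apply: le_trans (Hk _) _; rewrite l2norm_bvec mulr1.
  have t_lo l : 1 <= k' * tv l.
    apply: le_trans (Hk' _).
    by rewrite -[X in l2norm X]/((T' \o T) _) T'T l2norm_bvec.
  have tv0 l : 0 <= tv l by exact: l2norm_ge0.
  have q0 l : 0 < q (val alpha) l `^ r (val alpha) by exact: powR_gt0 (pos _ _).
  have c_gt0 : 0 < complex.Re c.
    rewrite -(pmulr_lgt0 _ (q0 j)) tE exprn_gt0// lt_neqAle tv0 andbT eq_sym.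
    by apply/eqP => t0; have := t_lo j; rewrite t0 mulr0 ler10.
  rewrite -(ler_pM2l c_gt0) mulrCA !tE /kappa exprMn.
  apply: (@le_trans _ _ (k ^+ 2)); first by rewrite ler_pXn2r ?nnegrE.
  rewrite -mulrA -exprMn ler_peMr ?sqr_ge0// -[leLHS](expr1n _ 2).
  by rewrite ler_pXn2r ?nnegrE ?mulr_ge0.
(* Taking logarithms in [ratio] at the largest and the smallest eigenvalue. *)
have bound alpha : E alpha ->
    ln (opnorm (mxop (Q alpha)) * opnorm (mxop (invmx (Q alpha)))) / ln (N alpha) <=
    ln kappa / ln C.
  move=> Ea; pose a : E := SigSub (mem_set Ea).
  have Ha i j : q alpha i `^ r alpha <= kappa * q alpha j `^ r alpha := ratio a i j.
  have qp i : 0 < q alpha i := pos alpha i.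
  have [i Hi] := exists_max (q alpha) (n0 alpha).
  have [j Hj] := exists_max (fun j => (q alpha j)^-1) (n0 alpha).
  have qr0 l : 0 < q alpha l `^ r alpha by exact: powR_gt0.
  have kappa1 : 1 <= kappa by have := Ha i i; rewrite ler_pMl.
  have opQ : opnorm (mxop (Q alpha)) <= q alpha i.
    apply: (@opnorm_diag _ _ _ (q alpha)); [exact: ltW|exact: dg|].
    by move=> l; rewrite ger0_norm ?Hi// ltW.
  have QV : invmx (Q alpha) = mxpow (Q alpha) (- 1).
    have QQ : Q alpha *m mxpow (Q alpha) (- 1) = 1%:M.
      by have := mxpowNr (pos alpha) 1; rewrite (mxpow1 (pos alpha) (dg alpha)).
    have [uQ _] := mulmx1_unit QQ.
    by rewrite -[LHS]mulmx1 -QQ mulmxA mulVmx// mul1mx.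
  have opQV : opnorm (mxop (invmx (Q alpha))) <= (q alpha j)^-1.
    apply: (@opnorm_diag _ _ _ (fun l => (q alpha l)^-1)).
    - by rewrite invr_ge0 ltW.
    - by move=> l m; rewrite QV mxpowE powR_inv1// ltW// qp.
    - by move=> l; rewrite ger0_norm ?Hj// invr_ge0 ltW.
  have lnq : ln (q alpha i / q alpha j) / ln (N alpha) <= ln kappa / ln C.
    have h : r alpha * (ln (q alpha i) - ln (q alpha j)) <= ln kappa.
      have kp : 0 < kappa := lt_le_trans ltr01 kappa1.
      have kq : 0 < kappa * q alpha j `^ r alpha by rewrite mulr_gt0.
      have lnE : ln (kappa * q alpha j `^ r alpha) = ln kappa + ln (q alpha j `^ r alpha).
        by rewrite lnM ?posrE.
      have : ln (q alpha i `^ r alpha) <= ln (kappa * q alpha j `^ r alpha).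
        by rewrite ler_ln ?posrE ?Ha.
      rewrite lnE (ln_powR (q alpha i)) (ln_powR (q alpha j)).
      by rewrite mulrBr lerBlDr.
    rewrite ln_div ?posrE// ler_pdivlMr//.
    by apply: le_trans h; rewrite mulrC mulrA mulrAC.
  set p := opnorm (mxop (Q alpha)) * _.
  have p_le : p <= q alpha i / q alpha j.
    by apply: ler_pM => //; apply: opnorm_ge0; exact: bounded_mxop.
  (* The logarithm vanishes on nonpositive numbers. *)
  have [p0|p0] := leP p 0.
    rewrite (ln0 p0) mul0r; apply: divr_ge0; last exact: ltW.
    exact: ln_ge0.
  apply: le_trans lnq; rewrite ler_pM2r ?invr_gt0//.
  by rewrite ler_ln ?posrE ?divr_gt0.
have : (ereal_sup [set (ln (opnorm (mxop (Q alpha)) * opnorm (mxop (invmx (Q alpha))))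
    / ln (1 + (irr_dim X alpha)%:R))%:E | alpha in E] <= (ln kappa / ln C)%:E)%E.
  by apply: ge_ereal_sup => _ [alpha Ea <-]; rewrite lee_fin bound.
by rewrite Hsup leye_eq.
Qed.
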